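(* The Insertion algorithm (the specific algorithm written out in full in the context) solves the Tanglegram Single Edge Insertion Problem in $O(n^2)$ time and space, where $n$ is the size of the tanglegram.
   Context: **Tanglegrams and layouts.** A rooted binary tree is a rooted tree in which every vertex has zero or two children; vertices with children are internal, the others are leaves. A tanglegram $(T,S,\phi)$ of size $n$ consists of rooted binary trees $T,S$ with leaves $t_1,\dots,t_n$ and $s_1,\dots,s_n$ and a bijection $\phi:[n]\to[n]$ matching $t_i$ with $s_{\phi(i)}$; the edges $(t_i,s_{\phi(i)})$ are the between-tree edges. Write $w>_T w'$ (resp. $>_S$) if $w$ is a proper ancestor of $w'$ in $T$ (resp. $S$), and $\operatorname{Lf}(w)$ for the set of leaves $\ell\le w$ of the tree containing $w$. A layout is a pair $(X,Y)$ of ordered lists of the leaves of $T$ and of $S$ in which the leaves below each vertex appear consecutively (the top-to-bottom leaf orders of planar embeddings of the trees). $(t_i,s_{\phi(i)})$ and $(t_j,s_{\phi(j)})$ cross if the relative order of $t_i,t_j$ in $X$ is opposite to that of $s_{\phi(i)},s_{\phi(j)}$ in $Y$. A layout is planar if it has no crossings; a tanglegram is planar if it has a planar layout. For $I\subseteq[n]$, $T_I$ is formed by taking the minimal subtree of $T$ containing the leaves indexed by $I$ and suppressing all internal vertices with only one child; the induced subtanglegram is $(T_I,S_{\phi(I)},\phi|_I)$. Layouts restrict to it by taking sublists. **Tanglegram Single Edge Insertion Problem.** Given a tanglegram $(T,S,\phi)$ and a planar subtanglegram $(T_I,S_{\phi(I)},\phi|_I)$ induced by $I=[n]\setminus\{i\}$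 for $i\in[n]$, find a layout of $(T,S,\phi)$ that restricts to a planar layout of $(T_I,S_{\phi(I)},\phi|_I)$ and has the minimal number of crossings possible. **Operations.** PairedFlip$((X,Y),(u,v))$ reverses the block of leaves $\operatorname{Lf}(u)$ in $X$ and the block $\operatorname{Lf}(v)$ in $Y$. SubtreeSwitch$(X,u)$ (resp. $(Y,v)$) interchanges the two consecutive blocks formed by the leaves below the two children of $u$ (resp. $v$), keeping the order inside each block. **ModifiedUntangle$(T,S,\phi|_I)$.** Compute the Boolean table $B$ with $B[u,v]$ True, for $u\in T,v\in S$, iff some $t_j\le_T u$, $j\in I$, has $s_{\phi(j)}\le_S v$. Start with the ordered lists $X=(\text{root of }T)$, $Y=(\text{root of }S)$, the edge set $E=\{(\text{root of }T,\text{root of }S)\}$, and $L=\emptyset$. While $X\cup Y$ contains an internal vertex: let $u$ be an internal vertex in $X\cup Y$ of highest degree in the bipartite graph on $X\cup Y$ with edge set $E$; if $u$ has degree 1, add to $L$ the pair formed by $u$ and its unique neighbor (written with the vertex of $T$ first); then Refine $u$. Here Refine, for $u$ in list $A$ with the other list $(b_1,\dots,b_m)$ and $u_1,u_2$ the children of $u$, replaces each edge $(u,b_j)$ by the edges $(u_r,b_j)$, $r\in\{1,2\}$, for which the table entry of $u_r,b_j$ is True; lets $k=\max\{j:(u_1,b_j)\in E\}$; and replaces $u$ in $A$ by $u_1u_2$ if $j>k$ for all $(u_2,b_j)\in E$, and by $u_2u_1$ otherwise (if $u_1$ has no neighbor, either order may be used). Return $(X,Y)$ and $L$. **Insertion**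 (input: tanglegram $(T,S,\phi)$ of size $n$ and index $i$ such that $(T_I,S_{\phi(I)},\phi|_I)$ is planar for $I=[n]\setminus\{i\}$). *Step 1.* Set $(X,Y),L:=$ ModifiedUntangle$(T,S,\phi|_I)$. Let $L(I)$ be the set of all $(u_{red},v_{red})$ with $(u,v)\in L$ and $|\operatorname{Lf}(u)\cap T_I|=|\operatorname{Lf}(v)\cap S_{\phi(I)}|>1$, where $u_{red}$ is the minimal $u'\le_T u$ with $\operatorname{Lf}(u')\cap T_I=\operatorname{Lf}(u)\cap T_I$, and $v_{red}$ is the minimal $v'\le_S v$ with $\operatorname{Lf}(v')\cap S_{\phi(I)}=\operatorname{Lf}(v)\cap S_{\phi(I)}$. Let $u_0,v_0$ be the parents of $t_i,s_{\phi(i)}$. Let $L(I)_S=\{(u,v)\in L(I):u\not>_T t_i,\ v>_S s_{\phi(i)}\}$ and $L(I)_T=\{(u,v)\in L(I):u>_T t_i,\ v\not>_S s_{\phi(i)}\}$. *Step 2.* If $L(I)_S\ne\emptyset$, let $(u_{Smax},v_{Smax})$ be its element with $>_S$-largest second vertex; if $L(I)_T\neq\emptyset$, let $(u_{Tmax},v_{Tmax})$ be its element with $>_T$-largest first vertex. If $L(I)_S\ne\emptyset$ and $u_0>_T u_{Smax}$, do Case A; else if $L(I)_T\neq\emptyset$ and $v_0>_S v_{Tmax}$, do Case B; else do Case C. Below, ''edges at $Z$'' means the between-tree edges with an endpoint in the leaf set $Z$, other than $(t_i,s_{\phi(i)})$ itself, and ''an edge set is bad'' means that $(t_i,s_{\phi(i)})$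 crosses more than half of its edges in the current layout $(X,Y)$. *Case A.* Order $L(I)_S=\{(u_j,v_j)\}_{j=1}^m$ with $v_1<_S\dots<_S v_m$. Let $E(u_0)$ be the edges at $\operatorname{Lf}(u_0)\setminus\operatorname{Lf}(u_m)$, $E(v_0)$ the edges at $\operatorname{Lf}(v_0)\setminus\{s_{\phi(i)}\}$, and $E(v_j)$ the edges at $\operatorname{Lf}(v_j)\setminus\operatorname{Lf}(v_{j-1})$ for $1\le j\le m$. If $E(u_0)$ is bad, set $X:=$ SubtreeSwitch$(X,u_0)$. For $j=m,\dots,2,1$: if $E(v_j)$ is bad, set $(X,Y):=$ PairedFlip$((X,Y),(u_j,v_j))$. If $E(v_0)$ is bad, set $Y:=$ SubtreeSwitch$(Y,v_0)$. Return $(X,Y)$. *Case B.* Order $L(I)_T=\{(u_j,v_j)\}_{j=1}^m$ with $u_1<_T\dots<_T u_m$. Let $E(v_0)$ be the edges at $\operatorname{Lf}(v_0)\setminus\operatorname{Lf}(v_m)$, $E(u_0)$ the edges at $\operatorname{Lf}(u_0)\setminus\{t_i\}$, and $E(u_j)$ the edges at $\operatorname{Lf}(u_j)\setminus\operatorname{Lf}(u_{j-1})$ for $1\le j\le m$. If $E(v_0)$ is bad, set $Y:=$ SubtreeSwitch$(Y,v_0)$. For $j=m,\dots,2,1$: if $E(u_j)$ is bad, set $(X,Y):=$ PairedFlip$((X,Y),(u_j,v_j))$. If $E(u_0)$ is bad, set $X:=$ SubtreeSwitch$(X,u_0)$. Return $(X,Y)$. *Case C.* Order $L(I)_S=\{(u_j,v_j)\}_{j=1}^k$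 with $v_1<_S\dots<_S v_k$ and $L(I)_T=\{(u_j,v_j)\}_{j=k+1}^{k+m}$ with $u_{k+1}<_T\dots<_T u_{k+m}$ (either may be empty). Let $E(v_j)$ be the edges at $\operatorname{Lf}(v_j)\setminus\operatorname{Lf}(v_{j-1})$ for $1\le j\le k$, $E(u_j)$ the edges at $\operatorname{Lf}(u_j)\setminus\operatorname{Lf}(u_{j-1})$ for $k+2\le j\le k+m$, $E(u_{k+1})$ the edges at $\operatorname{Lf}(u_{k+1})\setminus\operatorname{Lf}(u_0)$, $E(v_0)$ the edges at $\operatorname{Lf}(v_0)\setminus\{s_{\phi(i)}\}$, and $E(u_0)$ the edges at $\operatorname{Lf}(u_0)\setminus\{t_i\}$. For $j=k+m,\dots,k+1$: if $E(u_j)$ is bad, perform PairedFlip at $(u_j,v_j)$. Then for $j=k,\dots,1$: if $E(v_j)$ is bad, perform PairedFlip at $(u_j,v_j)$. If $E(u_0)\cap E(v_0)=\emptyset$: if $(t_i,s_{\phi(i)})$ crosses the edges in $E(u_0)$, set $X:=$ SubtreeSwitch$(X,u_0)$; if it crosses the edges in $E(v_0)$, set $Y:=$ SubtreeSwitch$(Y,v_0)$; return $(X,Y)$. Otherwise, let $X'=$ SubtreeSwitch$(X,u_0)$, $Y'=$ SubtreeSwitch$(Y,v_0)$ and return a layout among $(X,Y),(X',Y),(X,Y'),(X',Y')$ with the fewest crossings.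
   Formalization: In Refine, u is replaced by u_1u_2 if j ≥ k (instead of j > k) for all edges (u_2,b_j); with the strict inequality the returned layout can fail to restrict to a planar one, e.g. T=(0,(1,(2,3))), S=(0,(2,(1,3))), φ=id, i=0. *)

(* Defs.v *)
From HB Require Import structures.
From mathcomp Require Import all_boot all_fingroup.

Set Implicit Arguments.
Unset Strict Implicit.
Unset Printing Implicit Defensive.

(* The two children of an internal vertex are stored in some order, which
   carries no meaning: layouts are quantified over separately, and the
   algorithm only uses the order to name the children u1 and u2. *)
Inductive tree (A : Type) :=
| Leaf of A
| Node of tree A & tree A.

Fixpoint tree_eqb (A : eqType) (t u : tree A) : bool :=
  match t, u with
  | Leaf a, Leaf b => a == b
  | Node t1 t2, Node u1 u2 => tree_eqb t1 u1 && tree_eqb t2 u2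
  | _, _ => false
  end.

Lemma tree_eqP (A : eqType) : Equality.axiom (@tree_eqb A).
Proof.
elim=> [a|t1 IH1 t2 IH2] [b|u1 u2] /=; try by constructor.
  by apply: (iffP eqP) => [->|[]].
apply: (iffP andP) => [[/IH1-> /IH2->] //|[<- <-]].
by split; [apply/IH1 | apply/IH2].
Qed.

HB.instance Definition _ (A : eqType) := hasDecEq.Build (tree A) (@tree_eqP A).

Fixpoint leaves (A : Type) (t : tree A) : seq A :=
  match t with
  | Leaf a => [:: a]
  | Node t1 t2 => leaves t1 ++ leaves t2
  end.

(* When the leaf labels of t are distinct, distinct vertices of t carry
   distinct subtrees, so a vertex w of t is represented by the subtree hanging
   at w.  Then w' is below w iff w' \in vertices w. *)
Fixpoint vertices (A : Type) (t : tree A) : seq (tree A) :=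
  match t with
  | Leaf _ => [:: t]
  | Node t1 t2 => t :: vertices t1 ++ vertices t2
  end.

(* Minimal subtree containing the leaves in I, with the vertices having one
   child suppressed; None when no leaf of t is in I. *)
Fixpoint induced (A : Type) (I : pred A) (t : tree A) : option (tree A) :=
  match t with
  | Leaf a => if I a then Some t else None
  | Node t1 t2 =>
    match induced I t1, induced I t2 with
    | Some u1, Some u2 => Some (Node u1 u2)
    | Some u, None | None, Some u => Some u
    | None, None => None
    end
  end.

(* The leaf t_j of T is Leaf j, and the leaf s_k of S is Leaf k. *)
Record tanglegram (n : nat) := Tanglegram {
  treeT : tree 'I_n;
  treeS : tree 'I_n;
  phi : {perm 'I_n};
  leavesT : perm_eq (leaves treeT) (enum 'I_n);
  leavesS : perm_eq (leaves treeS) (enum 'I_n)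
}.

(* A pair (X, Y) of lists of labels of leaves of T and of S. *)
Definition layout (n : nat) := (seq 'I_n * seq 'I_n)%type.

Definition consecutive (A : eqType) (Z X : seq A) : Prop :=
  exists p q r, X = p ++ q ++ r /\ perm_eq q Z.

Definition leaf_order (A : eqType) (t : option (tree A)) (X : seq A) : Prop :=
  if t is Some t' then
    perm_eq X (leaves t') /\
    {in vertices t', forall w, consecutive (leaves w) X}
  else X = [::].

Definition is_layout n (T S : option (tree 'I_n)) (XY : layout n) : Prop :=
  leaf_order T XY.1 /\ leaf_order S XY.2.

Definition crosses n (f : {perm 'I_n}) (XY : layout n) (j k : 'I_n) : bool :=
  (index j XY.1 < index k XY.1) != (index (f j) XY.2 < index (f k) XY.2).

Definition crossings n (f : {perm 'I_n}) (XY : layout n) : nat :=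
  #|[set p : 'I_n * 'I_n | [&& p.1 \in XY.1, p.2 \in XY.1, p.1 < p.2
                             & crosses f XY p.1 p.2]]|.

Definition planar_layout n (T S : option (tree 'I_n)) (f : {perm 'I_n})
    (XY : layout n) : Prop :=
  is_layout T S XY /\ crossings f XY = 0.

Section SingleEdgeInsertion.
Variables (n : nat) (G : tanglegram n).

Definition induced_treeT (I : {set 'I_n}) := induced (mem I) (treeT G).
Definition induced_treeS (I : {set 'I_n}) := induced (mem (phi G @: I)) (treeS G).

Definition planar_induced (I : {set 'I_n}) : Prop :=
  exists XY, planar_layout (induced_treeT I) (induced_treeS I) (phi G) XY.

Definition restrict_layout (I : {set 'I_n}) (XY : layout n) : layout n :=
  ([seq j <- XY.1 | j \in I], [seq k <- XY.2 | k \in phi G @: I]).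

Definition extends_planar (i : 'I_n) (XY : layout n) : Prop :=
  is_layout (Some (treeT G)) (Some (treeS G)) XY /\
  planar_layout (induced_treeT [set~ i]) (induced_treeS [set~ i]) (phi G)
    (restrict_layout [set~ i] XY).

Definition solves_insertion (i : 'I_n) (XY : layout n) : Prop :=
  extends_planar i XY /\
  forall XY', extends_planar i XY' ->
    crossings (phi G) XY <= crossings (phi G) XY'.

End SingleEdgeInsertion.

(* A computation is the list of its possible runs, over all the choices left
   open by the algorithm.  A run has a result (None for a run that aborts), a
   number of elementary steps and a number of memory cells.

   Cost model: a unit-cost random access machine whose words hold a label, a
   number polynomial in n, or a vertex of T or S (a vertex is a number; it is
   rendered by its subtree, so reading the children of a vertex is a pattern
   match).  Between two charged operations there is only straight-line code on
   words, tuples of words and heads of lists.  Every iteration of a loop and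
   every call of a recursive function is charged one step and one cell, the
   cell covering the stack frame and the list cell built; every access to a
   table is charged one step; creating a table is charged one step and one
   cell per entry.  Cells are never reclaimed, so the cells of a run bound the
   memory in use at any time. *)
Definition comp (A : Type) := seq (option A * (nat * nat)).

Definition ret (A : Type) (a : A) : comp A := [:: (Some a, (0, 0))].

Definition abort (A : Type) : comp A := [:: (None, (0, 0))].
Arguments abort {A}.

Definition charge (t s : nat) : comp unit := [:: (Some tt, (t, s))].

Definition bind (A B : Type) (c : comp A) (k : A -> comp B) : comp B :=
  flatten [seq
    let: (o, (t, s)) := r in
    if o is Some a then [seq (q.1, (t + q.2.1, s + q.2.2)) | q <- k a]
    else [:: (None, (t, s))]
  | r <- c].

(* Choosing from an empty list aborts, so every computation has a run. *)
Definition choose (A : Type) (l : seq A) : comp A :=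
  if l is [::] then abort else [seq (Some a, ((size l).+1, 0)) | a <- l].

Notation "'let*' x ':=' c 'in' k" := (bind c (fun x => k))
  (at level 200, x name, c at level 200, k at level 200).
Notation "'let*' ' p ':=' c 'in' k" := (bind c (fun x => match x with p => k end))
  (at level 200, p strict pattern, c at level 200, k at level 200).
Notation "c ';;' k" := (bind c (fun _ : unit => k))
  (at level 199, right associativity).

Definition call : comp unit := charge 1 1.

(* A table is a functional array, but it is always used linearly: no version of
   it is read after being updated, so an update may be made in place. *)

Definition new_table (K V : Type) (size : nat) (v : V) : comp (K -> V) :=
  charge size size;; ret (fun=> v).
Arguments new_table K {V}.

Definition read (K V : Type) (f : K -> V) (k : K) : comp V :=
  charge 1 0;; ret (f k).

Definition write (K : eqType) (V : Type) (f : K -> V) (k : K) (v : V) :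
    comp (K -> V) :=
  charge 1 0;; ret (fun x => if x == k then v else f x).

Fixpoint lmap (A B : Type) (f : A -> comp B) (l : seq A) : comp (seq B) :=
  call;;
  if l is x :: l' then
    let* y := f x in let* l'' := lmap f l' in ret (y :: l'')
  else ret [::].

Fixpoint lfilter (A : Type) (p : A -> comp bool) (l : seq A) : comp (seq A) :=
  call;;
  if l is x :: l' then
    let* b := p x in let* l'' := lfilter p l' in
    ret (if b then x :: l'' else l'')
  else ret [::].

Fixpoint lfold (A B : Type) (f : B -> A -> comp B) (b : B) (l : seq A) : comp B :=
  call;;
  if l is x :: l' then let* b' := f b x in lfold f b' l' else ret b.

Definition lall (A : Type) (p : A -> comp bool) : seq A -> comp bool :=
  lfold (fun b x => let* b' := p x in ret (b && b')) true.

Definition lhas (A : Type) (p : A -> comp bool) : seq A -> comp bool :=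
  lfold (fun b x => let* b' := p x in ret (b || b')) false.

Definition lcount (A : Type) (p : A -> comp bool) : seq A -> comp nat :=
  lfold (fun c x => let* b := p x in ret (if b then c.+1 else c)) 0.

Fixpoint lcat (A : Type) (l1 l2 : seq A) : comp (seq A) :=
  call;;
  if l1 is x :: l1' then let* l := lcat l1' l2 in ret (x :: l) else ret l2.

Definition lrev (A : Type) : seq A -> comp (seq A) :=
  lfold (fun l x => ret (x :: l)) [::].

Fixpoint lspan (A : Type) (p : A -> comp bool) (l : seq A) :
    comp (seq A * seq A) :=
  call;;
  if l is x :: l' then
    let* b := p x in
    if b then let* '(l1, l2) := lspan p l' in ret (x :: l1, l2)
    else ret ([::], l)
  else ret ([::], [::]).

(* Insertion sort, largest elements first. *)
Fixpoint linsert (A : Type) (gt : A -> A -> comp bool) (x : A) (l : seq A) :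
    comp (seq A) :=
  call;;
  if l is y :: l' then
    let* b := gt x y in
    if b then ret (x :: l) else let* l'' := linsert gt x l' in ret (y :: l'')
  else ret [:: x].

Definition lsort (A : Type) (gt : A -> A -> comp bool) : seq A -> comp (seq A) :=
  lfold (fun l x => linsert gt x l) [::].

Definition positions (K : eqType) (size : nat) (l : seq K) : comp (K -> nat) :=
  let* pos := new_table K size 0 in
  let* '(pos, _) :=
    lfold (fun st x => let: (pos, j) := st in
             let* pos := write pos x j in ret (pos, j.+1)) (pos, 0) l in
  ret pos.

Section Insertion.
Variable n : nat.
Notation vertex := (tree 'I_n).

(* A rooted binary tree with n leaves has 2n-1 vertices. *)
Definition nv : nat := (2 * n).-1.

Definition same (u v : vertex) : comp bool := charge 1 0;; ret (u == v).

(* The vertices of t, children before parents. *)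
Fixpoint postorder_acc (t : vertex) (acc : seq vertex) : comp (seq vertex) :=
  call;;
  match t with
  | Leaf _ => ret (t :: acc)
  | Node t1 t2 =>
    let* acc := postorder_acc t2 (t :: acc) in postorder_acc t1 acc
  end.

Definition postorder (t : vertex) : comp (seq vertex) := postorder_acc t [::].

(* Entry (u, w) tells whether w is below u or equal to u. *)
Definition below_table (t : vertex) : comp (vertex * vertex -> bool) :=
  let* le := new_table (vertex * vertex) (nv * nv) false in
  let* us := postorder t in
  lfold (fun le u =>
    let* ws := postorder u in
    lfold (fun le w => write le (u, w) true) le ws) le us.

(* w is a proper ancestor of w', given the table le of its tree. *)
Definition above (le : vertex * vertex -> bool) (w w' : vertex) : comp bool :=
  let* b := read le (w, w') in let* e := same w w' in ret (b && ~~ e).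

Definition parent (t w : vertex) : comp (option vertex) :=
  let* us := postorder t in
  lfold (fun o u =>
    if u is Node u1 u2 then
      let* e1 := same u1 w in let* e2 := same u2 w in
      ret (if e1 || e2 then Some u else o)
    else ret o) None us.

(* Entry u counts the leaves below u with a label different from a. *)
Definition count_table (t : vertex) (a : 'I_n) : comp (vertex -> nat) :=
  let* c := new_table vertex nv 0 in
  let* us := postorder t in
  lfold (fun c u =>
    match u with
    | Leaf b => write c u (nat_of_bool (b != a))
    | Node u1 u2 =>
      let* c1 := read c u1 in let* c2 := read c u2 in write c u (c1 + c2)
    end) c us.

Section Input.
Variables (T S : vertex) (f : 'I_n -> 'I_n) (i : 'I_n).

(* Throughout, I is the set of the labels other than i. *)

Definition untangle_table : comp (vertex * vertex -> bool) :=
  let* B := new_table (vertex * vertex) (nv * nv) false in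
  let* us := postorder T in
  let* vs := postorder S in
  lfold (fun B v =>
    lfold (fun B u =>
      let* b :=
        match u, v with
        | Leaf j, Leaf k => let* k' := read f j in ret ((j != i) && (k' == k))
        | Leaf _, Node v1 v2 =>
          let* b1 := read B (u, v1) in let* b2 := read B (u, v2) in ret (b1 || b2)
        | Node u1 u2, _ =>
          let* b1 := read B (u1, v) in let* b2 := read B (u2, v) in ret (b1 || b2)
        end in
      write B (u, v) b) B us) B vs.

(* A vertex of T is paired with true, a vertex of S with false. *)
Notation sided_vertex := (bool * vertex)%type.

(* Swaps the ends of an edge for a vertex on the side of S, so that the end on
   the side of the vertex comes first.  This is an involution. *)
Definition orient (side : bool) (e : vertex * vertex) : vertex * vertex :=
  if side then e else (e.2, e.1).

(* The highest degree of an internal vertex, and the vertices attaining it. *)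
Definition highest_internal (X Y : seq vertex) (E : seq (vertex * vertex)) :
    comp (nat * seq sided_vertex) :=
  let* dT := new_table vertex nv 0 in
  let* dS := new_table vertex nv 0 in
  let* '(dT, dS) :=
    lfold (fun d e =>
      let: (dT, dS) := d in
      let* x := read dT e.1 in let* dT := write dT e.1 x.+1 in
      let* y := read dS e.2 in let* dS := write dS e.2 y.+1 in
      ret (dT, dS)) (dT, dS) E in
  let scan side deg best u :=
    if u is Leaf _ then ret best else
      let: (m, l) := best in
      let* d := read deg u in
      ret (if m < d then (d, [:: (side, u)])
           else if d == m then (m, (side, u) :: l) else best) in
  let* best := lfold (scan true dT) (0, [::]) X in
  lfold (scan false dS) best Y.

Definition edges_of (su : sided_vertex) (E : seq (vertex * vertex)) :
    comp (seq (vertex * vertex)) :=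
  let: (side, u) := su in
  lfilter (fun e => same (orient side e).1 u) E.

(* The comparison with k' is not strict, because u1 and u2 may have a common
   neighbour, which is then the last one of the first child and the first one
   of the second child. *)
Definition refine (B : vertex * vertex -> bool) (su : sided_vertex)
    (X Y : seq vertex) (E : seq (vertex * vertex)) :
    comp (seq vertex * seq vertex * seq (vertex * vertex)) :=
  let: (side, u) := su in
  if u is Node u1 u2 then
    let* E := lfold (fun E' e =>
      let: (x, b) := orient side e in
      let* eu := same x u in
      if eu then
        let e1 := orient side (u1, b) in
        let e2 := orient side (u2, b) in
        let* b1 := read B e1 in
        let* b2 := read B e2 in
        let E' := if b1 then e1 :: E' else E' in
        ret (if b2 then e2 :: E' else E')
      else ret (e :: E')) [::] E in
    let* pos := positions nv (if side then Y else X) in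
    let* k := lfold (fun k e =>
      let: (x, b) := orient side e in
      let* e1 := same x u1 in
      if e1 then
        let* j := read pos b in
        ret (if k is Some k' then Some (maxn k' j) else Some j)
      else ret k) None E in
    let* '(w1, w2) :=
      if k is Some k' then
        let* ordered := lall (fun e =>
          let: (x, b) := orient side e in
          let* e2 := same x u2 in
          if e2 then let* j := read pos b in ret (k' <= j) else ret true) E in
        ret (if ordered then (u1, u2) else (u2, u1))
      else choose [:: (u1, u2); (u2, u1)] in
    let* A := lfold (fun A x =>
      let* eu := same x u in
      ret (if eu then w2 :: w1 :: A else x :: A)) [::] (if side then X else Y) in
    let* A := lrev A in
    ret (if side then (A, Y, E) else (X, A, E))
  else abort.

(* The argument fuel bounds the number of iterations of the loop; the loop
   aborts when it is exhausted. *)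
Fixpoint untangle_loop (fuel : nat) (B : vertex * vertex -> bool)
    (X Y : seq vertex) (E L : seq (vertex * vertex)) :
    comp (seq vertex * seq vertex * seq (vertex * vertex)) :=
  call;;
  let* '(d, best) := highest_internal X Y E in
  if best is [::] then ret (X, Y, L)
  else if fuel is fuel'.+1 then
    let* u := choose best in
    let* L :=
      if d == 1 then
        let* es := edges_of u E in
        if es is e :: _ then ret (e :: L) else abort
      else ret L in
    let* '(X, Y, E) := refine B u X Y E in
    untangle_loop fuel' B X Y E L
  else abort.

Definition leaf_labels : seq vertex -> comp (seq 'I_n) :=
  lmap (fun u => if u is Leaf a then ret a else abort).

Definition modified_untangle : comp (layout n * seq (vertex * vertex)) :=
  let* B := untangle_table in
  let* '(X, Y, L) := untangle_loop (2 * n) B [:: T] [:: S] [:: (T, S)] [::] in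
  let* X := leaf_labels X in
  let* Y := leaf_labels Y in
  ret ((X, Y), L).

(* The lowest vertex below u with the same count as u, where c u > 1. *)
Fixpoint reduce (c : vertex -> nat) (u : vertex) : comp vertex :=
  call;;
  if u is Node u1 u2 then
    let* m := read c u in
    let* m1 := read c u1 in
    let* m2 := read c u2 in
    if m1 == m then reduce c u1 else if m2 == m then reduce c u2 else ret u
  else ret u.

(* L(I), as a list without duplicates. *)
Definition reduced_pairs (L : seq (vertex * vertex)) :
    comp (seq (vertex * vertex)) :=
  let* cT := count_table T i in
  let* k := read f i in
  let* cS := count_table S k in
  lfold (fun R p =>
    let: (u, v) := p in
    let* mu := read cT u in
    let* mv := read cS v in
    if (mu == mv) && (1 < mu) then
      let* u := reduce cT u in
      let* v := reduce cS v in
      let* dup := lhas (fun q =>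
        let* e1 := same q.1 u in let* e2 := same q.2 v in ret (e1 && e2)) R in
      ret (if dup then R else (u, v) :: R)
    else ret R) [::] L.

(* An edge is given by its index; js is the list of all the indices, leT and
   leS are the tables of T and S. *)
Section Layouts.
Variables (js : seq 'I_n) (leT leS : vertex * vertex -> bool).

(* The edges at Lf(w) \ Lf(w'), which never include the edge i. *)
Definition edges_atT (w w' : vertex) : comp (seq 'I_n) :=
  lfilter (fun j =>
    let* a := read leT (w, Leaf j) in
    let* b := read leT (w', Leaf j) in
    ret [&& j != i, a & ~~ b]) js.

Definition edges_atS (w w' : vertex) : comp (seq 'I_n) :=
  lfilter (fun j =>
    let* k := read f j in
    let* a := read leS (w, Leaf k) in
    let* b := read leS (w', Leaf k) in
    ret [&& j != i, a & ~~ b]) js.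

Definition crossing (posX posY : 'I_n -> nat) (j k : 'I_n) : comp bool :=
  let* xj := read posX j in
  let* xk := read posX k in
  let* fj := read f j in
  let* fk := read f k in
  let* yj := read posY fj in
  let* yk := read posY fk in
  ret ((xj < xk) != (yj < yk)).

(* The number of edges of es, and the number of those crossed by the edge i. *)
Definition crossed (XY : layout n) (es : seq 'I_n) : comp (nat * nat) :=
  let* posX := positions n XY.1 in
  let* posY := positions n XY.2 in
  lfold (fun c j =>
    let* b := crossing posX posY i j in
    ret (c.1.+1, if b then c.2.+1 else c.2)) (0, 0) es.

Definition bad (XY : layout n) (es : seq 'I_n) : comp bool :=
  let* '(m, c) := crossed XY es in ret (m < c + c).

Definition crosses_all (XY : layout n) (es : seq 'I_n) : comp bool :=
  let* '(m, c) := crossed XY es in ret (c == m).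

Definition crossing_number (XY : layout n) : comp nat :=
  let* posX := positions n XY.1 in
  let* posY := positions n XY.2 in
  lfold (fun c j =>
    let* d := lcount (fun k =>
      let* b := crossing posX posY j k in ret ((j < k) && b)) js in
    ret (c + d)) 0 js.

Definition outside (le : vertex * vertex -> bool) (u : vertex) (x : 'I_n) :
    comp bool :=
  let* b := read le (u, Leaf x) in ret (~~ b).

(* Splits X around the leaves below u, which are consecutive in X. *)
Definition split_at (le : vertex * vertex -> bool) (X : seq 'I_n) (u : vertex) :
    comp (seq 'I_n * seq 'I_n * seq 'I_n) :=
  let* '(p, qr) := lspan (outside le u) X in
  let* '(q, r) := lspan (fun x => read le (u, Leaf x)) qr in
  ret (p, q, r).

Definition flip (le : vertex * vertex -> bool) (X : seq 'I_n) (u : vertex) :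
    comp (seq 'I_n) :=
  let* '(p, q, r) := split_at le X u in
  let* q := lrev q in
  let* qr := lcat q r in
  lcat p qr.

Definition paired_flip (XY : layout n) (uv : vertex * vertex) :
    comp (layout n) :=
  let* X := flip leT XY.1 uv.1 in
  let* Y := flip leS XY.2 uv.2 in
  ret (X, Y).

Definition subtree_switch (le : vertex * vertex -> bool) (X : seq 'I_n)
    (u : vertex) : comp (seq 'I_n) :=
  if u is Node u1 u2 then
    let* '(p, q, r) := split_at le X u in
    if q is x :: _ then
      let* first := read le (u1, Leaf x) in
      let* '(q1, q2) :=
        lspan (fun y => read le (if first then u1 else u2, Leaf y)) q in
      let* q := lcat q2 q1 in
      let* qr := lcat q r in
      lcat p qr
    else abort
  else abort.

Definition switchT (u : vertex) (XY : layout n) : comp (layout n) :=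
  let* X := subtree_switch leT XY.1 u in ret (X, XY.2).

Definition switchS (v : vertex) (XY : layout n) : comp (layout n) :=
  let* Y := subtree_switch leS XY.2 v in ret (XY.1, Y).

(* The loops over L(I)_S and L(I)_T.  The list is sorted from the largest pair
   to the smallest one; the lower vertex for the last pair is v0, resp. u0. *)
Fixpoint flip_chainS (v0 : vertex) (ps : seq (vertex * vertex))
    (XY : layout n) : comp (layout n) :=
  call;;
  if ps is p :: ps' then
    let* es := edges_atS p.2 (if ps' is q :: _ then q.2 else v0) in
    let* b := bad XY es in
    let* XY := if b then paired_flip XY p else ret XY in
    flip_chainS v0 ps' XY
  else ret XY.

Fixpoint flip_chainT (u0 : vertex) (ps : seq (vertex * vertex))
    (XY : layout n) : comp (layout n) :=
  call;;
  if ps is p :: ps' then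
    let* es := edges_atT p.1 (if ps' is q :: _ then q.1 else u0) in
    let* b := bad XY es in
    let* XY := if b then paired_flip XY p else ret XY in
    flip_chainT u0 ps' XY
  else ret XY.

Definition caseA (u0 v0 um : vertex) (chainS : seq (vertex * vertex))
    (XY : layout n) : comp (layout n) :=
  let* k := read f i in
  let* Eu0 := edges_atT u0 um in
  let* b := bad XY Eu0 in
  let* XY := if b then switchT u0 XY else ret XY in
  let* XY := flip_chainS v0 chainS XY in
  let* Ev0 := edges_atS v0 (Leaf k) in
  let* b := bad XY Ev0 in
  if b then switchS v0 XY else ret XY.

Definition caseB (u0 v0 vm : vertex) (chainT : seq (vertex * vertex))
    (XY : layout n) : comp (layout n) :=
  let* Ev0 := edges_atS v0 vm in
  let* b := bad XY Ev0 in
  let* XY := if b then switchS v0 XY else ret XY in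
  let* XY := flip_chainT u0 chainT XY in
  let* Eu0 := edges_atT u0 (Leaf i) in
  let* b := bad XY Eu0 in
  if b then switchT u0 XY else ret XY.

Definition fewest_crossings (XYs : seq (layout n)) : comp (layout n) :=
  let* cXYs := lmap (fun XY => let* c := crossing_number XY in ret (c, XY)) XYs in
  let* best := lfold (fun best cXY =>
    let: (c, XY) := cXY in
    ret (match best with
         | None => Some (c, [:: XY])
         | Some (m, l) =>
           if c < m then Some (c, [:: XY])
           else if c == m then Some (m, XY :: l) else best
         end)) None cXYs in
  if best is Some (_, l) then choose l else abort.

(* When Eu0 and Ev0 are disjoint, planarity of the layout away from the edge i
   makes this edge cross all or none of the edges of Eu0, and likewise for
   Ev0, so nothing depends on reading "crosses the edges" as "crosses all". *)
Definition caseC (u0 v0 : vertex) (chainS chainT : seq (vertex * vertex))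
    (XY : layout n) : comp (layout n) :=
  let* k := read f i in
  let* XY := flip_chainT u0 chainT XY in
  let* XY := flip_chainS v0 chainS XY in
  let* Eu0 := edges_atT u0 (Leaf i) in
  let* Ev0 := edges_atS v0 (Leaf k) in
  let* meet := lhas (fun j => lhas (fun j' => ret (j == j')) Ev0) Eu0 in
  if ~~ meet then
    let* b := crosses_all XY Eu0 in
    let* XY := if b then switchT u0 XY else ret XY in
    let* b := crosses_all XY Ev0 in
    if b then switchS v0 XY else ret XY
  else
    let* XY1 := switchT u0 XY in
    let* XY2 := switchS v0 XY in
    let* XY3 := switchS v0 XY1 in
    fewest_crossings [:: XY; XY1; XY2; XY3].

(* chainS and chainT are L(I)_S and L(I)_T, sorted from the largest pair. *)
Definition step2 (u0 v0 : vertex) (R : seq (vertex * vertex))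
    (XY : layout n) : comp (layout n) :=
  let* k := read f i in
  let* LS := lfilter (fun p =>
    let* a := above leT p.1 (Leaf i) in
    let* b := above leS p.2 (Leaf k) in ret (~~ a && b)) R in
  let* LT := lfilter (fun p =>
    let* a := above leT p.1 (Leaf i) in
    let* b := above leS p.2 (Leaf k) in ret (a && ~~ b)) R in
  let* chainS := lsort (fun p q => above leS p.2 q.2) LS in
  let* chainT := lsort (fun p q => above leT p.1 q.1) LT in
  let* isA := if chainS is p :: _ then above leT u0 p.1 else ret false in
  let* isB := if chainT is p :: _ then above leS v0 p.2 else ret false in
  match isA, chainS, isB, chainT with
  | true, p :: _, _, _ => caseA u0 v0 p.1 chainS XY
  | _, _, true, p :: _ => caseB u0 v0 p.2 chainT XY
  | _, _, _, _ => caseC u0 v0 chainS chainT XY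
  end.

End Layouts.

(* The leaves t_i and s_(f i) have no parents iff n = 1; then there is a single
   layout. *)
Definition insertion_program : comp (layout n) :=
  let* '(XY, L) := modified_untangle in
  let* R := reduced_pairs L in
  let* k := read f i in
  let* ou0 := parent T (Leaf i) in
  let* ov0 := parent S (Leaf k) in
  match ou0, ov0 with
  | Some u0, Some v0 =>
    let* us := postorder T in
    let* js := lfold (fun js u => ret (if u is Leaf j then j :: js else js)) [::] us in
    let* leT := below_table T in
    let* leS := below_table S in
    step2 js leT leS u0 v0 R XY
  | _, _ => ret XY
  end.

End Input.
End Insertion.

Definition insertion (n : nat) (G : tanglegram n) (i : 'I_n) : comp (layout n) :=
  insertion_program (treeT G) (treeS G) (phi G) i.

(* Main.v *)
From mathcomp Require Import all_boot all_fingroup zify.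
Require Import Defs.

(** Fix the edge i.  On either side, the sets of edges that end below a vertex
    form a hierarchy, and the order in which a layout lists the edges cannot
    tell apart two elements of a cluster from outside the cluster.

    Step 2.  Compare the layout of the algorithm with any competitor, and let d
    relate two edges when the two layouts list them in opposite orders on one
    side.  Again d cannot tell apart the elements of a cluster.  Both layouts
    are planar away from i, so on the other edges the relations of the two sides
    coincide, and this single relation respects both hierarchies at once.  By
    [rigidity] it takes the same value on two pairs of edges that belong to the
    same common clusters, the sets cut out by a vertex of T and by a vertex of S
    at the same time.  (So the planar layouts of the subtanglegram
    differ by paired flips at common clusters.)  On its own side, i compares
    with an edge outside its sibling set as any member of the sibling set does.
    Hence the change of the crossing between i and an edge j, called the swing
    of j, depends only on the place of j among the common clusters above the two
    sibling sets: it is constant on every set of edges that the algorithm tests,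
    and zero outside these sets.  On a set with constant swing, a layout that
    crosses at most half of the edges cannot be beaten ([fewer_group]), so a
    layout that is good on all the sets is optimal ([nested_optimal] for Cases A
    and B, [disjoint_optimal] for Case C).  A paired flip or a switch changes
    the crossings of i with the edges below one vertex and no others, so going
    down a chain of common clusters makes the sets good one after the other
    without spoiling the earlier ones.  If the sibling sets meet in Case C, two
    bits describe the swing everywhere ([swing_overlap]), and the best of four
    layouts is optimal.

    Step 1.  The two lists of the untangling loop stay compatible with some
    planar order of the other edges ([refine_planar]).  The neighbours of the
    two children decide which child goes first, except when all the edges of the
    refined vertex u lead to one vertex x.  Then u has degree one; as its degree
    is the highest, all the edges of x lead to u ([full_neighbour]), so u and x
    cut out a common cluster, and reversing it in the planar order is harmless.
    This is also the moment when the pair (u, x) is recorded, which is why every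
    common cluster is found ([state_refined]).

    Cost.  The edges between the two lists do not cross, hence there are at most
    as many as list entries ([size_edges]); every one of the at most 2n
    refinements is therefore linear.  There are at most 2n common clusters, and
    each is handled in linear time by Step 2; sorting them by insertion and
    counting crossings are quadratic. *)

Set Implicit Arguments.
Unset Strict Implicit.
Unset Printing Implicit Defensive.

(** * A program logic for nondeterministic computations with costs *)

(** One budget bounds both time and space: every charge costs at least as much
    time as space, so nothing is lost and only one quantity is tracked.  Asking
    for a nonempty list of runs makes the judgement a total one. *)
Definition within (A : Type) (c : comp A) (k : nat) (P : A -> Prop) : Prop :=
  c <> [::] /\ forall r, List.In r c ->
    exists2 a, r.1 = Some a & [/\ P a, r.2.1 <= k & r.2.2 <= k].

Lemma In_flatten (A : Type) (x : A) (ss : seq (seq A)) :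
  List.In x (flatten ss) -> exists2 s, List.In s ss & List.In x s.
Proof.
elim: ss => //= s ss IH xss.
have [xs|/IH[s' s'ss xs']] := proj1 (List.in_app_iff _ _ _) xss.
  by exists s; [left|].
by exists s'; [right|].
Qed.

Lemma within_ret (A : Type) (a : A) k (P : A -> Prop) : P a -> within (ret a) k P.
Proof. by move=> Pa; split=> // r [<-|//]; exists a. Qed.

Lemma within_bind (A B : Type) (c : comp A) (f : A -> comp B) k1 k Q P :
  within c k1 Q -> k1 <= k -> (forall a, Q a -> within (f a) (k - k1) P) ->
  within (bind c f) k P.
Proof.
move=> [c0 cQ] k1k fP; split.
  case: c c0 cQ => // -[o [t s]] c _ cQ.
  have [a /= oE [Qa _ _]] : exists2 a, o = Some a & [/\ Q a, t <= k1 & s <= k1] by apply: (cQ (o, (t, s))); left.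
  rewrite oE.
  have [fa0 _] := fP _ Qa; rewrite /bind /=.
  by case: (f a) fa0.
move=> r rb; have [l lc rl] := In_flatten rb.
have [[o [t s]] [lE rc]] := proj1 (List.in_map_iff _ _ _) lc.
move: rl; rewrite -{}lE.
have [a /= oE [Qa tk sk]] := cQ _ rc; rewrite oE.
move=> rl; have [q [<- qf]] := proj1 (List.in_map_iff _ _ _) rl.
have [_ /(_ _ qf)[b qb [Pb tb sb]]] := fP _ Qa.
by exists b; first exact: qb; split=> //=; lia.
Qed.

Lemma within_weaken (A : Type) (c : comp A) k k' (P Q : A -> Prop) :
  within c k P -> k <= k' -> (forall a, P a -> Q a) -> within c k' Q.
Proof.
move=> [c0 cP] kk' PQ; split=> // r /cP[a ra [Pa tk sk]].
by exists a => //; split; [exact: PQ | lia..].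
Qed.

Lemma within_charge t s k (P : unit -> Prop) :
  t <= k -> s <= k -> P tt -> within (charge t s) k P.
Proof. by move=> tk sk Pt; split=> // r [<-|//]; exists tt. Qed.

Lemma within_seq (B : Type) t s (f : unit -> comp B) k P :
  t <= k -> s <= t -> within (f tt) (k - t) P -> within (bind (charge t s) f) k P.
Proof.
move=> tk st fP; apply: (@within_bind _ _ _ _ t _ (fun=> True)) => //.
  exact: within_charge.
by case.
Qed.

Lemma within_choose (A : eqType) (l : seq A) k (P : A -> Prop) :
  l != [::] -> (size l).+1 <= k -> {in l, forall a, P a} -> within (choose l) k P.
Proof.
case: l => // x l _ lk lP; split=> // r rl.
have [a [<- al]] := proj1 (List.in_map_iff (fun a => (Some a, ((size (x :: l)).+1, 0))) (x :: l) r) rl.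
exists a => //; split=> //; apply: lP.
elim: (x :: l) al => //= y s IH [->|/IH]; rewrite inE ?eqxx // => ->.
by rewrite orbT.
Qed.

(** The form of a step whose result is determined. *)
Lemma within_bind_eq (A B : Type) (c : comp A) (f : A -> comp B) v k1 k P :
  within c k1 (eq v) -> k1 <= k -> within (f v) (k - k1) P ->
  within (bind c f) k P.
Proof. by move=> cv k1k fP; apply: (within_bind cv k1k) => _ <-. Qed.

Lemma within_call (B : Type) (f : unit -> comp B) k P :
  0 < k -> within (f tt) (k - 1) P -> within (bind call f) k P.
Proof. by move=> k0 fP; apply: within_seq. Qed.

Lemma within_read (K V : Type) (f : K -> V) x : within (read f x) 1 (eq (f x)).
Proof. by apply: within_seq => //; apply: within_ret. Qed.

Lemma within_same n (u v : tree 'I_n) : within (same u v) 1 (eq (u == v)).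
Proof. by apply: within_seq => //; apply: within_ret. Qed.

Lemma within_write (K : eqType) (V : Type) (f : K -> V) x v :
  within (write f x v) 1 (eq (fun y => if y == x then v else f y)).
Proof. by apply: within_seq => //; apply: within_ret. Qed.

Lemma within_new_table (K V : Type) size (v : V) :
  within (new_table K size v) size (eq (fun=> v)).
Proof. by apply: within_seq => //; apply: within_ret. Qed.

(** The invariant speaks of the part of the list already traversed. *)
Lemma within_lfold (A B : Type) (f : B -> A -> comp B) b l k
    (Inv : seq A -> B -> Prop) :
  Inv [::] b ->
  (forall p x s b', l = p ++ x :: s -> Inv p b' ->
     within (f b' x) k (Inv (rcons p x))) ->
  within (lfold f b l) (size l * k.+1).+1 (Inv l).
Proof.
move=> Ib If; suff: forall p s b', l = p ++ s -> Inv p b' ->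
    within (lfold f b' s) (size s * k.+1).+1 (Inv l) by move=> H; apply: (H [::]).
move=> p s; elim: s p => [|x s IH] p b' lE Ip /=; apply: within_call => //.
  by apply: within_ret; rewrite lE cats0.
apply: within_bind; [exact: If lE Ip | by lia |] => b'' Ib''.
apply: within_weaken; [apply: (IH (rcons p x)) => //; by rewrite cat_rcons | by lia |].
by [].
Qed.

Lemma within_lfold_eq (A : eqType) (B : Type) (f : B -> A -> comp B) g b l k :
  (forall b' x, x \in l -> within (f b' x) k (eq (g b' x))) ->
  within (lfold f b l) (size l * k.+1).+1 (eq (foldl g b l)).
Proof.
move=> fg; apply: (within_lfold (Inv := fun p b' => foldl g b p = b')) => //.
move=> p x s b' lE <-; apply: within_weaken; [apply: fg | by [] |].
  by rewrite lE mem_cat mem_head orbT.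
by move=> _ <-; rewrite foldl_rcons.
Qed.

Arguments within_lfold_eq {A B f g b l k}.

Lemma within_lmap (A : eqType) (B : Type) (f : A -> comp B) g l k :
  {in l, forall x, within (f x) k (eq (g x))} ->
  within (lmap f l) (size l * k.+1).+1 (eq (map g l)).
Proof.
elim: l => [|x l IH] fg /=; apply: within_call => //; first exact: within_ret.
apply: within_bind_eq; [by apply: fg; rewrite mem_head | by lia |].
apply: within_bind_eq; [apply: IH => y yl; apply: fg; rewrite inE yl orbT // | by lia |].
exact: within_ret.
Qed.

Lemma within_lfilter (A : eqType) (p : A -> comp bool) q l k :
  {in l, forall x, within (p x) k (eq (q x))} ->
  within (lfilter p l) (size l * k.+1).+1 (eq (filter q l)).
Proof.
elim: l => [|x l IH] pq /=; apply: within_call => //; first exact: within_ret.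
apply: within_bind_eq; [by apply: pq; rewrite mem_head | by lia |].
apply: within_bind_eq; [apply: IH => y yl; apply: pq; rewrite inE yl orbT // | by lia |].
exact: within_ret.
Qed.

Lemma within_lall (A : eqType) (p : A -> comp bool) q l k :
  {in l, forall x, within (p x) k (eq (q x))} ->
  within (lall p l) (size l * k.+1).+1 (eq (all q l)).
Proof.
move=> pq; have <-: foldl (fun b x => b && q x) true l = all q l.
  by rewrite -[RHS]/(true && _); elim: l true {pq} => [|x l IH] b //=;
    rewrite ?andbT // IH andbA.
apply: within_lfold_eq => b x xl.
apply: within_bind_eq; [exact: pq | by [] |]; exact: within_ret.
Qed.

Lemma within_lhas (A : eqType) (p : A -> comp bool) q l k :
  {in l, forall x, within (p x) k (eq (q x))} ->
  within (lhas p l) (size l * k.+1).+1 (eq (has q l)).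
Proof.
move=> pq; have <-: foldl (fun b x => b || q x) false l = has q l.
  by rewrite -[RHS]/(false || _); elim: l false {pq} => [|x l IH] b //=;
    rewrite ?orbF // IH orbA.
apply: within_lfold_eq => b x xl.
apply: within_bind_eq; [exact: pq | by [] |]; exact: within_ret.
Qed.

Lemma within_lcount (A : eqType) (p : A -> comp bool) q l k :
  {in l, forall x, within (p x) k (eq (q x))} ->
  within (lcount p l) (size l * k.+1).+1 (eq (count q l)).
Proof.
move=> pq; have <-: foldl (fun b x => if q x then b.+1 else b) 0 l = count q l.
  rewrite -[RHS]add0n; elim: l 0 {pq} => [|x l IH] b //=; rewrite ?addn0 // IH.
  by case: (q x); lia.
apply: within_lfold_eq => b x xl.
apply: within_bind_eq; [exact: pq | by [] |]; exact: within_ret.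
Qed.

Lemma within_lcat (A : Type) (l1 l2 : seq A) :
  within (lcat l1 l2) (size l1).+1 (eq (l1 ++ l2)).
Proof.
elim: l1 => [|x l1 IH] /=; apply: within_call => //; first exact: within_ret.
by apply: within_bind_eq; [exact: IH | by [] | exact: within_ret].
Qed.

Lemma within_lrev (A : eqType) (l : seq A) :
  within (lrev l) (size l).+1 (eq (rev l)).
Proof.
have <-: foldl (fun s x => x :: s) [::] l = rev l.
  by rewrite /rev; elim: l [::] => /=.
apply: within_weaken.
- apply: (within_lfold_eq (g := fun s x => x :: s) (k := 0)) => b x _.
  exact: within_ret.
- by rewrite muln1.
by [].
Qed.

Lemma within_lspan (A : eqType) (p : A -> comp bool) q l1 l2 k :
  all q l1 -> ~~ has q (take 1 l2) ->
  {in l1 ++ l2, forall x, within (p x) k (eq (q x))} ->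
  within (lspan p (l1 ++ l2)) (size (l1 ++ l2) * k.+1).+1 (eq (l1, l2)).
Proof.
elim: l1 => [_|x l1 IH /= /andP[qx ql1]] ql2 pq /=.
  case: l2 ql2 pq => [|y l2] /= ql2 pq; apply: within_call => //.
    exact: within_ret.
  apply: within_bind_eq; [by apply: pq; rewrite mem_head | by lia |].
  move: ql2; rewrite take0 orbF; case: (q y) => // _; exact: within_ret.
apply: within_call => //.
apply: within_bind_eq; [by apply: pq; rewrite mem_head | by lia |].
rewrite qx; apply: within_bind_eq; [apply: IH => // y yl | by lia |].
  by apply: pq; rewrite inE yl orbT.
exact: within_ret.
Qed.

(** * Vertices of a tree and the leaves below them *)

Lemma size_vertices (A : Type) (t : tree A) :
  (size (vertices t)).+1 = 2 * size (leaves t).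
Proof. by elim: t => //= t1 IH1 t2 IH2; rewrite !size_cat; lia. Qed.

Lemma size_leaves_gt0 (A : Type) (t : tree A) : 0 < size (leaves t).
Proof. by have := size_vertices t; lia. Qed.

Section Trees.
Variable A : eqType.
Implicit Types (t u v w : tree A) (x y : A).

Lemma leaves_ex t : exists x, x \in leaves t.
Proof.
elim: t => [a|t1 [x x1] t2 _]; first by exists a; rewrite mem_head.
by exists x; rewrite mem_cat x1.
Qed.

Lemma vertices_refl t : t \in vertices t.
Proof. by case: t => *; rewrite mem_head. Qed.

Lemma vertices_Node t1 t2 u :
  (u \in vertices (Node t1 t2)) =
  [|| u == Node t1 t2, u \in vertices t1 | u \in vertices t2].
Proof. by rewrite inE mem_cat. Qed.

Lemma vertices_trans u t w :
  u \in vertices t -> w \in vertices u -> w \in vertices t.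
Proof.
elim: t => [a|t1 IH1 t2 IH2]; first by rewrite inE => /eqP->.
rewrite !vertices_Node => /or3P[/eqP->|/IH1 H /H->|/IH2 H /H->];
  by rewrite ?orbT // vertices_Node.
Qed.

Lemma vertices_childl t1 t2 t : Node t1 t2 \in vertices t -> t1 \in vertices t.
Proof. by move/vertices_trans; apply; rewrite vertices_Node vertices_refl orbT. Qed.

Lemma vertices_childr t1 t2 t : Node t1 t2 \in vertices t -> t2 \in vertices t.
Proof. by move/vertices_trans; apply; rewrite vertices_Node vertices_refl !orbT. Qed.

Lemma leaves_sub u t : u \in vertices t -> {subset leaves u <= leaves t}.
Proof.
elim: t => [a|t1 IH1 t2 IH2]; first by rewrite inE => /eqP->.
rewrite vertices_Node => /or3P[/eqP->//|/IH1 H x /H|/IH2 H x /H] xt;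
  by rewrite mem_cat xt ?orbT.
Qed.

Lemma leaves_uniq u t : u \in vertices t -> uniq (leaves t) -> uniq (leaves u).
Proof.
elim: t => [a|t1 IH1 t2 IH2]; first by rewrite inE => /eqP->.
by rewrite vertices_Node cat_uniq => /or3P[/eqP->|/IH1 H|/IH2 H] /and3P[? ? ?];
  rewrite /= ?cat_uniq; first exact/and3P; apply: H.
Qed.

Lemma mem_vertices_Leaf x t : (Leaf x \in vertices t) = (x \in leaves t).
Proof.
elim: t => [a|t1 IH1 t2 IH2]; first by rewrite !inE.
by rewrite vertices_Node mem_cat IH1 IH2.
Qed.

Lemma leaves_disjoint t1 t2 x :
  uniq (leaves (Node t1 t2)) -> x \in leaves t1 -> x \notin leaves t2.
Proof.
rewrite cat_uniq => /and3P[_ /hasPn t12 _] x1; apply/negP => /t12.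
by rewrite /= x1.
Qed.

Lemma vertices_size u t :
  u \in vertices t -> u = t \/ size (leaves u) < size (leaves t).
Proof.
elim: t => [a|t1 IH1 t2 IH2]; first by rewrite inE => /eqP->; left.
rewrite vertices_Node /= size_cat.
have := size_leaves_gt0 t1; have := size_leaves_gt0 t2.
by move=> ? ? /or3P[/eqP->|/IH1[->|?]|/IH2[->|?]]; [left | right; lia..].
Qed.

(** Labels are distinct, so a common leaf forces the two subtrees to be nested
    rather than side by side. *)
Lemma vertices_laminar t u v x : uniq (leaves t) ->
  u \in vertices t -> v \in vertices t -> x \in leaves u -> x \in leaves v ->
  u \in vertices v \/ v \in vertices u.
Proof.
elim: t => [a|t1 IH1 t2 IH2] Ut.
  by rewrite !inE => /eqP-> /eqP-> _ _; left; rewrite vertices_refl.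
have [U1 _ U2] := and3P (etrans (esym (cat_uniq _ _)) Ut).
move=> ut vt xu xv.
have [/eqP->|u12] := orP (etrans (esym (vertices_Node _ _ _)) ut); first by right.
have [/eqP->|v12] := orP (etrans (esym (vertices_Node _ _ _)) vt); first by left.
have L y := @leaves_disjoint t1 t2 y Ut.
case/orP: u12 v12 => u12 /orP[] v12; [exact: IH1 | | | exact: IH2].
  by have := L _ (leaves_sub u12 xu); rewrite (leaves_sub v12 xv).
by have := L _ (leaves_sub v12 xv); rewrite (leaves_sub u12 xu).
Qed.

Lemma vertices_lca t x y : x != y -> x \in leaves t -> y \in leaves t ->
  exists t1 t2, Node t1 t2 \in vertices t /\
    (x \in leaves t1 /\ y \in leaves t2 \/ y \in leaves t1 /\ x \in leaves t2).
Proof.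
move=> xy; elim: t => [a|t1 IH1 t2 IH2].
  by rewrite !inE => /eqP xa /eqP ya; rewrite xa ya eqxx in xy.
rewrite !mem_cat => /orP[] xt /orP[] yt.
- have [u1 [u2 [ut H]]] := IH1 xt yt.
  by exists u1, u2; rewrite vertices_Node ut orbT.
- by exists t1, t2; rewrite vertices_refl; split=> //; left.
- by exists t1, t2; rewrite vertices_refl; split=> //; right.
have [u1 [u2 [ut H]]] := IH2 xt yt.
by exists u1, u2; rewrite vertices_Node ut !orbT.
Qed.

Lemma vertices_parent t w : w \in vertices t -> w <> t ->
  exists t1 t2, Node t1 t2 \in vertices t /\ (t1 = w \/ t2 = w).
Proof.
elim: t => [a|t1 IH1 t2 IH2]; first by rewrite inE => /eqP->.
rewrite vertices_Node => /or3P[/eqP->//|wt _|wt _].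
  have [->|/eqP wt1] := eqVneq w t1.
    by exists t1, t2; rewrite vertices_refl; split=> //; left.
  have [u1 [u2 [ut H]]] := IH1 wt wt1.
  by exists u1, u2; rewrite vertices_Node ut orbT.
have [->|/eqP wt2] := eqVneq w t2.
  by exists t1, t2; rewrite vertices_refl; split=> //; right.
have [u1 [u2 [ut H]]] := IH2 wt wt2.
by exists u1, u2; rewrite vertices_Node ut !orbT.
Qed.

Lemma leaves_induced (I : pred A) t :
  oapp (@leaves A) [::] (induced I t) = filter I (leaves t).
Proof.
elim: t => [a|t1 IH1 t2 IH2] /=; first by case: ifP.
by rewrite filter_cat -IH1 -IH2; case: (induced I t1) => [u1|];
  case: (induced I t2) => [u2|] //=; rewrite cats0.
Qed.

(** Suppressing vertices with one child identifies the vertices that have the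
    same leaves in I, and loses only those that have none. *)
Lemma vertices_induced (I : pred A) t t' : induced I t = Some t' ->
  {in vertices t, forall u, has I (leaves u) ->
     exists2 u', u' \in vertices t' & leaves u' = filter I (leaves u)} /\
  {in vertices t', forall u',
     exists2 u, u \in vertices t & leaves u' = filter I (leaves u)}.
Proof.
elim: t t' => [a|t1 IH1 t2 IH2] t'.
  rewrite /=; case: ifP => // Ia [<-]; split=> u; rewrite inE => /eqP->.
    by exists (Leaf a); rewrite ?mem_head //= Ia.
  by exists (Leaf a); rewrite ?mem_head //= Ia.
move=> t'E; have tE := leaves_induced I (Node t1 t2); rewrite t'E /= in tE.
have root : exists2 u', u' \in vertices t' & leaves u' = filter I (leaves (Node t1 t2)).
  by exists t'; rewrite ?vertices_refl.
have root' : exists2 u, u \in vertices (Node t1 t2) & leaves t' = filter I (leaves u).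
  by exists (Node t1 t2); rewrite ?vertices_refl.
have no u t0 : induced I t0 = None -> u \in vertices t0 -> ~~ has I (leaves u).
  move=> t0E ut; have := leaves_induced I t0; rewrite t0E => /esym/eqP.
  rewrite -[_ == _]negbK -has_filter; apply: contra => /hasP[x xu Ix].
  by apply/hasP; exists x; rewrite ?(leaves_sub ut).
move: t'E => /=; case E1: (induced I t1) IH1 => [u1|] IH1;
  case E2: (induced I t2) IH2 => [u2|] IH2 // -[t'E].
- have [H1 K1] := IH1 _ erefl; have [H2 K2] := IH2 _ erefl.
  split=> u; last first.
    rewrite -t'E vertices_Node => /or3P[/eqP->|/K1[v vt ->]|/K2[v vt ->]].
    - by rewrite t'E.
    - by exists v; rewrite // vertices_Node vt orbT.
    by exists v; rewrite // vertices_Node vt !orbT.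
  rewrite vertices_Node => /or3P[/eqP->//|/H1 K /K[v vu <-]|/H2 K /K[v vu <-]];
    by exists v; rewrite // -t'E vertices_Node vu ?orbT.
- have [H1 K1] := IH1 _ erefl; rewrite -t'E.
  split=> u; last first.
    by move=> /K1[v vt ->]; exists v; rewrite // vertices_Node vt orbT.
  rewrite vertices_Node => /or3P[/eqP->|/H1 //|/(no _ _ E2)/negP//].
  by rewrite t'E.
have [H2 K2] := IH2 _ erefl; rewrite -t'E.
split=> u; last first.
  by move=> /K2[v vt ->]; exists v; rewrite // vertices_Node vt !orbT.
rewrite vertices_Node => /or3P[/eqP->|/(no _ _ E1)/negP//|/H2 //].
by rewrite t'E.
Qed.

End Trees.

(** * Leaf orders as order relations *)

Section Orders.
Variable A : eqType.
Implicit Types (X Z : seq A) (x y z : A).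

Definition before X x y : bool := index x X < index y X.

Lemma before_total X x y : x \in X -> x != y -> before X y x = ~~ before X x y.
Proof.
move=> xX xy; rewrite /before -leqNgt ltn_neqAle andb_idl // => _.
apply: contraNneq xy => /esym iE; apply/eqP.
by rewrite -(nth_index x xX) iE nth_index // -index_mem -iE index_mem.
Qed.

Lemma before_filter (I : pred A) X x y :
  I x -> I y -> before (filter I X) x y = before X x y.
Proof.
move=> Ix Iy; rewrite /before; elim: X => //= a X IH.
case: ifP => [Ia|NIa] /=; first by do 2!case: eqP => //.
have /negPf-> : a != x by apply: contraFneq NIa => ->.
by have /negPf-> : a != y by apply: contraFneq NIa => ->.
Qed.

Lemma before_block p q r x y z : uniq (p ++ q ++ r) -> x \in q -> y \in q ->
  z \in p ++ q ++ r -> z \notin q ->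
  before (p ++ q ++ r) x z = before (p ++ q ++ r) y z.
Proof.
move=> U xq yq zX zq; rewrite /before !index_cat xq yq.
have np w : w \in q -> w \notin p.
  move: U; rewrite cat_uniq => /and3P[_ /hasPn H _] wq; apply: H.
  by rewrite mem_cat wq.
rewrite (negPf (np _ xq)) (negPf (np _ yq)) (negPf zq).
case: ifP => zp; first by have := index_mem z p; rewrite zp; lia.
by move: (index_mem x q) (index_mem y q); rewrite xq yq; lia.
Qed.

Lemma filter_prefix (Z : pred A) X :
  (forall x z, x \in X -> z \in X -> Z x -> ~~ Z z -> before X x z) -> uniq X ->
  X = filter Z X ++ filter (predC Z) X.
Proof.
elim: X => //= a X IH H /andP[aX U].
case: ifPn => Za /=.
  congr cons; apply: IH => // x z xX zX Zx Zz.
  have := H x z; rewrite /before !inE xX zX !orbT /=.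
  have /negPf-> : a != x by apply: contraNneq aX => ->.
  have /negPf-> : a != z by apply: contraNneq aX => ->.
  exact.
have /eqP-> : filter Z X == [::].
  rewrite -[_ == _]negbK -has_filter; apply/hasPn => x xX; apply/negP => Zx.
  have := H x a; rewrite /before !inE xX eqxx orbT /=.
  by rewrite eqxx => /(_ isT isT Zx Za); case: eqP.
rewrite /= ; congr cons; apply/esym/all_filterP/allP => x xX.
apply/negP => Zx; have := H x a; rewrite /before !inE xX eqxx orbT /=.
by rewrite eqxx => /(_ isT isT Zx Za); case: eqP.
Qed.

(** Conversely, the list splits into what precedes Z, the elements of Z and what
    follows them, and sorting it in this way changes nothing. *)
Lemma consecutiveP Z X : uniq X -> uniq Z -> {subset Z <= X} ->
  consecutive Z X <->
  (forall x y z, x \in Z -> y \in Z -> z \in X -> z \notin Z ->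
     before X x z = before X y z).
Proof.
move=> UX UZ ZX; split.
  move=> [p [q [r [XE qZ]]]] x y z; rewrite -!(perm_mem qZ) XE.
  by move=> *; apply: before_block; rewrite // -XE.
move=> H; suff [p [q [r [XE qZ]]]] : exists p q r, X = p ++ q ++ r /\ q =i Z.
  exists p, q, r; split=> //; apply: uniq_perm => //.
  by move: UX; rewrite XE !cat_uniq => /and3P[_ _ /and3P[]].
have {UZ} : forall x y z, x \in X -> y \in X -> x \in Z -> y \in Z ->
    z \in X -> z \notin Z -> before X x z = before X y z.
  by move=> x y z _ _; apply: H.
elim: X {H} UX ZX => [_ ZX _|a X IH /=/andP[aX UX] ZX H].
  exists [::], [::], [::]; split=> // x; rewrite in_nil.
  by apply/esym/negP => /ZX.
have sh x : x \in X -> a == x = false.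
  by move=> xX; apply: contraNF aX => /eqP->.
case aZ: (a \in Z); last first.
  case: IH => // [x xZ|x y z xX yX xZ yZ zX zZ|p [q [r [XE qZ]]]].
  - by have := ZX _ xZ; rewrite inE => /predU1P[xa|//]; rewrite -xa xZ in aZ.
  - have := H x y z; rewrite /before /= !inE xX yX zX !orbT !sh //.
    exact.
  by exists (a :: p), q, r; rewrite XE.
exists [::], (filter (mem Z) (a :: X)), (filter (predC (mem Z)) (a :: X)).
split; last first.
  by move=> x; rewrite mem_filter /= andb_idr // => /ZX.
apply: filter_prefix; last by rewrite /= aX.
move=> x z xX zX xZ zZ; rewrite (H _ a) ?mem_head //.
rewrite /before /= eqxx; case: eqP => // az.
by move: zZ; rewrite /= -az aZ.
Qed.

(** Comparisons, unlike blocks, are not affected by restricting the layout. *)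
Lemma leaf_orderP (t : tree A) X : uniq (leaves t) ->
  leaf_order (Some t) X <->
  perm_eq X (leaves t) /\
  {in vertices t, forall u x y z, x \in leaves u -> y \in leaves u ->
     z \in leaves t -> z \notin leaves u -> before X x z = before X y z}.
Proof.
move=> Ut; split=> -[Xt H]; split=> // u ut.
  have UX : uniq X by rewrite (perm_uniq Xt).
  have uX : {subset leaves u <= X}.
    by move=> x xu; rewrite (perm_mem Xt) (leaves_sub ut).
  move=> x y z xu yu zt zu.
  have [/(_ (H u ut)) K _] := consecutiveP UX (leaves_uniq ut Ut) uX.
  by apply: K => //; rewrite (perm_mem Xt).
apply/consecutiveP; first by rewrite (perm_uniq Xt).
- exact: leaves_uniq ut Ut.
- by move=> x xu; rewrite (perm_mem Xt) (leaves_sub ut).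
by move=> x y z xu yu; rewrite (perm_mem Xt); apply: H.
Qed.

Lemma leaf_order_inducedP (I : pred A) (t : tree A) X : uniq (leaves t) ->
  leaf_order (induced I t) X <->
  perm_eq X (filter I (leaves t)) /\
  {in vertices t, forall u x y z, I x -> I y -> I z ->
     x \in leaves u -> y \in leaves u ->
     z \in leaves t -> z \notin leaves u -> before X x z = before X y z}.
Proof.
move=> Ut; have := leaves_induced I t.
case tE: (induced I t) => [t'|] /= tI; last first.
  by rewrite -tI; split=> [->|[/perm_size/size0nil->//]]; split.
have [H K] := vertices_induced tE.
have Ut' : uniq (leaves t') by rewrite tI filter_uniq.
rewrite -/(leaf_order (Some t') X) leaf_orderP // tI; split=> -[Xt L]; split=> //.
  move=> u ut x y z Ix Iy Iz xu yu zt zu.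
  have [|u' u't' u'E] := H u ut; first by apply/hasP; exists x.
  by apply: (L u') => //; rewrite ?tI ?u'E !mem_filter ?Ix ?Iy ?Iz.
move=> u' /K[u ut u'E] x y z; rewrite u'E ?tI !mem_filter => /andP[Ix xu] /andP[Iy yu].
move=> /andP[Iz zt]; rewrite Iz /= => zu; exact: (L u).
Qed.

End Orders.

(** * Rigidity of a pair of hierarchies *)

Section Hierarchies.
Variable V : finType.
Implicit Types (F : seq {set V}) (A B C D E : {set V}) (x y z : V) (d o : rel V).

(** A and B are the two sides of a branching that separates x from y. *)
Definition parts F x y A B : Prop :=
  [/\ A \in F, B \in F, A :|: B \in F, x \in A & y \in B] /\ [disjoint A & B].

(** Nested or disjoint clusters, of which some branching separates any two
    elements: this is what a binary tree looks like from its leaves. *)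
Definition hierarchy F : Prop :=
  {in F &, forall A B x, x \in A -> x \in B -> A \subset B \/ B \subset A} /\
  (forall x y, x != y -> exists A B, parts F x y A B).

(** A relation on D that cannot tell apart two elements of a cluster from
    outside the cluster; leaf orders and their differences have this property. *)
Definition congruent F D o : Prop :=
  {in F, forall A x y z, x \in D -> y \in D -> z \in D ->
    x \in A -> y \in A -> z \notin A -> o x z = o y z}.

Definition symmetric_on D d : Prop :=
  forall x y, x \in D -> y \in D -> x != y -> d x y = d y x.

Definition common F1 F2 D C : Prop :=
  exists A B, [/\ A \in F1, B \in F2, A :&: D = C & B :&: D = C].

Lemma commonC F1 F2 D C : common F1 F2 D C -> common F2 F1 D C.
Proof. by move=> [A [B [? ? ? ?]]]; exists B, A. Qed.

Lemma partsC F x y A B : parts F x y A B -> parts F y x B A.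
Proof. by move=> [[? ? ? ? ?] ?]; split; rewrite 1?disjoint_sym // setUC. Qed.

Lemma parts_neq F x y A B : parts F x y A B -> x \notin B /\ y \notin A.
Proof.
move=> [[_ _ _ xA yB] /pred0P AB].
by split; apply/negP => h; [have := AB x | have := AB y];
  rewrite /= ?xA ?yB ?h.
Qed.

Section Rigidity.
Variables (F1 F2 : seq {set V}) (D : {set V}) (d : rel V).
Hypotheses (H1 : hierarchy F1) (H2 : hierarchy F2).
Hypotheses (d1 : congruent F1 D d) (d2 : congruent F2 D d).
Hypothesis dC : symmetric_on D d.

Lemma parts_min F x y A B C : hierarchy F -> parts F x y A B ->
  C \in F -> x \in C -> y \in C -> A :|: B \subset C.
Proof.
move=> [L _] P CF xC yC; have [xB yA] := parts_neq P.
case: P => -[AF BF _ xA yB] _; rewrite subUset; apply/andP; split.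
  by case: (L _ _ AF CF _ xA xC) => // /subsetP/(_ _ yC); rewrite (negPf yA).
by case: (L _ _ BF CF _ yB yC) => // /subsetP/(_ _ xC); rewrite (negPf xB).
Qed.

Lemma congruent_parts F x y A B : congruent F D d -> parts F x y A B ->
  forall z, x \in D -> y \in D -> z \in D -> z \in A -> d z y = d x y.
Proof.
move=> dF P z xD yD zD zA; have [_ yA] := parts_neq P.
by case: P => -[AF _ _ xA _] _; apply: (dF A).
Qed.

Lemma parts_grow F x y A B z A' B' : hierarchy F -> parts F x y A B ->
  z \notin A :|: B -> parts F z y A' B' \/ parts F x z A' B' ->
  A :|: B \proper A' :|: B'.
Proof.
move=> [L _] [[_ _ ABF xA yB] _] zAB P.
have [s [sAB sAB' zAB' AB'F]] : exists s, [/\ s \in A :|: B, s \in A' :|: B',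
    z \in A' :|: B' & A' :|: B' \in F].
  case: P => -[[_ _ ? p q] _]; [exists y | exists x]; split=> //;
  by rewrite inE ?p ?q ?xA ?yB ?orbT.
case: (L _ _ ABF AB'F _ sAB sAB') => S.
  by apply/properP; split=> //; exists z.
by rewrite (subsetP S _ zAB') in zAB.
Qed.

(** Replacing an end of a pair by an element of the smallest cluster of one
    hierarchy around the pair enlarges the smallest cluster of the other one,
    without leaving any common cluster or changing d; it stops at the smallest
    common cluster that contains the pair. *)
Lemma ascend m x y A1 A2 B1 B2 :
  #|~: (A1 :|: A2)| + #|~: (B1 :|: B2)| < m -> x \in D -> y \in D ->
  parts F1 x y A1 A2 -> parts F2 x y B1 B2 ->
  exists x' y' A1' A2',
    [/\ x' \in D, y' \in D, parts F1 x' y' A1' A2', d x' y' = d x y &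
        common F1 F2 D ((A1' :|: A2') :&: D)] /\
    (A1 :|: A2 \subset A1' :|: A2' /\
     forall C, common F1 F2 D C -> x \in C -> y \in C ->
       (A1' :|: A2') :&: D \subset C).
Proof.
elim: m x y A1 A2 B1 B2 => // m IH x y A1 A2 B1 B2 lem xD yD P Q.
have minP C : common F1 F2 D C -> x \in C -> y \in C ->
    (A1 :|: A2) :&: D \subset C /\ (B1 :|: B2) :&: D \subset C.
  move=> [A [B [AF BF AC BC]]] xC yC.
  have [xA yA] : x \in A /\ y \in A.
    by move: xC yC; rewrite -AC !inE => /andP[-> _] /andP[-> _].
  have [xB yB] : x \in B /\ y \in B.
    by move: xC yC; rewrite -BC !inE => /andP[-> _] /andP[-> _].
  split; [rewrite -AC | rewrite -BC]; apply: setSI.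
    exact: (parts_min H1 P).
  exact: (parts_min H2 Q).
have [eqAB|] := eqVneq ((A1 :|: A2) :&: D) ((B1 :|: B2) :&: D).
  exists x, y, A1, A2; split; last by split=> // C CC xC yC; case: (minP C).
  split=> //; exists (A1 :|: A2), (B1 :|: B2).
  by case: P Q => -[? ? ? ? ?] _ [[? ? ? ? ?] _]; split.
rewrite eqEsubset negb_and => /orP[] /subsetPn[z];
  rewrite !in_setI => /andP[zU zD]; rewrite zD andbT => zN.
- have grow B1' B2' : B1 :|: B2 \proper B1' :|: B2' ->
     #|~: (A1 :|: A2)| + #|~: (B1' :|: B2')| < m.
    move/proper_card; have := cardsC (B1 :|: B2); have := cardsC (B1' :|: B2').
    by move: lem; lia.
  have zC C : common F1 F2 D C -> x \in C -> y \in C -> z \in C.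
    by move=> CC xC yC; apply: (subsetP (minP C CC xC yC).1); rewrite !inE in zU *; rewrite zU.
  have zy := congruent_parts d1 P xD yD zD.
  have zx := congruent_parts d1 (partsC P) yD xD zD.
  have [xA2 yA1] := parts_neq P; case/setUP: (zU) => zA.
    have zny : z != y by apply: contraNneq yA1 => <-.
    have [B1' [B2' Q']] := H2.2 _ _ zny.
    have P' : parts F1 z y A1 A2 by case: P => -[? ? ? ? ?] ?; split.
    have [x' [y' [A1' [A2' [[? ? ? dE ?] [S M]]]]]] :=
      IH _ _ _ _ _ _ (grow _ _ (parts_grow H2 Q zN (or_introl Q'))) zD yD P' Q'.
    exists x', y', A1', A2'; split; first by rewrite dE zy.
    by split=> // C CC xC yC; apply: M => //; apply: zC.
  have xnz : x != z by apply: contraNneq xA2 => ->.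
  have [B1' [B2' Q']] := H2.2 _ _ xnz.
  have P' : parts F1 x z A1 A2 by case: P => -[? ? ? ? ?] ?; split.
  have [x' [y' [A1' [A2' [[? ? ? dE ?] [S M]]]]]] :=
    IH _ _ _ _ _ _ (grow _ _ (parts_grow H2 Q zN (or_intror Q'))) xD zD P' Q'.
  exists x', y', A1', A2'; split.
    rewrite dE; split=> //; rewrite dC // zx // dC //.
    by apply: contraNneq yA1 => ->; case: P => -[].
  by split=> // C CC xC yC; apply: M => //; apply: zC.
have grow A1' A2' : A1 :|: A2 \proper A1' :|: A2' ->
   #|~: (A1' :|: A2')| + #|~: (B1 :|: B2)| < m.
  move/proper_card; have := cardsC (A1 :|: A2); have := cardsC (A1' :|: A2').
  by move: lem; lia.
have zC C : common F1 F2 D C -> x \in C -> y \in C -> z \in C.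
  by move=> CC xC yC; apply: (subsetP (minP C CC xC yC).2); rewrite !inE in zU *; rewrite zU.
have zy := congruent_parts d2 Q xD yD zD.
have zx := congruent_parts d2 (partsC Q) yD xD zD.
have [xB2 yB1] := parts_neq Q; case/setUP: (zU) => zB.
  have zny : z != y by apply: contraNneq yB1 => <-.
  have [A1' [A2' P']] := H1.2 _ _ zny.
  have Q' : parts F2 z y B1 B2 by case: Q => -[? ? ? ? ?] ?; split.
  have S' := parts_grow H1 P zN (or_introl P').
  have [x' [y' [A1'' [A2'' [[? ? ? dE ?] [S M]]]]]] :=
    IH _ _ _ _ _ _ (grow _ _ S') zD yD P' Q'.
  exists x', y', A1'', A2''; split; first by rewrite dE zy.
  split; first exact: subset_trans (proper_sub S') S.
  by move=> C CC xC yC; apply: M => //; apply: zC.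
have xnz : x != z by apply: contraNneq xB2 => ->.
have [A1' [A2' P']] := H1.2 _ _ xnz.
have Q' : parts F2 x z B1 B2 by case: Q => -[? ? ? ? ?] ?; split.
have S' := parts_grow H1 P zN (or_intror P').
have [x' [y' [A1'' [A2'' [[? ? ? dE ?] [S M]]]]]] :=
  IH _ _ _ _ _ _ (grow _ _ S') xD zD P' Q'.
exists x', y', A1'', A2''; split.
  rewrite dE; split=> //; rewrite dC // zx // dC //.
  by apply: contraNneq yB1 => ->; case: Q => -[].
split; first exact: subset_trans (proper_sub S') S.
by move=> C CC xC yC; apply: M => //; apply: zC.
Qed.

(** Climb from both pairs to the smallest common cluster that contains them.  By
    hypothesis it is the same one, namely the union of the two parts of a single
    branching, across which d is constant. *)
Theorem rigidity x y x' y' : x \in D -> y \in D -> x' \in D -> y' \in D ->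
  x != y -> x' != y' ->
  (forall C, common F1 F2 D C ->
     (x \in C) && (y \in C) = (x' \in C) && (y' \in C)) ->
  d x y = d x' y'.
Proof.
move=> xD yD x'D y'D xy x'y' eqC.
have up a b : a \in D -> b \in D -> a != b -> exists p q A1 A2,
    [/\ p \in D, q \in D, parts F1 p q A1 A2, d p q = d a b &
        common F1 F2 D ((A1 :|: A2) :&: D)] /\
    [/\ a \in (A1 :|: A2) :&: D, b \in (A1 :|: A2) :&: D &
     forall C, common F1 F2 D C -> a \in C -> b \in C ->
       (A1 :|: A2) :&: D \subset C].
  move=> aD bD ab; have [A1 [A2 P]] := H1.2 _ _ ab.
  have [B1 [B2 Q]] := H2.2 _ _ ab.
  have [p [q [A1' [A2' [H [S M]]]]]] := ascend (ltnSn _) aD bD P Q.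
  exists p, q, A1', A2'; split=> //; split=> //; rewrite !in_setI ?aD ?bD andbT;
    by apply: (subsetP S); rewrite inE; case: P => -[_ _ _ pA qA] _; rewrite ?pA ?qA ?orbT.
have [p [q [A1 [A2 [[pD qD P <- CA] [xA yA minA]]]]]] := up _ _ xD yD xy.
have [s [t [B1 [B2 [[sD tD Q <- CB] [xB yB minB]]]]]] := up _ _ x'D y'D x'y'.
have {minA minB} eqAB : (A1 :|: A2) :&: D = (B1 :|: B2) :&: D.
  apply/eqP; rewrite eqEsubset; apply/andP; split.
    by have := eqC _ CB; rewrite xB yB => /andP[? ?]; apply: minA.
  by have := eqC _ CA; rewrite xA yA => /esym/andP[? ?]; apply: minB.
(* The parts of one branching cannot both lie in one part of the other. *)
have sep p' q' A1' A2' C z : parts F1 p' q' A1' A2' -> C \in F1 ->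
    z \in A1' :|: A2' -> z \notin C -> ~~ ((p' \in C) && (q' \in C)).
  move=> P' CF zA zC; apply/negP => /andP[p'C q'C].
  by rewrite (subsetP (parts_min H1 P' CF p'C q'C) _ zA) in zC.
have [sB2 tB1] := parts_neq Q.
have [B1F B2F BF sB1 tB2] := Q.1.
have [inp inq] : p \in B1 :|: B2 /\ q \in B1 :|: B2.
  by split; apply: (subsetP (subsetIl _ D)); rewrite -eqAB !inE ?pD ?qD andbT;
    case: P => -[_ _ _ pA qA] _; rewrite ?pA ?qA ?orbT.
have inA z : z \in D -> z \in B1 :|: B2 -> z \in A1 :|: A2.
  by move=> zD zB; apply: (subsetP (subsetIl _ D)); rewrite eqAB !inE zD andbT -in_setU.
have sAA : s \in A1 :|: A2 by apply: inA; rewrite // inE sB1.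
have tAA : t \in A1 :|: A2 by apply: inA; rewrite // inE tB2 orbT.
have := sep _ _ _ _ _ _ P B1F tAA tB1; have := sep _ _ _ _ _ _ P B2F sAA sB2.
have pq : p != q by have [_] := parts_neq P; apply: contraNneq => <-; case: P => -[].
have d_across a b : a \in D -> b \in D -> a \in B1 -> b \in B2 -> d a b = d s t.
  move=> aD bD aB bB; have Q' : parts F1 s b B1 B2 by case: Q => -[? ? ? ? ?] ?; split.
  rewrite (congruent_parts d1 Q' sD bD aD aB).
  have sb : s != b by apply: contraNneq sB2 => ->.
  have st : s != t by apply: contraNneq sB2 => ->.
  by rewrite dC // (congruent_parts d1 (partsC Q) tD sD bD bB) dC // eq_sym.
move: inp inq; rewrite !inE => /orP[] pB /orP[] qB; rewrite ?pB ?qB //= => _ _.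
  exact: d_across.
by rewrite dC //; apply: d_across.
Qed.

End Rigidity.

(** * The effect of changing the layout on the inserted edge *)

(** The difference d of two orders on one side.  The sibling set w of i is all
    that the position of i on that side depends on. *)
Section OneSide.
Variables (F1 F2 : seq {set V}) (i : V) (w : {set V}) (d : rel V).
Let D := [set~ i].
Hypotheses (H1 : hierarchy F1) (H2 : hierarchy F2).
Hypotheses (d1 : congruent F1 setT d) (d2 : congruent F2 D d).
Hypothesis dC : symmetric_on setT d.
Hypotheses (wF : w \in F1) (iwF : i |: w \in F1) (iw : i \notin w).

Let neq_i j : j \in w -> i != j.
Proof. by move=> jw; apply: contraNneq iw => ->. Qed.

Lemma congruent_sub F (D' D'' : {set V}) o : D'' \subset D' ->
  congruent F D' o -> congruent F D'' o.
Proof.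
by move=> /subsetP S H A AF x y z xD yD zD; apply: (H A) => //; apply: S.
Qed.

Lemma symmetric_on_sub (D' D'' : {set V}) o : D'' \subset D' ->
  symmetric_on D' o -> symmetric_on D'' o.
Proof. by move=> /subsetP S H x y xD yD; apply: H; apply: S. Qed.

Lemma swing_sibling j k : j \in w -> k \in w -> d i j = d i k.
Proof.
move=> jw kw; rewrite dC ?neq_i // [RHS]dC ?neq_i //.
by apply: (d1 wF).
Qed.

Lemma swing_outside z j : z \in w -> j \notin w -> j != i -> d i j = d z j.
Proof.
move=> zw jw ji; apply: (d1 iwF) => //; first exact: setU11.
  by rewrite inE zw orbT.
by rewrite !inE negb_or ji.
Qed.

(** Clusters that meet are nested, and the one that also has an outside element
    is the larger one. *)
Lemma common_above C z j : common F1 F2 D C -> z \in w -> j \notin w ->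
  z \in C -> j \in C -> w \proper C.
Proof.
move=> [A [B [AF _ AC _]]] zw jw zC jC.
have [zA jA] : z \in A /\ j \in A.
  by move: zC jC; rewrite -AC !inE => /andP[-> _] /andP[-> _].
apply/properP; split; last by exists j.
case: (H1.1 _ _ wF AF _ zw zA) => [wA|/subsetP/(_ _ jA)]; last by rewrite (negPf jw).
by rewrite -AC subsetI wA; apply/subsetP => x xw; rewrite !inE eq_sym neq_i.
Qed.

(** No common cluster above w cuts through E, which makes i compare in the same
    way with all the elements of E. *)
Definition tight E : Prop :=
  E \subset w \/ [disjoint E & w] /\
  forall C j, common F1 F2 D C -> w \proper C -> j \in E -> j \in C -> E \subset C.

Lemma rigid_outside z z' j k : z \in D -> z' \in D -> j \in D -> k \in D ->
  z != j -> z' != k ->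
  (forall C, common F1 F2 D C -> (z \in C) && (j \in C) = (z' \in C) && (k \in C)) ->
  d z j = d z' k.
Proof.
move=> zD z'D jD kD zj zk HC.
apply: (rigidity H1 H2 (congruent_sub (subsetT _) d1) d2) HC => //.
exact: symmetric_on_sub (subsetT _) dC.
Qed.

Lemma tight_const E j k : (exists z, z \in w) -> E \subset D -> tight E ->
  j \in E -> k \in E -> d i j = d i k.
Proof.
move=> [z zw] /subsetP ED [/subsetP Ew|[/pred0P dE M]] jE kE.
  by apply: swing_sibling; apply: Ew.
have nw l : l \in E -> l \notin w by move=> lE; have := dE l; rewrite /= lE => /= ->.
have ni l : l \in E -> l != i by move=> /ED; rewrite !inE.
have zl l : l \in E -> z != l by move=> /nw; apply: contraNneq => <-.
rewrite (swing_outside zw (nw _ jE) (ni _ jE)) (swing_outside zw (nw _ kE) (ni _ kE)).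
have zD : z \in D by rewrite !inE eq_sym neq_i.
apply: rigid_outside => //; [exact: ED | exact: ED | exact: zl | exact: zl |] => C CC.
case zC: (z \in C) => //=.
by apply/idP/idP => lC; [apply: (subsetP (M C j _ _ _ _) k) | apply: (subsetP (M C k _ _ _ _) j)];
  rewrite // (common_above CC zw _ zC lC) // nw.
Qed.

End OneSide.

Section TwoSides.
Variables (F1 F2 : seq {set V}) (i : V) (w1 w2 : {set V}) (d1 d2 : rel V).
Let D := [set~ i].
Hypotheses (H1 : hierarchy F1) (H2 : hierarchy F2).
Hypotheses (dF1 : congruent F1 setT d1) (dF2 : congruent F2 setT d2).
Hypotheses (d1C : symmetric_on setT d1) (d2C : symmetric_on setT d2).
Hypothesis d12 : forall x y, x \in D -> y \in D -> d1 x y = d2 x y.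
Hypotheses (w1F : w1 \in F1) (iw1F : i |: w1 \in F1) (iw1 : i \notin w1).
Hypotheses (w2F : w2 \in F2) (iw2F : i |: w2 \in F2) (iw2 : i \notin w2).
Hypotheses (w1_ex : exists z, z \in w1) (w2_ex : exists z, z \in w2).

(** Whether the edge j crosses the inserted edge in one layout only. *)
Definition swing j := d1 i j (+) d2 i j.

Let dF21 : congruent F2 D d1.
Proof.
move=> A AF x y z xD yD zD xA yA zA; rewrite !d12 //; exact: (dF2 AF).
Qed.

Let dF12 : congruent F1 D d2.
Proof.
move=> A AF x y z xD yD zD xA yA zA; rewrite -!d12 //; exact: (dF1 AF).
Qed.

Let inD j (w : {set V}) : i \notin w -> j \in w -> j \in D.
Proof. by move=> iw jw; rewrite !inE; apply: contraNneq iw => <-. Qed.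

Lemma swing_const E j k : E \subset D -> tight F1 F2 i w1 E -> tight F2 F1 i w2 E ->
  j \in E -> k \in E -> swing j = swing k.
Proof.
move=> ED t1 t2 jE kE; rewrite /swing.
have H := tight_const H1 H2 dF1 dF21 d1C w1F iw1F iw1 w1_ex ED t1 jE kE.
by rewrite H (tight_const H2 H1 dF2 dF12 d2C w2F iw2F iw2 w2_ex ED t2 jE kE).
Qed.

(** On either side i can be replaced by an element of its sibling set.  The two
    replacements see j from the same common clusters, so the changes cancel. *)
Lemma swing_none j : j \in D -> j \notin w1 -> j \notin w2 ->
  (forall C, common F1 F2 D C -> j \in C -> (w1 \proper C) = (w2 \proper C)) ->
  swing j = false.
Proof.
move=> jD jw1 jw2 HC; have [z1 zw1] := w1_ex; have [z2 zw2] := w2_ex.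
have ji : j != i by move: jD; rewrite !inE.
rewrite /swing (swing_outside dF1 iw1F zw1 jw1 ji) (swing_outside dF2 iw2F zw2 jw2 ji).
have z1D := inD iw1 zw1; have z2D := inD iw2 zw2.
rewrite -d12 // (rigid_outside H1 H2 dF1 dF21 d1C (z' := z2) (k := j)) ?addbb //.
- by apply: contraNneq jw1 => <-.
- by apply: contraNneq jw2 => <-.
move=> C CC; have [jC|] := boolP (j \in C); last by rewrite !andbF.
rewrite !andbT; apply/idP/idP => zC.
  have : w2 \proper C by rewrite -HC // (common_above H1 w1F iw1 CC zw1 jw1 zC jC).
  by move/proper_sub/subsetP; apply.
have : w1 \proper C by rewrite HC // (common_above H2 w2F iw2 (commonC CC) zw2 jw2 zC jC).
by move/proper_sub/subsetP; apply.
Qed.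

(** A common element z of the sibling sets replaces i on both sides.  As a common
    cluster that contains z and an element of S, the symmetric difference of the
    sibling sets, contains both sibling sets, rigidity makes d z constant on S. *)
Lemma swing_overlap z : z \in w1 -> z \in w2 ->
  (forall C, common F1 F2 D C -> (w1 \proper C) = (w2 \proper C)) ->
  exists a b, forall j, j \in D ->
    swing j = (a && (j \in w1)) (+) (b && (j \in w2)).
Proof.
move=> zw1 zw2 HC; have zD := inD iw1 zw1.
pose S := (w1 :\: w2) :|: (w2 :\: w1).
have zS j : j \in S -> z != j.
  by apply: contraTneq => <-; rewrite !inE zw1 zw2.
have SD j : j \in S -> j \in D.
  by rewrite !in_setU !in_setD => /orP[]/andP[_]; apply: inD.
have above C j : common F1 F2 D C -> z \in C -> j \in S -> j \in C ->
    w1 \proper C /\ w2 \proper C.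
  move=> CC zC + jC; rewrite !in_setU !in_setD => /orP[]/andP[jn _].
    have H := common_above H2 w2F iw2 (commonC CC) zw2 jn zC jC.
    by rewrite HC // H.
  have H := common_above H1 w1F iw1 CC zw1 jn zC jC.
  by rewrite -HC // H.
have dS j k : j \in S -> k \in S -> d1 z j = d1 z k.
  move=> jS kS; apply: (rigid_outside H1 H2 dF1 dF21 d1C) => //;
    [exact: SD | exact: SD | exact: zS | exact: zS |] => C CC.
  case zC: (z \in C) => //=.
  have sub l : l \in S -> w1 \proper C -> w2 \proper C -> l \in C.
    move=> + /proper_sub/subsetP s1 /proper_sub/subsetP s2.
    by rewrite !in_setU !in_setD => /orP[]/andP[_]; [apply: s1 | apply: s2].
  by apply/idP/idP => lC;
    [have [? ?] := above C _ CC zC jS lC | have [? ?] := above C _ CC zC kS lC];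
    apply: sub.
pose c := if [pick j in S] is Some j then d1 z j else false.
have dc j : j \in S -> d1 z j = c.
  by move=> jS; rewrite /c; case: pickP => [k kS|/(_ j)]; [apply: dS | rewrite jS].
exists (d1 i z (+) c), (d2 i z (+) c) => j jD; rewrite /swing.
have ji : j != i by move: jD; rewrite !inE.
have [j1|j1] := boolP (j \in w1); have [j2|j2] := boolP (j \in w2);
  rewrite ?andbT ?andbF ?addbF.
- rewrite (swing_sibling dF1 d1C w1F iw1 j1 zw1) (swing_sibling dF2 d2C w2F iw2 j2 zw2).
  by case: (d1 i z); case: (d2 i z); case: (c).
- rewrite (swing_sibling dF1 d1C w1F iw1 j1 zw1) (swing_outside dF2 iw2F zw2 j2 ji).
  by rewrite -d12 // dc // !inE j1 j2.
- rewrite (swing_sibling dF2 d2C w2F iw2 j2 zw2) (swing_outside dF1 iw1F zw1 j1 ji).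
  by rewrite dc ?inE ?j1 ?j2 // addbC.
rewrite (swing_outside dF1 iw1F zw1 j1 ji) (swing_outside dF2 iw2F zw2 j2 ji).
by rewrite d12 // addbb.
Qed.

End TwoSides.

(** * Minimising separately on the groups of edges *)

Section Optimality.
Variables (K K' : {set V}).

Definition fewer E : Prop := #|K :&: E| <= #|K' :&: E|.

Lemma fewer_same E : (forall j, j \in E -> (j \in K) = (j \in K')) -> fewer E.
Proof.
move=> H; rewrite /fewer; suff -> : K :&: E = K' :&: E by [].
by apply/setP => j; rewrite !inE; case: (boolP (j \in E)) => [/H->|_]; rewrite ?andbF.
Qed.

Lemma fewer_none E : (forall j, j \in E -> j \notin K) -> fewer E.
Proof.
move=> H; rewrite /fewer; suff -> : K :&: E = set0 by rewrite cards0.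
by apply/setP => j; rewrite !inE andbC; case: (boolP (j \in E)) => //= /H/negPf->.
Qed.

(** A competitor either crosses the same edges of the group or the other ones. *)
Lemma fewer_group E (b : bool) : (forall j, j \in E -> (j \in K') = (j \in K) (+) b) ->
  2 * #|K :&: E| <= #|E| -> fewer E.
Proof.
case: b => H le; last by apply: fewer_same => j /H->; rewrite addbF.
rewrite /fewer; suff -> : K' :&: E = E :\: K by have := cardsID K E; rewrite setIC; lia.
by apply/setP => j; rewrite !inE; case: (boolP (j \in E)) => [/H->|_]; rewrite ?andbF ?addbT ?andbT.
Qed.

Lemma fewer_split E E' : E' \subset E -> fewer E' -> fewer (E :\: E') -> fewer E.
Proof.
rewrite /fewer => /setIidPr EE.
have P (L : {set V}) : #|L :&: E| = #|L :&: E'| + #|L :&: (E :\: E')|.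
  by rewrite -(cardsID E' (L :&: E)) -setIA EE setIDA.
rewrite !P; lia.
Qed.

End Optimality.

(** For the traces of the chain v_m, ..., v_1 and for that of v_0, these are the
    sets E(v_m), ..., E(v_1). *)
Fixpoint groups (A0 : {set V}) (As : seq {set V}) : seq {set V} :=
  if As is A :: As' then (A :\: head A0 As') :: groups A0 As' else [::].

Lemma fewer_chain K K' A0 As :
  sorted (fun A B => B \proper A) As -> {in As, forall A, A0 \proper A} ->
  fewer K K' A0 -> {in groups A0 As, forall E, fewer K K' E} ->
  fewer K K' (head A0 As).
Proof.
elim: As => //= A As IH sA sub f0 fE.
have {}IH : fewer K K' (head A0 As).
  apply: IH => //; first exact: path_sorted sA.
    by move=> B BAs; apply: sub; rewrite inE BAs orbT.
  by move=> E EAs; apply: fE; rewrite inE EAs orbT.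
apply: fewer_split IH (fE _ (mem_head _ _)).
case: As sA sub {fE} => /= [_ /(_ A)|B As /andP[/proper_sub//]].
by rewrite mem_head => /(_ isT)/proper_sub.
Qed.

Lemma sorted_top A0 As C : sorted (fun A B => B \proper A) As ->
  C \in As -> C \subset head A0 As.
Proof.
case: As => //= A As; rewrite inE => sA /predU1P[->//|CAs].
have tr : transitive (fun A B : {set V} => B \proper A).
  by move=> B1 B2 B3 h1 h2; apply: proper_trans h2 h1.
exact: proper_sub (allP (order_path_min tr sA) _ CAs).
Qed.

(** Each group is a layer of the chain, so its members cannot cut through it. *)
Lemma groupsP A0 As E : sorted (fun A B => B \proper A) As ->
  {in As, forall A, A0 \proper A} -> E \in groups A0 As ->
  exists A B, [/\ A \in As, E = A :\: B, A0 \subset B &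
    {in As, forall C, A \subset C \/ C \subset B}].
Proof.
elim: As => //= A As IH sA sub; rewrite inE => /predU1P[->|EAs].
  exists A, (head A0 As); split; rewrite ?mem_head //.
    case: As sub {IH sA} => //= B As /(_ B); rewrite !inE eqxx orbT.
    by move/(_ isT)/proper_sub.
  move=> C; rewrite inE => /predU1P[->|CAs]; [by left | right].
  exact: sorted_top (path_sorted sA) CAs.
have [|B [B' [BAs -> S H]]] := IH (path_sorted sA) _ EAs.
  by move=> B BAs; apply: sub; rewrite inE BAs orbT.
exists B, B'; split=> //; first by rewrite inE BAs orbT.
move=> C; rewrite inE => /predU1P[->|/H//]; left.
by apply: (@sorted_top A0 (A :: As) B sA); rewrite inE BAs orbT.
Qed.

Section Chains.
Variables (F1 F2 : seq {set V}) (i : V) (w1 w2 : {set V}).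
Let D := [set~ i].
Hypotheses (H1 : hierarchy F1) (w1F : w1 \in F1) (iw1 : i \notin w1).

(** The set L(I)_S of the algorithm, seen through the edges; exchanging the
    hierarchies gives L(I)_T. *)
Definition one_sided As : Prop :=
  sorted (fun A B => B \proper A) As /\
  forall C, C \in As <-> [/\ common F1 F2 D C, w2 \proper C & ~~ (w1 \proper C)].

Lemma common_sub C : common F1 F2 D C -> C \subset D.
Proof. by move=> [A [B [_ _ <- _]]]; apply: subsetIr. Qed.

Lemma common_nested C C' x : common F1 F2 D C -> common F1 F2 D C' ->
  x \in C -> x \in C' -> C \subset C' \/ C' \subset C.
Proof.
move=> [A [_ [AF _ <- _]]] [A' [_ [AF' _ <- _]]]; rewrite !inE.
move=> /andP[xA _] /andP[xA' _].
by case: (H1.1 _ _ AF AF' _ xA xA') => S; [left | right]; apply: setSI.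
Qed.

Lemma common_sibling C x : common F1 F2 D C -> x \in C -> x \in w1 ->
  C \subset w1 \/ w1 \proper C.
Proof.
move=> CC xC xw; have [|/subsetPn[z zC zw]] := boolP (C \subset w1); first by left.
by right; apply: (common_above H1 w1F iw1 CC xw zw xC zC).
Qed.

(** A common cluster above w2 is above w1 as well, and then contains every member
    of the chain that it meets, or belongs to the chain. *)
Lemma group_tight2 As E : one_sided As -> E \in groups w2 As ->
  E \subset D /\ tight F2 F1 i w2 E.
Proof.
move=> [sA HA] EAs.
have [|A [B [AAs -> S H]]] := groupsP sA _ EAs; first by move=> A /HA[].
have [CA w2A w1A] := proj1 (HA A) AAs; split.
  exact: subset_trans (subsetDl _ _) (common_sub CA).
right; split.
  by rewrite disjoint_sym disjoints_subset (subset_trans S) // setCD subsetUr.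
move=> C j /commonC CC w2C; rewrite inE => /andP[jB jA] jC.
apply: subset_trans (subsetDl _ _) _.
have [w1C|w1C] := boolP (w1 \proper C).
  have [//|CA'] := common_nested CA CC jA jC.
  by rewrite (proper_sub_trans w1C CA') in w1A.
have [//|/subsetP/(_ _ jC)] := H C (proj2 (HA C) (And3 CC w2C w1C)).
by rewrite (negPf jB).
Qed.

(** A common cluster above w1 is not inside a member of the chain. *)
Lemma one_sided_out As E : one_sided As ->
  [disjoint head w2 As & w1] -> E \in groups w2 As -> tight F1 F2 i w1 E.
Proof.
move=> [sA HA] dis EAs.
have [|A [B [AAs -> S H]]] := groupsP sA _ EAs; first by move=> A /HA[].
have [CA w2A w1A] := proj1 (HA A) AAs; right; split.
  apply: disjointWl dis; apply: subset_trans (subsetDl _ _) _.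
  exact: sorted_top sA AAs.
move=> C j CC w1C; rewrite inE => /andP[jB jA] jC.
apply: subset_trans (subsetDl _ _) _.
have [//|CA'] := common_nested CA CC jA jC.
by rewrite (proper_sub_trans w1C CA') in w1A.
Qed.

(** A common cluster that meets w1 is inside w1 or above it. *)
Lemma top_disjoint As : one_sided As -> [disjoint w1 & w2] ->
  As = [::] \/ ~~ (head w2 As \subset w1) -> [disjoint head w2 As & w1].
Proof.
move=> [_ HA] w12 [->|]; first by rewrite disjoint_sym.
case: As HA => [|A As] HA /= top; first by rewrite disjoint_sym.
have [CA _ w1A] := proj1 (HA A) (mem_head _ _).
apply/pred0P => x /=; apply/negbTE/negP => /andP[xA xw].
have [S|S] := common_sibling CA xA xw; first by rewrite S in top.
by rewrite S in w1A.
Qed.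

End Chains.

Lemma tops_disjoint F1 F2 i w1 w2 As Bs : hierarchy F1 ->
  one_sided F1 F2 i w1 w2 As -> one_sided F2 F1 i w2 w1 Bs ->
  [disjoint head w2 As & w1] -> [disjoint head w1 Bs & w2] ->
  [disjoint head w1 Bs & head w2 As].
Proof.
move=> H1 [_ HA] [_ HB]; case: As HA => [|A As] HA //=.
case: Bs HB => [|B Bs] HB /= disA disB; first by rewrite disjoint_sym.
have [CA w2A w1A] := proj1 (HA A) (mem_head _ _).
have [/commonC CB w1B w2B] := proj1 (HB B) (mem_head _ _).
apply/pred0P => x /=; apply/negbTE/negP => /andP[xB xA].
have [S|S] := common_nested H1 CA CB xA xB.
  by rewrite (proper_sub_trans w2A S) in w2B.
by rewrite (proper_sub_trans w1B S) in w1A.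
Qed.


Section Cases.
Variables (F1 F2 : seq {set V}) (i : V) (w1 w2 : {set V}) (d1 d2 : rel V).
Let D := [set~ i].
Hypotheses (H1 : hierarchy F1) (H2 : hierarchy F2).
Hypotheses (dF1 : congruent F1 setT d1) (dF2 : congruent F2 setT d2).
Hypotheses (d1C : symmetric_on setT d1) (d2C : symmetric_on setT d2).
Hypothesis d12 : forall x y, x \in D -> y \in D -> d1 x y = d2 x y.
Hypotheses (w1F : w1 \in F1) (iw1F : i |: w1 \in F1) (iw1 : i \notin w1).
Hypotheses (w2F : w2 \in F2) (iw2F : i |: w2 \in F2) (iw2 : i \notin w2).
Hypotheses (w1_ex : exists z, z \in w1) (w2_ex : exists z, z \in w2).
Variables (K K' : {set V}).
Hypothesis KK' : forall j, j \in D -> (j \in K') = (j \in K) (+) swing i d1 d2 j.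

Definition settled E : Prop := 2 * #|K :&: E| <= #|E|.

Lemma settled_fewer E : E \subset D -> tight F1 F2 i w1 E -> tight F2 F1 i w2 E ->
  settled E -> fewer K K' E.
Proof.
move=> ED t1 t2 sE; have [->|[j jE]] := set_0Vmem E.
  by apply: fewer_none => j; rewrite inE.
apply: (fewer_group (b := swing i d1 d2 j)) sE => k kE.
rewrite KK' ?(subsetP ED) //; congr (_ (+) _).
exact: (swing_const H1 H2 dF1 dF2 d1C d2C d12 w1F iw1F iw1 w2F iw2F iw2 _ _ ED t1 t2).
Qed.

Lemma none_fewer E : E \subset D -> [disjoint E & w1] -> [disjoint E & w2] ->
  (forall C j, common F1 F2 D C -> j \in E -> j \in C ->
     (w1 \proper C) = (w2 \proper C)) ->
  fewer K K' E.
Proof.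
move=> /subsetP ED /pred0P E1 /pred0P E2 HC; apply: fewer_same => j jE.
rewrite KK' ?ED // (swing_none H1 H2 dF1 dF2 d1C d12 w1F iw1F iw1 w2F) ?addbF ?ED //.
- by have := E1 j; rewrite /= jE => /= ->.
- by have := E2 j; rewrite /= jE => /= ->.
by move=> C CC jC; apply: (HC C j).
Qed.

Let DI (w : {set V}) : i \notin w -> w \subset D.
Proof. by move=> iw; apply/subsetP => j jw; rewrite !inE; apply: contraNneq iw => <-. Qed.

Let D_opt : fewer K K' D -> K \subset D -> K' \subset D -> #|K| <= #|K'|.
Proof. by rewrite /fewer => f /setIidPl KE /setIidPl K'E; rewrite KE K'E in f. Qed.

(** The sets w2, the groups of the chain and the rest of w1 fill w1, and nothing
    swings outside w1: a common cluster that reaches outside w1 and is above one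
    of the sibling sets is above both. *)
Theorem nested_optimal As : one_sided F1 F2 i w1 w2 As -> As != [::] ->
  head w2 As \subset w1 -> settled (w1 :\: head w2 As) -> settled w2 ->
  {in groups w2 As, forall E, settled E} ->
  K \subset D -> K' \subset D -> #|K| <= #|K'|.
Proof.
move=> OS As0 top s1 s2 sE; apply: D_opt; have [sA HA] := OS.
have subA A : A \in As -> A \subset w1.
  by move=> AAs; apply: subset_trans (sorted_top _ sA AAs) top.
have w2top : w2 \subset head w2 As.
  case: As As0 HA {OS top s1 sE sA subA} => //= A As _ /(_ A); rewrite mem_head.
  by case=> /(_ isT)[_ /proper_sub].
have w21 := subset_trans w2top top.
have f2 : fewer K K' w2 by apply: settled_fewer; rewrite ?DI //; left.
have ftop : fewer K K' (head w2 As).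
  apply: fewer_chain => //; first by move=> A /HA[].
  move=> E EAs; have [ED t2] := group_tight2 H1 OS EAs.
  apply: settled_fewer (sE _ EAs) => //; left.
  have [|A [B [AAs -> _ _]]] := groupsP sA _ EAs; first by move=> A /HA[].
  exact: subset_trans (subsetDl _ _) (subA _ AAs).
have f1 : fewer K K' w1.
  apply: fewer_split top ftop _; apply: settled_fewer s1.
  - exact: subset_trans (subsetDl _ _) (DI iw1).
  - by left; apply: subsetDl.
  right; split.
    by rewrite disjoint_sym disjoints_subset (subset_trans w2top) // setCD subsetUr.
  move=> C j /commonC CC w2C; rewrite inE => /andP[jtop jw1] jC.
  apply: subset_trans (subsetDl _ _) _.
  have [/proper_sub//|w1C] := boolP (w1 \proper C).
  have CAs := proj2 (HA C) (And3 CC w2C w1C).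
  by rewrite (subsetP (sorted_top w2 sA CAs) _ jC) in jtop.
apply: fewer_split (DI iw1) f1 _; apply: none_fewer.
- exact: subsetDl.
- by rewrite disjoint_sym disjoints_subset setCD subsetUr.
- by rewrite disjoint_sym disjoints_subset (subset_trans w21) // setCD subsetUr.
move=> C j CC; rewrite inE => /andP[jw1 _] jC; apply/idP/idP => wC.
  exact: sub_proper_trans w21 wC.
have [//|w1C] := boolP (w1 \proper C).
by have := subsetP (subA _ (proj2 (HA C) (And3 CC wC w1C))) _ jC; rewrite (negPf jw1).
Qed.

(** The tops of the two chains are disjoint sets, filled by the sibling sets and
    by the groups; a common cluster that reaches outside the tops is above both
    sibling sets or above none, so nothing swings there. *)
Theorem disjoint_optimal As Bs : [disjoint w1 & w2] ->
  one_sided F1 F2 i w1 w2 As -> one_sided F2 F1 i w2 w1 Bs ->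
  (As = [::] \/ ~~ (head w2 As \subset w1)) ->
  (Bs = [::] \/ ~~ (head w1 Bs \subset w2)) ->
  [disjoint K & w1] -> [disjoint K & w2] ->
  {in groups w2 As, forall E, settled E} ->
  {in groups w1 Bs, forall E, settled E} ->
  K \subset D -> K' \subset D -> #|K| <= #|K'|.
Proof.
move=> w12 OA OB topA topB K1 K2 sA sB; apply: D_opt.
have [srtA HA] := OA; have [srtB HB] := OB.
have none (w : {set V}) : [disjoint K & w] -> fewer K K' w.
  move=> /pred0P Kw; apply: fewer_none => j jw; apply/negP => jK.
  by have := Kw j; rewrite /= jK jw.
have disA := top_disjoint H1 w1F iw1 OA w12 topA.
have disB : [disjoint head w1 Bs & w2].
  by apply: (top_disjoint H2 w2F iw2 OB _ topB); rewrite disjoint_sym.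
have disAB := tops_disjoint H1 OA OB disA disB.
have fA : fewer K K' (head w2 As).
  apply: fewer_chain (none _ K2) _ => //; first by move=> A /HA[].
  move=> E EAs; have [ED t2] := group_tight2 H1 OA EAs.
  exact: settled_fewer ED (one_sided_out H1 OA disA EAs) t2 (sA _ EAs).
have fB : fewer K K' (head w1 Bs).
  apply: fewer_chain (none _ K1) _ => //; first by move=> B /HB[].
  move=> E EBs; have [ED t1] := group_tight2 H2 OB EBs.
  exact: settled_fewer ED t1 (one_sided_out H2 OB disB EBs) (sB _ EBs).
have topD (w w' : {set V}) (Cs : seq {set V}) (G G' : seq {set V}) : i \notin w ->
    one_sided G G' i w' w Cs -> head w Cs \subset D.
  case: Cs => [|C Cs] iw [_ HC] /=; first exact: DI.
  by have [CC _ _] := proj1 (HC C) (mem_head _ _); apply: common_sub CC.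
have fAB : fewer K K' (head w2 As :|: head w1 Bs).
  apply: fewer_split (subsetUl _ _) fA _.
  rewrite setDUl setDv set0U; suff /setDidPl-> : [disjoint head w1 Bs & head w2 As] by [].
  exact: disAB.
have UD : head w2 As :|: head w1 Bs \subset D.
  by rewrite subUset (topD _ _ _ _ _ iw2 OA) (topD _ _ _ _ _ iw1 OB).
have above (w w' : {set V}) (Cs : seq {set V}) (G G' : seq {set V}) :
    one_sided G G' i w' w Cs -> w \subset head w Cs.
  case: Cs => [|C Cs] [_ HC] //=.
  by have [_ /proper_sub] := proj1 (HC C) (mem_head _ _).
apply: fewer_split UD fAB _; apply: none_fewer.
- exact: subsetDl.
- rewrite disjoint_sym disjoints_subset setCD subsetU // orbC.
  by rewrite (subset_trans (above _ _ _ _ _ OB)) // subsetUr.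
- rewrite disjoint_sym disjoints_subset setCD subsetU // orbC.
  by rewrite (subset_trans (above _ _ _ _ _ OA)) // subsetUl.
move=> C j CC; rewrite !inE negb_or => /andP[/andP[jA jB] _] jC.
apply/idP/idP => wC; apply: contraT => wC'.
  have CBs := proj2 (HB C) (And3 (commonC CC) wC wC').
  by rewrite (subsetP (sorted_top w1 srtB CBs) _ jC) in jB.
have CAs := proj2 (HA C) (And3 CC wC wC').
by rewrite (subsetP (sorted_top w2 srtA CAs) _ jC) in jA.
Qed.

End Cases.

End Hierarchies.

(** * The hierarchy of edge sets of a tree *)

Section Clusters.
Variables (n : nat) (g : 'I_n -> 'I_n) (t : tree 'I_n).
Hypotheses (gI : injective g) (tE : perm_eq (leaves t) (enum 'I_n)).
Implicit Types (u v w : tree 'I_n) (i j x y z : 'I_n).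

Definition cluster u : {set 'I_n} := [set j | g j \in leaves u].
Definition clusters : seq {set 'I_n} := [seq cluster u | u <- vertices t].

Lemma leaves_all x : x \in leaves t.
Proof. by rewrite (perm_mem tE) mem_enum. Qed.

Lemma leaves_tree_uniq : uniq (leaves t).
Proof. by rewrite (perm_uniq tE) enum_uniq. Qed.

Lemma size_leaves : size (leaves t) = n.
Proof. by rewrite (perm_size tE) size_enum_ord. Qed.

Lemma cluster_in u : u \in vertices t -> cluster u \in clusters.
Proof. exact: map_f. Qed.

Lemma cluster_mono u v : u \in vertices v -> cluster u \subset cluster v.
Proof. by move=> uv; apply/subsetP => j; rewrite !inE; apply: leaves_sub. Qed.

Lemma cluster_Node u v : cluster (Node u v) = cluster u :|: cluster v.
Proof. by apply/setP => j; rewrite !inE mem_cat. Qed.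

Lemma cluster_disjoint u v : Node u v \in vertices t ->
  [disjoint cluster u & cluster v].
Proof.
move=> /leaves_uniq/(_ leaves_tree_uniq) U; apply/pred0P => j /=.
rewrite !inE; apply/negbTE/negP => /andP[ju].
by rewrite (negPf (leaves_disjoint U ju)).
Qed.

(** The lowest common ancestor of two leaves is the branching that separates
    them. *)
Lemma hierarchy_clusters : hierarchy clusters.
Proof.
split.
  move=> _ _ /mapP[u ut ->] /mapP[v vt ->] x; rewrite !inE => xu xv.
  have [uv|vu] := vertices_laminar leaves_tree_uniq ut vt xu xv.
    by left; apply: cluster_mono.
  by right; apply: cluster_mono.
move=> x y xy; have gxy : g x != g y by apply: contraNneq xy => /gI->.
have [u [v [uvt H]]] := vertices_lca gxy (leaves_all _) (leaves_all _).
have P a b : cluster a :|: cluster b = cluster (Node u v) -> a \in vertices t ->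
    b \in vertices t -> [disjoint cluster a & cluster b] -> g x \in leaves a ->
    g y \in leaves b -> parts clusters x y (cluster a) (cluster b).
  by move=> E at_ bt ab xa yb; split=> //; rewrite E !cluster_in // !inE; split.
have D := cluster_disjoint uvt.
have ut := vertices_childl uvt; have vt := vertices_childr uvt.
case: H => -[xu yv]; [exists (cluster u), (cluster v) | exists (cluster v), (cluster u)];
  apply: P; rewrite // ?cluster_Node 1?setUC // 1?setUC //.
by rewrite disjoint_sym.
Qed.

Lemma congruent_leaf_order X : leaf_order (Some t) X ->
  congruent clusters setT (fun x y => before X (g x) (g y)).
Proof.
move=> /(leaf_orderP _ leaves_tree_uniq)[_ H] _ /mapP[u ut ->] x y z _ _ _.
by rewrite !inE => xu yu zu; apply: (H u) => //; apply: leaves_all.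
Qed.

Lemma leaf_order_all X x : leaf_order (Some t) X -> x \in X.
Proof. by move=> [/perm_mem-> _]; apply: leaves_all. Qed.

Lemma leaf_order_uniq X : leaf_order (Some t) X -> uniq X.
Proof. by move=> [/perm_uniq-> _]; apply: leaves_tree_uniq. Qed.

Lemma leaf_order_size X : leaf_order (Some t) X -> size X = n.
Proof. by move=> [/perm_size-> _]; apply: size_leaves. Qed.

(** The effect of a flip or of a switch is a set c of inverted pairs; the result
    is a leaf order as soon as c respects the clusters, so neither operation has
    to be followed block by block. *)
Lemma leaf_order_invert X X' (c : rel 'I_n) : leaf_order (Some t) X ->
  perm_eq X' X ->
  (forall x y, x != y -> before X' x y = before X x y (+) c x y) ->
  {in vertices t, forall w x y z, x \in leaves w -> y \in leaves w ->
     z \notin leaves w -> c x z = c y z} ->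
  leaf_order (Some t) X'.
Proof.
move=> /(leaf_orderP _ leaves_tree_uniq)[Xt H] X'X X'E cH.
apply/(leaf_orderP _ leaves_tree_uniq); split; first exact: perm_trans X'X Xt.
move=> w wt x y z xw yw zt zw.
have nz a : a \in leaves w -> a != z by move=> aw; apply: contraNneq zw => <-.
by rewrite (X'E _ _ (nz _ xw)) (X'E _ _ (nz _ yw)); congr addb; [apply: (H w) | apply: (cH w)].
Qed.

End Clusters.

(** * Reversing and exchanging blocks *)

Section Blocks.
Variable A : eqType.
Implicit Types (p q r X : seq A) (x y : A).

Lemma before_mid p q q' r x y : uniq (p ++ q ++ r) -> perm_eq q' q ->
  before (p ++ q' ++ r) x y =
  if (x \in q) && (y \in q) then before q' x y else before (p ++ q ++ r) x y.
Proof.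
move=> U qq'; rewrite /before !index_cat !(perm_mem qq') (perm_size qq').
have np w : w \in q -> (w \in p) = false.
  move: U; rewrite cat_uniq => /and3P[_ /hasPn H _] wq; apply/negbTE/H.
  by rewrite mem_cat wq.
have sz w : w \in q -> index w q < size q /\ index w q' < size q.
  by move=> wq; rewrite -{2}(perm_size qq') !index_mem (perm_mem qq').
case xq: (x \in q); case yq: (y \in q) => //=; rewrite ?(np _ xq) ?(np _ yq).
- by rewrite ltn_add2l.
- case: ifP => yp; last by have [? ?] := sz _ xq; lia.
  by have := index_mem y p; rewrite yp; lia.
case: ifP => xp; last by have [? ?] := sz _ yq; lia.
by have := index_mem x p; rewrite xp; lia.
Qed.

Lemma before_rev q x y : uniq q -> x \in q -> y \in q ->
  before (rev q) x y = before q y x.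
Proof.
rewrite /before; elim: q => //= a q IH /andP[aq Uq].
rewrite rev_cons -cats1 !index_cat !mem_rev !size_rev !inE /=.
rewrite ![_ == a]eq_sym.
have ix z : z \in q -> index z (rev q) < size q.
  by rewrite -mem_rev -index_mem size_rev.
have [ax|ax] := eqVneq a x; have [ay|ay] := eqVneq a y => /= xq yq.
- by rewrite -ax -ay (negPf aq) ltnn.
- by rewrite -ax (negPf aq) yq addn0; have := ix _ yq; lia.
- by rewrite -ay (negPf aq) xq addn0; have := ix _ xq; lia.
by rewrite xq yq IH.
Qed.

Lemma before_flip p q r x y : uniq (p ++ q ++ r) -> x \in p ++ q ++ r -> x != y ->
  before (p ++ rev q ++ r) x y =
  before (p ++ q ++ r) x y (+) ((x \in q) && (y \in q)).
Proof.
move=> U xX xy; rewrite (before_mid _ _ U) ?perm_rev // 1?perm_sym ?perm_rev //.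
have Uq : uniq q by move: U; rewrite !cat_uniq => /and3P[_ _ /and3P[]].
have := @before_mid p q q r x y U (perm_refl _).
case: ifP => [/andP[xq yq] ->|_ _]; last by rewrite addbF.
by rewrite addbT before_rev // (before_total xq xy).
Qed.

Lemma before_switch p q1 q2 r x y : uniq (p ++ (q1 ++ q2) ++ r) ->
  before (p ++ (q2 ++ q1) ++ r) x y =
  before (p ++ (q1 ++ q2) ++ r) x y (+)
    ((x \in q1) && (y \in q2) || (x \in q2) && (y \in q1)).
Proof.
move=> U; have Q : perm_eq (q2 ++ q1) (q1 ++ q2) by rewrite perm_catC.
rewrite (before_mid _ _ U Q).
have := @before_mid p (q1 ++ q2) (q1 ++ q2) r x y U (perm_refl _).
have Uq : uniq (q1 ++ q2) by move: U; rewrite !cat_uniq => /and3P[_ _ /and3P[]].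
have q12 z : z \in q2 -> (z \in q1) = false.
  by move=> zq; move: Uq; rewrite cat_uniq => /and3P[_ /hasPn H _]; apply/negbTE/H.
rewrite !mem_cat; case: ifP => [/andP[xq yq] ->|N _]; last first.
  suff /negbTE-> : ~~ ((x \in q1) && (y \in q2) || (x \in q2) && (y \in q1)).
    by rewrite addbF.
  by apply: contraFN N => /orP[]/andP[-> ->]; rewrite ?orbT.
rewrite /before !index_cat; have := index_mem x q1; have := index_mem x q2.
have := index_mem y q1; have := index_mem y q2; move: xq yq.
case x2: (x \in q2); case y2: (y \in q2); rewrite ?(q12 _ x2) ?(q12 _ y2) ?orbT ?orbF /=;
  do ?[move=> ->]; move=> *; rewrite /= ?ltn_add2l ?addbF ?addbT //; lia.
Qed.

End Blocks.

(** * Layouts extending a planar one *)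

Section Layouts.
Variables (n : nat) (G : tanglegram n) (i : 'I_n).
Let T := treeT G.
Let S := treeS G.
Let f := phi G.
Implicit Types (X Y : seq 'I_n) (XY : layout n) (j k : 'I_n).

(** The layouts among which the problem asks for the best one, described by
    comparisons only. *)
Definition extending XY : Prop :=
  [/\ leaf_order (Some T) XY.1, leaf_order (Some S) XY.2 &
      forall j k, j != i -> k != i -> j != k ->
        before XY.1 j k = before XY.2 (f j) (f k)].

Lemma crossesE XY j k :
  crosses f XY j k = before XY.1 j k (+) before XY.2 (f j) (f k).
Proof. by rewrite /crosses /before negb_eqb. Qed.

Lemma crossesC XY j k : leaf_order (Some T) XY.1 -> leaf_order (Some S) XY.2 ->
  crosses f XY j k = crosses f XY k j.
Proof.
have [->//|jk] := eqVneq j k => LX LY; rewrite !crossesE.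
rewrite (before_total (leaf_order_all (leavesT G) k LX)) 1?eq_sym //.
rewrite (before_total (leaf_order_all (leavesS G) (f k) LY)).
  by rewrite addNb addbN negbK.
by rewrite eq_sym (inj_eq perm_inj).
Qed.

Let inI j : (j \in [set~ i]) = (j != i).
Proof. by rewrite !inE. Qed.

Let infI j : (f j \in f @: [set~ i]) = (j != i).
Proof. by rewrite mem_imset ?inI //; apply: perm_inj. Qed.

(** For distinct edges other than i, comparing the orders of the two sides is the
    same in a layout and in its restriction. *)
Lemma extendingP XY : extends_planar G i XY <-> extending XY.
Proof.
case: XY => X Y; split.
  move=> [[LX LY] [_ /eqP]]; rewrite cards_eq0 => /eqP cr0; split=> //= j k ji ki jk.
  suff H a b : a != i -> b != i -> a < b ->
      crosses f (restrict_layout G [set~ i] (X, Y)) a b = false.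
    have E a b : a != i -> b != i -> a < b -> before X a b = before Y (f a) (f b).
      move=> ai bi ab; have /negbT := H _ _ ai bi ab; rewrite crossesE /=.
      by rewrite !before_filter ?inI ?infI // -negb_eqb negbK => /eqP.
    have [jk'|kj|/val_inj/eqP] := ltngtP j k; last by rewrite (negPf jk).
      exact: E.
    rewrite (before_total (leaf_order_all (leavesT G) k LX)) 1?eq_sym //.
    rewrite (before_total (leaf_order_all (leavesS G) (f k) LY)) 1?E //.
    by rewrite eq_sym (inj_eq perm_inj).
  move=> ai bi ab; apply/negbTE/negP => crab.
  have := in_set0 (a, b); rewrite -cr0 inE /= !mem_filter !inI ai bi.
  by rewrite !(leaf_order_all (leavesT G)) // ab crab.
move=> [/= LX LY P]; split=> //; split; last first.
  apply/eqP; rewrite cards_eq0; apply/eqP/setP => -[a b]; rewrite in_set0 inE /=.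
  apply/negbTE/negP => /and4P[]; rewrite !mem_filter !inI => /andP[ai _] /andP[bi _] ab.
  rewrite crossesE /= !before_filter ?inI ?infI // P ?addbb //.
  by apply: contraTneq ab => ->; rewrite ltnn.
have U := leaves_tree_uniq (leavesT G); have V := leaves_tree_uniq (leavesS G).
have [XT HX] := proj1 (leaf_orderP _ U) LX; have [YS HY] := proj1 (leaf_orderP _ V) LY.
split=> /=.
  apply/(leaf_order_inducedP _ _ U); split; first exact: perm_filter.
  move=> u ut x y z xI yI zI xu yu zt zu.
  by rewrite !before_filter //; apply: (HX u).
apply/(leaf_order_inducedP _ _ V); split; first exact: perm_filter.
move=> u ut x y z xI yI zI xu yu zt zu.
by rewrite !before_filter //; apply: (HY u).
Qed.

Definition crossed_by XY : {set 'I_n} := [set j | (j != i) && crosses f XY i j].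

(** All the crossings involve the inserted edge. *)
Lemma crossings_extending XY : extending XY -> crossings f XY = #|crossed_by XY|.
Proof.
move=> [LX LY P]; pose h j := if i < j then (i, j) else (j, i).
rewrite -(card_in_imset (f := h) (D := crossed_by XY)); last first.
  move=> a b; rewrite !inE /h => /andP[ai _] /andP[bi _].
  by case: ifP => _; case: ifP => _ /eqP; rewrite xpair_eqE ?eqxx ?(negPf ai) //=
    ?[i == b]eq_sym ?(negPf bi) ?andbT //= => /eqP.
apply: eq_card => -[a b]; rewrite inE /=; apply/idP/imsetP.
  move=> /and4P[_ _]; have [->|ai] := eqVneq a i => ab.
    move=> crab; exists b; rewrite ?inE ?crab ?andbT /h ?ab //.
    by apply: contraTneq ab => ->; rewrite ltnn.
  move: ab; have [->|bi] := eqVneq b i => ab.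
    move=> crab; exists a; rewrite ?inE 1?crossesC ?crab ?andbT ?neq_ltn ?ab //.
    by rewrite /h ltnNge ltnW.
  rewrite crossesE P ?addbb //.
  by apply: contraTneq ab => ->; rewrite ltnn.
move=> [j]; rewrite inE => /andP[ji cr]; rewrite /h.
case: ifP => ij [-> ->]; rewrite !(leaf_order_all (leavesT G)) //= ?ij //.
rewrite crossesC // cr andbT ltn_neqAle leqNgt ij andbT.
by rewrite (inj_eq val_inj).
Qed.

End Layouts.

(** * Tables *)

Lemma within_positions (K : eqType) size0 (l : seq K) : uniq l ->
  within (positions size0 l) (size0 + 2 * size l + 1)
    (fun pos => {in l, forall x, pos x = index x l}).
Proof.
move=> U; rewrite /positions.
apply: within_bind_eq; [exact: within_new_table | by lia |].
apply: within_bind; [apply: (within_lfold (k := 1) (Inv := fun p st =>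
   st.2 = size p /\ {in p, forall x, st.1 x = index x l})) | by lia | ].
- by [].
- move=> p x s [pos j] lE /= [-> Ip].
  apply: within_bind_eq; [exact: within_write | by [] |].
  apply: within_ret; split=> /=; first by rewrite size_rcons.
  move=> y; rewrite mem_rcons inE; case: eqP => [-> _|_ /Ip//].
  rewrite lE index_cat /= eqxx addn0; case: ifP => // xp.
  by move: U; rewrite lE cat_uniq /= xp /= andbF.
by move=> [pos j] [_ Ip]; apply: within_ret.
Qed.

Lemma split_filter (A : eqType) (Z : seq A) p q r X : uniq X ->
  X = p ++ q ++ r -> perm_eq q Z ->
  [/\ all (fun x => x \notin Z) p, all (mem Z) q & all (fun x => x \notin Z) r].
Proof.
move=> U XE qZ; move: U; rewrite XE !cat_uniq => /and3P[_ /hasPn H /and3P[_ /hasPn K _]].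
split; apply/allP => x xp; rewrite /= -(perm_mem qZ) //.
  by apply/negP => xq; have := H x; rewrite mem_cat xq /= xp; move=> /(_ isT).
exact: K.
Qed.

Section Tables.
Variable n : nat.
Implicit Types (t u v w : tree 'I_n) (a j x : 'I_n).

Fixpoint postorder_seq t : seq (tree 'I_n) :=
  match t with
  | Leaf _ => [:: t]
  | Node t1 t2 => postorder_seq t1 ++ postorder_seq t2 ++ [:: t]
  end.

Lemma mem_postorder t : postorder_seq t =i vertices t.
Proof.
elim: t => // t1 IH1 t2 IH2 u.
by rewrite /= !mem_cat !inE mem_cat IH1 IH2 orbA orbC.
Qed.

Lemma size_postorder t : (size (postorder_seq t)).+1 = 2 * size (leaves t).
Proof. by elim: t => //= t1 IH1 t2 IH2; rewrite !size_cat /=; lia. Qed.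

(** This is what lets the tables be filled bottom-up. *)
Lemma postorder_children t p s t1 t2 : postorder_seq t = p ++ Node t1 t2 :: s ->
  t1 \in p /\ t2 \in p.
Proof.
elim: t p s => [a|u1 IH1 u2 IH2] p s /=; first by case: p => [|? []].
move: (mem_postorder u1) (mem_postorder u2) IH1 IH2.
move: (postorder_seq u1) (postorder_seq u2) => l1 l2 M1 M2 IH1 IH2.
have split_cat (l l' p' s' : seq (tree 'I_n)) y : l ++ l' = p' ++ y :: s' ->
    (exists s0, l = p' ++ y :: s0) \/
    (exists p0, p' = l ++ p0 /\ l' = p0 ++ y :: s').
  elim: l p' => [|z l IH] [|z' p'] //=; first by move=> ->; right; exists [::].
  - by move=> ->; right; exists (z' :: p').
  - by move=> [-> _]; left; exists l.
  move=> [-> /IH[[s0 ->]|[p0 [-> ->]]]]; first by left; exists s0.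
  by right; exists p0.
move=> /split_cat[[s0 /IH1]//|[p1 [-> /split_cat[[s0 /IH2[H1 H2]]|[p2 [-> E]]]]]].
  by rewrite !mem_cat H1 H2 !orbT.
have p20 : p2 = [::] by apply: size0nil; have := congr1 size E; rewrite size_cat /=; lia.
move: E; rewrite p20 => -[<- <- _].
by rewrite !mem_cat !M1 !M2 !vertices_refl ?orbT.
Qed.

Lemma within_postorder t :
  within (postorder t) (2 * size (leaves t)) (eq (postorder_seq t)).
Proof.
suff H acc : within (postorder_acc t acc) (size (vertices t))
    (eq (postorder_seq t ++ acc)).
  rewrite /postorder; apply: within_weaken; [exact: H | | by move=> _ <-; rewrite cats0].
  by have := size_vertices t; lia.
elim: t acc => [a|t1 IH1 t2 IH2] acc /=; apply: within_call => //.
  exact: within_ret.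
rewrite size_cat; apply: within_bind_eq; [exact: IH2 | by lia |].
by rewrite -!catA; apply: within_weaken; [exact: IH1 | by lia |].
Qed.

Definition is_below t (le : tree 'I_n * tree 'I_n -> bool) : Prop :=
  forall u w, le (u, w) = (u \in vertices t) && (w \in vertices u).

Lemma within_below_table t : size (leaves t) = n ->
  within (below_table t) (18 * n ^ 2) (is_below t).
Proof.
move=> tn; have n0 : 0 < n by rewrite -tn size_leaves_gt0.
have po := size_postorder t; rewrite tn in po.
rewrite /below_table; apply: within_bind_eq; [exact: within_new_table | by rewrite /nv; nia |].
apply: within_bind_eq; [exact: within_postorder | by rewrite /nv tn; nia |].
pose Inv (p : seq (tree 'I_n)) (le : tree 'I_n * tree 'I_n -> bool) :=
  forall u w, le (u, w) = (u \in p) && (w \in vertices u).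
apply: within_weaken; [apply: (within_lfold (k := 6 * n) (Inv := Inv)) | | ] => //.
- move=> p u s le pE Ile.
  have ut : u \in vertices t by rewrite -mem_postorder pE mem_cat mem_head orbT.
  have un : size (leaves u) <= size (leaves t).
    by case: (vertices_size ut) => [->|/ltnW].
  have pou := size_postorder u.
  apply: within_bind_eq; [exact: within_postorder | by lia |].
  pose Jnv (q : seq (tree 'I_n)) (le' : tree 'I_n * tree 'I_n -> bool) :=
    forall v w, le' (v, w) = le (v, w) || (v == u) && (w \in q).
  apply: within_weaken; [apply: (within_lfold (k := 1) (Inv := Jnv)) | | ].
  + by move=> x y; rewrite in_nil andbF orbF.
  + move=> q w r le' _ Ile'.
    apply: within_weaken; [exact: within_write | by [] |] => _ <- v y.
    rewrite Ile' mem_rcons inE xpair_eqE.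
    by case: (v == u); case: (y == w); rewrite ?orbT.
  + nia.
  move=> le' Ile' v y; rewrite Ile' Ile mem_rcons inE mem_postorder.
  by have [->|_] := eqVneq v u; case: (y \in _); rewrite ?orbT ?andbF ?orbF.
- rewrite /nv tn; nia.
by move=> le Ile u w; rewrite Ile mem_postorder.
Qed.

Lemma within_above le w w' :
  within (above le w w') 2 (eq (le (w, w') && (w != w'))).
Proof.
rewrite /above; apply: within_bind_eq; [exact: within_read | by [] |].
apply: within_bind_eq; [exact: within_same | by [] |]; exact: within_ret.
Qed.

Lemma within_parent t w : size (leaves t) = n -> w \in vertices t ->
  within (parent t w) (8 * n)
    (fun o => if o is Some u then
         exists u1 u2, [/\ u = Node u1 u2, u \in vertices t & u1 = w \/ u2 = w]
       else w = t).
Proof.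
move=> tn wt; have n0 : 0 < n by rewrite -tn size_leaves_gt0.
have po := size_postorder t; rewrite tn in po.
rewrite /parent; apply: within_bind_eq; [exact: within_postorder | by rewrite tn; lia |].
pose found u := exists u1 u2,
  [/\ u = Node u1 u2, u \in vertices t & u1 = w \/ u2 = w].
apply: within_weaken; [apply: (within_lfold (A := tree 'I_n) (k := 2) (Inv := fun p o =>
  if o is Some u then found u else forall u, u \in p -> ~ found u)) | | ] => //.
- move=> p u s o pE Io.
  have ut : u \in vertices t by rewrite -mem_postorder pE mem_cat mem_head orbT.
  case: u ut pE => [a|u1 u2] ut _.
    apply: within_ret; case: o Io => // Io u; rewrite mem_rcons inE.
    by case/predU1P => [-> [? [? []]]|/Io].
  apply: within_bind_eq; [exact: within_same | by [] |].
  apply: within_bind_eq; [exact: within_same | by [] |].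
  apply: within_ret; case: ifP => [/orP H|/norP[/eqP n1 /eqP n2]].
    by exists u1, u2; split=> //; case: H => /eqP; [left | right].
  case: o Io => // Io u; rewrite mem_rcons inE.
  by case/predU1P => [-> [? [? [[<- <-] _ []]]]|/Io].
- rewrite tn; lia.
case=> // H; have [//|/eqP wt'] := eqVneq w t.
have [u1 [u2 [ut uw]]] := vertices_parent wt wt'.
by case: (H (Node u1 u2)); rewrite ?mem_postorder //; exists u1, u2.
Qed.

Lemma within_count_table t a : size (leaves t) = n ->
  within (count_table t a) (12 * n)
    (fun c => {in vertices t, forall u, c u = count (fun b => b != a) (leaves u)}).
Proof.
move=> tn; have n0 : 0 < n by rewrite -tn size_leaves_gt0.
have po := size_postorder t; rewrite tn in po.
rewrite /count_table; apply: within_bind_eq; [exact: within_new_table | by rewrite /nv; lia |].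
apply: within_bind_eq; [exact: within_postorder | by rewrite /nv tn; lia |].
apply: within_weaken; [apply: (within_lfold (A := tree 'I_n) (k := 3) (Inv := fun p c =>
  {in p, forall u, c u = count (fun b => b != a) (leaves u)})) | | ] => //.
- move=> p u s c pE Ic; case: u pE => [b|u1 u2] pE.
    apply: within_weaken; [exact: within_write | by [] |] => _ <- u.
    by rewrite mem_rcons inE; case: eqP => [->|_ /Ic] //=; rewrite addn0.
  have [u1p u2p] := postorder_children pE.
  apply: within_bind_eq; [exact: within_read | by [] |].
  apply: within_bind_eq; [exact: within_read | by [] |].
  apply: within_weaken; [exact: within_write | by [] |] => _ <- u.
  rewrite mem_rcons inE; case: eqP => [->|_ /Ic] //= _.
  by rewrite count_cat !Ic.
- rewrite /nv tn; lia.
by move=> c Ic u ut; apply: Ic; rewrite mem_postorder.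
Qed.

(** * Operations on layouts *)

Section Splitting.
Variables (t : tree 'I_n) (le : tree 'I_n * tree 'I_n -> bool).
Hypotheses (tE : perm_eq (leaves t) (enum 'I_n)) (leP : is_below t le).

Lemma belowE u x : u \in vertices t -> le (u, Leaf x) = (x \in leaves u).
Proof. by move=> ut; rewrite leP ut mem_vertices_Leaf. Qed.

Lemma within_split_at X u : leaf_order (Some t) X -> u \in vertices t ->
  within (split_at le X u) (4 * n + 2) (fun pqr =>
    X = pqr.1.1 ++ pqr.1.2 ++ pqr.2 /\ perm_eq pqr.1.2 (leaves u)).
Proof.
move=> LX ut; have U := leaf_order_uniq tE LX.
have sX := leaf_order_size tE LX.
have [p [q [r [XE qu]]]] := (LX.2 u ut).
have [pn qy rn] := split_filter U XE qu.
have sqr : size (q ++ r) <= n.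
  apply: leq_trans (_ : size X <= n); last by rewrite sX.
  by rewrite XE [size (p ++ _)]size_cat leq_addl.
rewrite /split_at {1}XE.
apply: within_bind_eq; [apply: (within_lspan (q := fun x => x \notin leaves u) (k := 1)) | |].
- by [].
- have := perm_size qu; have := size_leaves_gt0 u.
  by case: (q) qy => [|x q'] /=; [lia | rewrite take0 => /andP[/= ->]].
- move=> x _; rewrite /outside; apply: within_bind_eq; [exact: within_read | by [] |].
  by apply: within_ret; rewrite belowE.
- by rewrite -XE sX; lia.
apply: within_bind_eq; [apply: (within_lspan (q := mem (leaves u)) (k := 1)) | |].
- by [].
- by case: (r) rn => //= x r' /andP[xn _]; rewrite (negPf xn) take0.
- move=> x _; apply: within_weaken; [exact: within_read | by [] |] => _ <-.
  by rewrite belowE.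
- by rewrite -XE sX; move: sqr; set k := size (q ++ r); lia.
exact: within_ret.
Qed.

End Splitting.
End Tables.

(** * Flips and switches *)

Section Moves.
Variables (n : nat) (t : tree 'I_n) (le : tree 'I_n * tree 'I_n -> bool).
Hypotheses (tE : perm_eq (leaves t) (enum 'I_n)) (leP : is_below t le).
Let Ut := leaves_tree_uniq tE.
Implicit Types (X : seq 'I_n) (u v w : tree 'I_n) (x y z : 'I_n).

Let npos (x : 'I_n) : 0 < n. Proof. exact: leq_ltn_trans (ltn_ord x). Qed.

Lemma before_in_order X x y : leaf_order (Some t) X -> x != y ->
  before X y x = ~~ before X x y.
Proof. by move=> LX; apply: before_total (leaf_order_all tE x LX). Qed.

Lemma within_flip X u : leaf_order (Some t) X -> u \in vertices t ->
  within (flip le X u) (12 * n) (fun X' => leaf_order (Some t) X' /\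
    forall x y, x != y -> before X' x y =
      before X x y (+) ((x \in leaves u) && (y \in leaves u))).
Proof.
move=> LX ut; have [x0 _] := leaves_ex u; have {x0} n0 := npos x0.
have UX := leaf_order_uniq tE LX.
rewrite /flip; apply: within_bind; [exact: within_split_at LX ut | by lia |].
move=> [[p q] r] /= [XE qu].
have [sp sq] : size p <= n /\ size q <= n.
  have := leaf_order_size tE LX; rewrite XE !size_cat => sX.
  by move: sX; set a := size p; set b := size q; lia.
apply: within_bind_eq; [exact: within_lrev | by move: sq; set a := size q; lia |].
apply: within_bind_eq; [exact: within_lcat | rewrite size_rev; move: sq; set a := size q; lia |].
apply: within_weaken; [exact: within_lcat | rewrite size_rev; move: sp sq; set a := size q; set b := size p; lia |].
move=> _ <-; have B x y : x != y -> before (p ++ rev q ++ r) x y =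
    before X x y (+) ((x \in leaves u) && (y \in leaves u)).
  move=> xy; rewrite before_flip // -?XE ?(leaf_order_all tE _ LX) //.
  by rewrite !(perm_mem qu).
split=> //; apply: (leaf_order_invert tE LX _ B).
  by rewrite XE perm_cat2l perm_cat2r perm_rev.
move=> w wt x y z xw yw zw; have [zu|] := boolP (z \in leaves u); last by rewrite !andbF.
rewrite !andbT; have side a b : a \in leaves w -> b \in leaves w -> a \in leaves u -> b \in leaves u.
  move=> aw bw au; have [uw|wu] := vertices_laminar Ut ut wt au aw.
    by rewrite (leaves_sub uw zu) in zw.
  exact: leaves_sub wu _ bw.
by apply/idP/idP; apply: side.
Qed.

(** The program looks only at the first leaf of the block of a vertex in order to
    find out which child comes first; the block of that child is a prefix since
    the leaves of the other child cannot separate its leaves. *)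
Lemma block_children X p x q r u1 u2 : leaf_order (Some t) X ->
  u1 \in vertices t -> u2 \in vertices t -> X = p ++ (x :: q) ++ r ->
  perm_eq (x :: q) (leaves u1 ++ leaves u2) -> x \in leaves u1 ->
  exists q1 q2, [/\ x :: q = q1 ++ q2, perm_eq q1 (leaves u1) & perm_eq q2 (leaves u2)].
Proof.
move=> LX ut1 ut2 XE qu xu1; have UX := leaf_order_uniq tE LX.
have Uq : uniq (x :: q).
  by move: UX; rewrite XE !cat_uniq => /and3P[_ _ /and3P[]].
have Uu : uniq (leaves u1 ++ leaves u2) by rewrite -(perm_uniq qu).
have q12 y : y \in x :: q -> (y \notin leaves u1) = (y \in leaves u2).
  rewrite (perm_mem qu) mem_cat; case: (boolP (y \in leaves u1)) => [yu1 _|//].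
  move: Uu; rewrite cat_uniq => /and3P[_ /hasPn H _]; apply/esym/negbTE.
  by apply/negP => /H; rewrite /= yu1.
exists (filter (mem (leaves u1)) (x :: q)), (filter (predC (mem (leaves u1))) (x :: q)).
have cut (a : tree 'I_n) (P : pred 'I_n) : a \in vertices t ->
    {subset leaves a <= leaves u1 ++ leaves u2} ->
    {in x :: q, forall y, P y = (y \in leaves a)} ->
    perm_eq (filter P (x :: q)) (leaves a).
  move=> at_ sub PE; apply: uniq_perm; [exact: filter_uniq | exact: leaves_uniq at_ Ut |].
  move=> y; rewrite mem_filter; apply/andP/idP => [[Py yq]|ya]; first by rewrite -PE.
  by have yq := sub _ ya; rewrite -(perm_mem qu) in yq; rewrite PE.
split; last 2 first.
- by apply: cut => // y yu; rewrite mem_cat yu.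
- by apply: cut => // y yu; rewrite ?mem_cat ?yu ?orbT //=; apply: q12.
apply: filter_prefix => // y z yq zq yu1 zu1.
have U' : uniq (p ++ (x :: q) ++ r) by rewrite -XE.
have mid a : a \in x :: q -> before X a z = before (x :: q) a z.
  by move=> aq; rewrite XE (before_mid a z U' (perm_refl _)) aq zq.
have [_ H] := proj1 (leaf_orderP _ Ut) LX.
rewrite -mid // (H u1 ut1 y x z) ?(leaves_all tE) // mid ?mem_head //.
by rewrite /before /= eqxx; case: eqP => // xz; rewrite -xz /= xu1 in zu1.
Qed.

(** A vertex is above both children, below one of them or beside them; in none of
    these cases can its leaves be told apart by an outside leaf. *)
Lemma children_congruent u1 u2 : Node u1 u2 \in vertices t ->
  {in vertices t, forall w x y z, x \in leaves w -> y \in leaves w -> z \notin leaves w ->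
    (x \in leaves u1) && (z \in leaves u2) || (x \in leaves u2) && (z \in leaves u1) =
    (y \in leaves u1) && (z \in leaves u2) || (y \in leaves u2) && (z \in leaves u1)}.
Proof.
move=> ut w wt y z s yw zw sw.
have side c d y' z' : (c = u1 /\ d = u2) \/ (c = u2 /\ d = u1) ->
    y' \in leaves w -> z' \in leaves w -> y' \in leaves c -> s \in leaves d ->
    z' \in leaves c.
  move=> cd y'w z'w y'c sd.
  have [y'u su] : y' \in leaves (Node u1 u2) /\ s \in leaves (Node u1 u2).
    by rewrite /= !mem_cat; case: cd y'c sd => -[-> ->] -> ->; rewrite ?orbT.
  have Uu := leaves_uniq ut Ut.
  have [uw|] := vertices_laminar Ut ut wt y'u y'w; first by rewrite (leaves_sub uw su) in sw.
  rewrite vertices_Node => /or3P[/eqP wE|wu|wu]; first by rewrite wE su in sw.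
    case: cd y'c => -[-> _] y'c; first exact: leaves_sub wu _ z'w.
    by have := leaves_disjoint Uu (leaves_sub wu y'w); rewrite y'c.
  case: cd y'c => -[-> _] y'c; last exact: leaves_sub wu _ z'w.
  by have := leaves_disjoint Uu y'c; rewrite (leaves_sub wu y'w).
have or1 : (u1 = u1 /\ u2 = u2) \/ (u1 = u2 /\ u2 = u1) by left.
have or2 : (u2 = u1 /\ u1 = u2) \/ (u2 = u2 /\ u1 = u1) by right.
apply/idP/idP => /orP[] /andP[yu su]; apply/orP; rewrite su !andbT.
- by left; apply: side or1 yw zw yu su.
- by right; apply: side or2 yw zw yu su.
- by left; apply: side or1 zw yw yu su.
by right; apply: side or2 zw yw yu su.
Qed.

Lemma within_switch X u1 u2 : leaf_order (Some t) X -> Node u1 u2 \in vertices t ->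
  within (subtree_switch le X (Node u1 u2)) (16 * n)
    (fun X' => leaf_order (Some t) X' /\
    forall x y, x != y -> before X' x y = before X x y (+)
      ((x \in leaves u1) && (y \in leaves u2) || (x \in leaves u2) && (y \in leaves u1))).
Proof.
move=> LX ut; have [x0 _] := leaves_ex u1; have {x0} n0 := npos x0.
have UX := leaf_order_uniq tE LX.
rewrite /subtree_switch; apply: within_bind; [exact: within_split_at LX ut | by lia |].
move=> [[p q] r] /= [XE qu].
case: q XE qu => [|x q] XE qu.
  have := perm_size qu; have := size_leaves_gt0 (Node u1 u2).
  by move=> + E; rewrite -E.
apply: within_bind_eq; [exact: within_read | by lia |].
rewrite (belowE leP) ?(vertices_childl ut) //.
have ut1 := vertices_childl ut; have ut2 := vertices_childr ut.
set a := if x \in leaves u1 then u1 else u2; pose b := if x \in leaves u1 then u2 else u1.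
have [q1 [q2 [qE H1 H2]]] : exists q1 q2, [/\ x :: q = q1 ++ q2,
    perm_eq q1 (leaves a) & perm_eq q2 (leaves b)].
  rewrite /a /b; case: ifPn => xu1; first exact: block_children LX ut1 ut2 XE qu xu1.
  have qu' : perm_eq (x :: q) (leaves u2 ++ leaves u1).
    by apply: perm_trans qu _; rewrite perm_catC.
  apply: block_children LX ut2 ut1 XE qu' _.
  by have := perm_mem qu x; rewrite mem_head mem_cat (negPf xu1).
have [at_ bt] : a \in vertices t /\ b \in vertices t by rewrite /a /b; case: ifP.
have ab y : y \in leaves b -> y \notin leaves a.
  have Uq : uniq (q1 ++ q2) by rewrite -qE (perm_uniq qu) (leaves_uniq ut Ut).
  rewrite -(perm_mem H1) -(perm_mem H2); move: Uq; rewrite cat_uniq => /and3P[_ /hasPn H _].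
  exact: H.
have sz : size p + (size q1 + size q2 + size r) = n.
  by have := leaf_order_size tE LX; rewrite XE qE !size_cat.
rewrite qE; apply: within_bind_eq;
  [apply: (within_lspan (q := mem (leaves a)) (k := 1)) | | ].
- by apply/allP => y; rewrite (perm_mem H1).
- case: (q2) (perm_mem H2) => // y q2' H; rewrite /= take0 orbF; apply: ab.
  by rewrite -H mem_head.
- move=> y _; apply: within_weaken; [exact: within_read | by [] |] => _ <-.
  by rewrite (belowE leP).
- by rewrite size_cat; move: sz; set a1 := size q1; set a2 := size q2; set a3 := size p; lia.
apply: within_bind_eq; [exact: within_lcat | |].
  by rewrite size_cat; move: sz; set a1 := size q1; set a2 := size q2; set a3 := size p; lia.
apply: within_bind_eq; [exact: within_lcat | |].
  by rewrite !size_cat; move: sz; set a1 := size q1; set a2 := size q2; set a3 := size p; lia.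
apply: within_weaken; [exact: within_lcat | |].
  by rewrite !size_cat; move: sz; set a1 := size q1; set a2 := size q2; set a3 := size p; lia.
move=> _ <-; rewrite qE in XE.
have B y z : y != z -> before (p ++ (q2 ++ q1) ++ r) y z = before X y z (+)
    ((y \in leaves u1) && (z \in leaves u2) || (y \in leaves u2) && (z \in leaves u1)).
  move=> yz; rewrite before_switch -?XE // !(perm_mem H1) !(perm_mem H2) /a /b.
  by case: ifP => // _; rewrite orbC.
split=> //; apply: (leaf_order_invert tE LX _ B).
  by rewrite XE perm_cat2l perm_cat2r perm_catC.
exact: children_congruent ut.
Qed.

End Moves.

(** * Crossings of the inserted edge *)

Section Insert.
Variables (n : nat) (G : tanglegram n) (i : 'I_n).
Let T := treeT G.
Let S := treeS G.
Let f := phi G.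
Let fI : injective f := @perm_inj _ f.
Implicit Types (u v w : tree 'I_n) (XY : layout n) (j k : 'I_n) (E : {set 'I_n}).

Let n0 : 0 < n. Proof. exact: leq_ltn_trans (ltn_ord i). Qed.

(** The edges other than i at the leaves below u. *)
Definition trace (g : 'I_n -> 'I_n) u : {set 'I_n} := cluster g u :&: [set~ i].

Lemma in_trace g u j : (j \in trace g u) = (g j \in leaves u) && (j != i).
Proof. by rewrite !inE. Qed.

Definition lists (es : seq 'I_n) E : Prop := uniq es /\ es =i E.

Lemma lists_size es E : lists es E -> size es = #|E|.
Proof. by move=> [U H]; rewrite -(card_uniqP U); apply: eq_card. Qed.

Lemma lists_le es E : lists es E -> size es <= n.
Proof. by move=> /lists_size->; rewrite -[n in _ <= n]card_ord max_card. Qed.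

Lemma lists_count es E (p : pred 'I_n) : lists es E ->
  count p es = #|[set j in E | p j]|.
Proof.
move=> [U H]; rewrite -size_filter -(card_uniqP (filter_uniq _ U)).
by apply: eq_card => j; rewrite mem_filter inE H andbC.
Qed.

Section Positions.
Variable XY : layout n.
Hypothesis eXY : extending G i XY.

Let UX : uniq XY.1. Proof. by case: eXY => /(leaf_order_uniq (leavesT G)). Qed.
Let UY : uniq XY.2. Proof. by case: eXY => _ /(leaf_order_uniq (leavesS G)). Qed.
Let sX : size XY.1 = n. Proof. by case: eXY => /(leaf_order_size (leavesT G)). Qed.
Let sY : size XY.2 = n. Proof. by case: eXY => _ /(leaf_order_size (leavesS G)). Qed.
Let mX j : j \in XY.1. Proof. by case: eXY => /(leaf_order_all (leavesT G)). Qed.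
Let mY j : j \in XY.2. Proof. by case: eXY => _ /(leaf_order_all (leavesS G)). Qed.

Lemma within_crossing posX posY j k :
  {in XY.1, forall x, posX x = index x XY.1} ->
  {in XY.2, forall x, posY x = index x XY.2} ->
  within (crossing f posX posY j k) 6 (eq (crosses f XY j k)).
Proof.
move=> pX pY; rewrite /crossing.
do 6!(apply: within_bind_eq; [exact: within_read | by [] |]).
by apply: within_ret; rewrite /crosses !pX // !pY.
Qed.

Lemma within_crossed es E : lists es E ->
  within (crossed f i XY es) (16 * n) (eq (#|E|, #|[set j in E | crosses f XY i j]|)).
Proof.
move=> LE; have sE := lists_le LE; rewrite /crossed.
apply: within_bind; [exact: within_positions UX | by rewrite sX; lia |] => posX pX.
apply: within_bind; [exact: within_positions UY | by rewrite sX sY; lia |] => posY pY.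
rewrite -(lists_size LE) -(lists_count _ LE).
pose step (c : nat * nat) (j : 'I_n) := (c.1.+1, if crosses f XY i j then c.2.+1 else c.2).
have stepE c : foldl step c es = (c.1 + size es, c.2 + count (crosses f XY i) es).
  elim: es c {LE sE} => [|j es IH] c /=; first by rewrite !addn0 -surjective_pairing.
  by rewrite IH /=; case: crosses; congr pair; lia.
apply: within_weaken; [apply: (within_lfold_eq (g := step) (k := 6)) | |].
- move=> c j _; apply: within_bind_eq; [exact: within_crossing | by [] |].
  exact: within_ret.
- by rewrite sX sY; move: sE; set m := size es; lia.
by move=> _ <-; rewrite stepE.
Qed.

Lemma crossed_in E : i \notin E ->
  [set j in E | crosses f XY i j] = crossed_by G i XY :&: E.
Proof.
move=> iE; apply/setP => j; rewrite !inE andbC.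
case: (boolP (j \in E)) => jE; rewrite ?andbF // !andbT.
by rewrite andb_idl // => _; apply: contraNneq iE => <-.
Qed.

Lemma within_bad es E : lists es E -> i \notin E ->
  within (bad f i XY es) (16 * n) (eq (#|E| < 2 * #|crossed_by G i XY :&: E|)).
Proof.
move=> LE iE; rewrite /bad.
apply: within_bind_eq; [exact: within_crossed LE | by [] |].
by apply: within_ret; rewrite mul2n -addnn crossed_in.
Qed.

Lemma within_crosses_all es E : lists es E -> i \notin E ->
  within (crosses_all f i XY es) (16 * n) (eq (#|crossed_by G i XY :&: E| == #|E|)).
Proof.
move=> LE iE; rewrite /crosses_all.
apply: within_bind_eq; [exact: within_crossed LE | by [] |].
by apply: within_ret; rewrite crossed_in.
Qed.

Lemma within_crossing_number js : perm_eq js (enum 'I_n) ->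
  within (crossing_number f js XY) (18 * n ^ 2) (eq (crossings f XY)).
Proof.
move=> jsE; have sjs : size js = n by rewrite (perm_size jsE) size_enum_ord.
rewrite /crossing_number.
apply: within_bind; [exact: within_positions UX | by rewrite sX; nia |] => posX pX.
apply: within_bind; [exact: within_positions UY | by rewrite sX sY; nia |] => posY pY.
pose q j k := (j < k) && crosses f XY j k.
apply: within_weaken; [apply: (within_lfold_eq
  (g := fun c j => c + count (q j) js) (k := n * 7 + 1)) | |].
- move=> c j _; apply: within_bind_eq; [apply: (within_lcount (q := q j) (k := 6)) | |].
  + move=> k _; apply: within_bind_eq; [exact: within_crossing | by [] |].
    exact: within_ret.
  + by rewrite sjs; lia.
  exact: within_ret.
- rewrite sX sY sjs; nia.
move=> _ <-; have foldlE c l : foldl (fun c j => c + count (q j) js) c l =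
    c + \sum_(j <- l) count (q j) js.
  elim: l c => [|j l IH] c /=; first by rewrite big_nil addn0.
  by rewrite IH big_cons addnA.
rewrite foldlE add0n (perm_big _ jsE) big_enum /=.
rewrite /crossings -sum1_card (eq_bigl (fun p : 'I_n * 'I_n => q p.1 p.2)).
  rewrite -(pair_big_dep xpredT q (fun _ _ => 1)) /=.
  by apply: eq_bigr => j _; rewrite (seq.permP jsE) -sum1_count big_enum_cond.
by move=> [j k]; rewrite inE /= !mX.
Qed.

End Positions.

(** XY' is a layout in which, compared to XY, the edge i has changed sides with
    the edges of E. *)
Definition moved XY E XY' : Prop := extending G i XY' /\
  forall j, j != i -> crosses f XY' i j = crosses f XY i j (+) (j \in E).

Section Tables.
Variables (leT leS : tree 'I_n * tree 'I_n -> bool).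
Hypotheses (leTP : is_below T leT) (leSP : is_below S leS).

(** The pairs inside the common trace are inverted on both sides, so planarity
    survives; i is moved on one side only. *)
Lemma within_paired_flip XY u v : extending G i XY ->
  u \in vertices T -> v \in vertices S -> trace id u = trace f v ->
  (i \in leaves u) (+) (f i \in leaves v) ->
  within (paired_flip leT leS XY (u, v)) (24 * n) (moved XY (trace id u)).
Proof.
move=> [LX LY P] ut vs uv iuv; rewrite /paired_flip /=.
apply: (within_bind (within_flip (leavesT G) leTP LX ut)); first by lia.
move=> X' [LX' BX].
apply: (within_bind (within_flip (leavesS G) leSP LY vs)); first by lia.
move=> Y' [LY' BY].
have same j : j != i -> (f j \in leaves v) = (j \in leaves u).
  by move=> ji; have /setP/(_ j) := uv; rewrite !in_trace ji !andbT.
apply: within_ret; split.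
  split=> // j k ji ki jk; rewrite /= BX // BY ?(inj_eq fI) // P // !same //.
move=> j ji; rewrite !crossesE /= BX 1?eq_sym // BY ?(inj_eq fI) 1?eq_sym //.
rewrite in_trace ji andbT (same _ ji) /id; move: iuv.
by case: (i \in _); case: (phi G i \in _) => //= _; case: (j \in _);
  case: before; case: before.
Qed.

(** The children are unordered, so the leaf may be either one. *)
Definition siblings x u w : Prop := u = Node (Leaf x) w \/ u = Node w (Leaf x).

Lemma siblings_notin t x u w : uniq (leaves t) -> u \in vertices t ->
  siblings x u w -> x \notin leaves w.
Proof.
move=> Ut ut sib; have U := leaves_uniq ut Ut.
case: sib U => -> U; first by apply: (leaves_disjoint U); rewrite mem_head.
by apply/negP => xw; have := leaves_disjoint U xw; rewrite mem_head.
Qed.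

Lemma switch_siblings (x y z : 'I_n) w u u1 u2 : siblings x u w -> u = Node u1 u2 ->
  (y \in leaves u1) && (z \in leaves u2) || (y \in leaves u2) && (z \in leaves u1) =
  (y == x) && (z \in leaves w) || (y \in leaves w) && (z == x).
Proof.
case=> -> [<- <-]; rewrite /= !inE //.
by rewrite orbC.
Qed.

Lemma within_switchT XY u w : extending G i XY -> u \in vertices T ->
  siblings i u w -> within (switchT leT u XY) (16 * n) (moved XY (trace id w)).
Proof.
move=> [LX LY P] ut sib; rewrite /switchT.
have [u1 [u2 uE]] : exists u1 u2, u = Node u1 u2 by case: sib => ->; do 2!eexists.
rewrite {1}uE; rewrite uE in ut.
apply: (within_bind (within_switch (leavesT G) leTP LX ut)); first by lia.
move=> X' [LX' BX].
apply: within_ret; split.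
  split=> // j k ji ki jk; rewrite /= BX // (switch_siblings _ _ sib uE) P //.
  by rewrite (negPf ji) (negPf ki) andbF addbF.
move=> j ji; rewrite !crossesE /= BX 1?eq_sym // (switch_siblings _ _ sib uE).
by rewrite eqxx (negPf ji) andbF orbF in_trace ji andbT addbAC.
Qed.

Lemma within_switchS XY v w : extending G i XY -> v \in vertices S ->
  siblings (f i) v w -> within (switchS leS v XY) (16 * n) (moved XY (trace f w)).
Proof.
move=> [LX LY P] vs sib; rewrite /switchS.
have [u1 [u2 uE]] : exists u1 u2, v = Node u1 u2 by case: sib => ->; do 2!eexists.
rewrite {1}uE; rewrite uE in vs.
apply: (within_bind (within_switch (leavesS G) leSP LY vs)); first by lia.
move=> Y' [LY' BY].
apply: within_ret; split.
  split=> // j k ji ki jk; rewrite /= BY ?(inj_eq fI) // (switch_siblings _ _ sib uE) P //.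
  by rewrite !(inj_eq fI) (negPf ji) (negPf ki) andbF addbF.
move=> j ji; rewrite !crossesE /= BY ?(inj_eq fI) 1?eq_sym // (switch_siblings _ _ sib uE).
by rewrite eqxx (inj_eq fI) (negPf ji) andbF orbF in_trace ji andbT addbA.
Qed.

Variable js : seq 'I_n.
Hypothesis jsE : perm_eq js (enum 'I_n).

Let sjs : size js = n. Proof. by rewrite (perm_size jsE) size_enum_ord. Qed.
Let ujs : uniq js. Proof. by rewrite (perm_uniq jsE) enum_uniq. Qed.
Let mjs j : j \in js. Proof. by rewrite (perm_mem jsE) mem_enum. Qed.

Lemma within_edges_atT u w : u \in vertices T -> w \in vertices T ->
  within (edges_atT i js leT u w) (6 * n)
    (fun es => lists es (trace id u :\: trace id w)).
Proof.
move=> ut wt; rewrite /edges_atT.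
pose q j := [&& j != i, j \in leaves u & j \notin leaves w].
apply: within_weaken; [apply: (within_lfilter (q := q) (k := 2)) | by rewrite sjs; lia |].
  move=> j _; do 2!(apply: within_bind_eq; [exact: within_read | by [] |]).
  by apply: within_ret; rewrite !(belowE leTP).
move=> _ <-; split=> [|j]; first exact: filter_uniq.
rewrite mem_filter mjs andbT inE !in_trace /q.
by case: (j != i); rewrite ?andbF //= !andbT andbC.
Qed.

Lemma within_edges_atS v w : v \in vertices S -> w \in vertices S ->
  within (edges_atS f i js leS v w) (6 * n)
    (fun es => lists es (trace f v :\: trace f w)).
Proof.
move=> vs ws; rewrite /edges_atS.
pose q j := [&& j != i, f j \in leaves v & f j \notin leaves w].
apply: within_weaken; [apply: (within_lfilter (q := q) (k := 3)) | by rewrite sjs; lia |].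
  move=> j _; do 3!(apply: within_bind_eq; [exact: within_read | by [] |]).
  by apply: within_ret; rewrite !(belowE leSP).
move=> _ <-; split=> [|j]; first exact: filter_uniq.
rewrite mem_filter mjs andbT inE !in_trace /q.
by case: (j != i); rewrite ?andbF //= !andbT andbC.
Qed.

End Tables.

(** * Walking down a chain of common clusters *)

Definition settled_in XY E : Prop := settled (crossed_by G i XY) E.

Lemma settled_same XY XY' E : settled_in XY E ->
  (forall j, j != i -> j \in E -> crosses f XY' i j = crosses f XY i j) ->
  settled_in XY' E.
Proof.
move=> st H; rewrite /settled_in /settled.
suff -> : crossed_by G i XY' :&: E = crossed_by G i XY :&: E by [].
apply/setP => j; rewrite !in_setI; case: (boolP (j \in E)) => jE; rewrite ?andbF // !andbT !inE.
by have [//|ji] := eqVneq j i; rewrite H.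
Qed.

(** Moving a bad group brings it below one half. *)
Lemma settle_group XY XY' A E : moved XY A XY' -> E \subset A -> i \notin E ->
  #|E| < 2 * #|crossed_by G i XY :&: E| -> settled_in XY' E.
Proof.
move=> [_ H] /subsetP EA iE bd; rewrite /settled_in /settled.
suff -> : crossed_by G i XY' :&: E = E :\: crossed_by G i XY.
  by have := cardsID (crossed_by G i XY) E; rewrite setIC; lia.
apply/setP => j; rewrite !inE; case: (boolP (j \in E)) => jE; rewrite ?andbF //.
have ji : j != i by apply: contraNneq iE => <-.
by rewrite ji H // EA // addbT !andbT.
Qed.

Lemma within_settle XY E (A : {set 'I_n}) b (move_A : comp (layout n)) : extending G i XY ->
  E \subset A -> i \notin E -> b = (#|E| < 2 * #|crossed_by G i XY :&: E|) ->
  within move_A (24 * n) (moved XY A) ->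
  within (if b then move_A else ret XY) (24 * n) (fun XY' =>
    [/\ extending G i XY', settled_in XY' E &
     forall j, j != i -> j \notin A -> crosses f XY' i j = crosses f XY i j]).
Proof.
move=> eXY EA iE ->; case: ifP => [bd mv|/negbT nb _]; last first.
  by apply: within_ret; split=> //; rewrite -leqNgt in nb.
apply: within_weaken mv _ _ => // XY' mv; split; first by case: mv.
  exact: settle_group mv EA iE bd.
by move=> j ji jA; rewrite mv.2 // (negPf jA) addbF.
Qed.

(** The loops over the two chains differ only in the operations on edges. *)
Section Chain.
Variables (edges : tree 'I_n -> tree 'I_n -> comp (seq 'I_n)).
Variables (turn : layout n -> tree 'I_n * tree 'I_n -> comp (layout n)).
Variables (side : tree 'I_n * tree 'I_n -> tree 'I_n) (g : 'I_n -> 'I_n).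

Fixpoint flip_chain (v0 : tree 'I_n) (ps : seq (tree 'I_n * tree 'I_n))
    (XY : layout n) : comp (layout n) :=
  call;;
  if ps is p :: ps' then
    let* es := edges (side p) (if ps' is q :: _ then side q else v0) in
    let* b := bad f i XY es in
    let* XY := if b then turn XY p else ret XY in
    flip_chain v0 ps' XY
  else ret XY.

Variables (t : tree 'I_n) (good : tree 'I_n * tree 'I_n -> Prop).
Hypothesis edgesP : forall u w, u \in vertices t -> w \in vertices t ->
  within (edges u w) (6 * n) (fun es => lists es (trace g u :\: trace g w)).
Hypothesis turnP : forall XY p, extending G i XY -> good p ->
  within (turn XY p) (24 * n) (moved XY (trace g (side p))).

(** Flipping at a member of the chain changes nothing outside it, in particular
    nothing in the groups that were settled before. *)
Lemma within_flip_chain v0 (ps : seq (tree 'I_n * tree 'I_n)) XY : extending G i XY -> v0 \in vertices t ->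
  {in ps, forall p, side p \in vertices t /\ good p} ->
  let As : seq {set 'I_n} := [seq trace g (side p) | p <- ps] in
  sorted (fun A B : {set 'I_n} => B \proper A) As ->
  within (flip_chain v0 ps XY) (size ps * (48 * n) + 1) (fun XY' =>
    [/\ extending G i XY',
        forall j, j != i -> j \notin head set0 As ->
          crosses f XY' i j = crosses f XY i j &
        {in groups (trace g v0) As, forall E, settled_in XY' E}]).
Proof.
move=> eXY v0t; elim: ps XY eXY => [|p ps IH] XY eXY good_ps /= srt.
  by apply: within_call; [lia | exact: within_ret].
have [pt gp] := good_ps p (mem_head _ _).
apply: within_call; first by lia.
have qt : (if ps is q :: _ then side q else v0) \in vertices t.
  case: ps good_ps {IH srt} => // q ps /(_ q); rewrite !inE eqxx orbT.
  by case.
set q := (if ps is q :: _ then _ else _) in qt *.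
apply: within_bind; [exact: edgesP | by lia |] => es les.
have iE : i \notin trace g (side p) :\: trace g q by rewrite !inE eqxx !andbF.
apply: within_bind_eq; [exact: within_bad les iE | by lia |].
set E := trace g (side p) :\: trace g q in les iE *.
apply: (within_bind (within_settle eXY (subsetDl _ _) iE erefl (turnP eXY gp))).
  by lia.
move=> XY1 [eXY1 st1 same1].
apply: within_weaken; [apply: IH | by lia |] => //.
- by move=> p' p'ps; apply: good_ps; rewrite inE p'ps orbT.
- exact: path_sorted srt.
move=> XY2 [eXY2 same2 st2]; split=> //.
  move=> j ji jp; rewrite same2 ?same1 //; apply: contra jp.
  case: (ps) srt => [|p' ps'] /=; first by rewrite inE.
  by move=> /andP[/proper_sub/subsetP sub _]; apply: sub.
have -> : head (trace g v0) [seq trace g (side p) | p <- ps] = trace g q.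
  by rewrite /q; case: (ps).
move=> E'; rewrite inE => /predU1P[->|/st2//].
apply: settled_same st1 _ => j ji jE; rewrite same2 //.
move: jE; rewrite inE => /andP[jq _]; move: jq; rewrite /q.
by case: (ps) => [|q' ps'] //= _; rewrite inE.
Qed.

End Chain.
End Insert.

(** * Sorting a chain *)

Section Sorting.
Variables (A : eqType) (gt : A -> A -> comp bool) (r : rel A) (k : nat).

Fixpoint insert x (l : seq A) : seq A :=
  if l is y :: l' then if r x y then x :: l else y :: insert x l' else [:: x].

Lemma perm_insert x l : perm_eq (insert x l) (x :: l).
Proof.
elim: l => //= y l IH; case: ifP => // _.
by rewrite perm_sym -[x :: _]/([:: x] ++ [:: y] ++ l) perm_catCA /= perm_cons perm_sym.
Qed.

Lemma within_linsert x l : {in l, forall y, within (gt x y) k (eq (r x y))} ->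
  within (linsert gt x l) (size l * k.+1).+1 (eq (insert x l)).
Proof.
elim: l => [|y l IH] gtE /=; apply: within_call => //; first exact: within_ret.
apply: within_bind_eq; [by apply: gtE; rewrite mem_head | by lia |].
case: ifP => _; first exact: within_ret.
apply: within_bind_eq; [apply: IH => z zl; apply: gtE; rewrite inE zl orbT // | by lia |].
exact: within_ret.
Qed.

Lemma path_insert x y l : {in l, forall z, r x z || r z x} ->
  r y x -> path r y l -> path r y (insert x l).
Proof.
elim: l y => [|z l IH] y tot yx /=; first by rewrite yx.
move=> /andP[yz zl]; case: ifP => [xz|xz] /=; first by rewrite yx xz.
rewrite yz IH //; first by move=> z' z'l; apply: tot; rewrite inE z'l orbT.
by have := tot z (mem_head _ _); rewrite xz.
Qed.

Lemma sorted_insert x l : {in l, forall z, r x z || r z x} ->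
  sorted r l -> sorted r (insert x l).
Proof.
case: l => [|y l] //= tot yl; case: ifP => [xy|xy] /=; first by rewrite xy.
apply: path_insert => //; first by move=> z zl; apply: tot; rewrite inE zl orbT.
by have := tot y (mem_head _ _); rewrite xy.
Qed.

Lemma within_lsort l : uniq l ->
  {in l &, forall x y, within (gt x y) k (eq (r x y))} ->
  {in l &, forall x y, x != y -> r x y || r y x} ->
  within (lsort gt l) (size l * (size l * k.+1 + 2)).+1
    (fun s => perm_eq s l /\ sorted r s).
Proof.
move=> U gtE tot; rewrite /lsort; apply: within_weaken;
  [apply: (within_lfold (k := (size l * k.+1).+1)
     (Inv := fun p s => perm_eq s p /\ sorted r s)) | by lia |] => //.
move=> p x s b lE [bp sb].
have xl : x \in l by rewrite lE mem_cat mem_head orbT.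
have bl y : y \in b -> y \in l by rewrite lE mem_cat (perm_mem bp) => ->.
apply: within_weaken; [apply: within_linsert => y yb | |].
- by apply: gtE => //; apply: bl.
- by rewrite (perm_size bp) lE size_cat /=; nia.
move=> _ <-; split.
  by rewrite (perm_trans (perm_insert x b)) // perm_sym perm_rcons perm_cons perm_sym.
apply: sorted_insert => // y yb; apply: tot => //; first exact: bl.
apply: contraTneq U => xy; rewrite lE cat_uniq /=.
by rewrite -(perm_mem bp) xy yb /= andbF.
Qed.

End Sorting.

(** * The vertices above a leaf *)

Section Above.
Variables (n : nat) (i : 'I_n) (g : 'I_n -> 'I_n) (t : tree 'I_n).
Hypotheses (gI : injective g) (tE : perm_eq (leaves t) (enum 'I_n)).
Let Ut := leaves_tree_uniq tE.
Implicit Types (u v w : tree 'I_n).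

(** These vertices stand for the internal vertices of the induced subtree. *)
Definition branching u : Prop := exists u1 u2,
  [/\ u = Node u1 u2, exists x, x \in trace i g u1 & exists x, x \in trace i g u2].

Lemma trace_mono u v : u \in vertices v -> trace i g u \subset trace i g v.
Proof. by move=> uv; apply: setSI; apply: cluster_mono. Qed.

(** Among the vertices with the same trace only the lowest one is branching, since
    the trace of a branching vertex is larger than the traces of its children. *)
Lemma branching_inj u v : u \in vertices t -> v \in vertices t ->
  branching u -> branching v -> trace i g u = trace i g v -> u = v.
Proof.
suff H a b : a \in vertices t -> b \in vertices t -> branching b ->
    trace i g a = trace i g b -> a \in vertices b -> a = b.
  move=> ut vt bu bv uv; have [u1 [u2 [uE [x xu1] _]]] := bu.
  have xu : x \in trace i g u.
    rewrite uE; apply: (subsetP (trace_mono _)) xu1.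
    by rewrite vertices_Node vertices_refl orbT.
  have xv : x \in trace i g v by rewrite -uv.
  rewrite !in_trace in xu xv; have [xu' _] := andP xu; have [xv' _] := andP xv.
  have [?|?] := vertices_laminar Ut ut vt xu' xv'; first exact: H.
  exact/esym/H.
move=> at_ bt [b1 [b2 [bE [x xb1] [y yb2]]]] ab.
have Ub := leaves_uniq bt Ut; rewrite bE in Ub ab *.
have [xb yb] : x \in trace i g a /\ y \in trace i g a.
  by rewrite ab !in_trace /= !mem_cat; move: xb1 yb2;
    rewrite !in_trace => /andP[-> ->] /andP[-> ->]; rewrite orbT.
rewrite vertices_Node => /or3P[/eqP//|a1|a2].
  have := subsetP (trace_mono a1) _ yb; move: yb2; rewrite !in_trace => /andP[y2 _] /andP[y1 _].
  by have := leaves_disjoint Ub y1; rewrite y2.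
have := subsetP (trace_mono a2) _ xb; move: xb1; rewrite !in_trace => /andP[y2 _] /andP[y1 _].
by have := leaves_disjoint Ub y2; rewrite y1.
Qed.

Variables (u0 w : tree 'I_n).
Hypotheses (u0t : u0 \in vertices t) (sib : siblings (g i) u0 w).

Lemma sibling_in_parent : w \in vertices u0 /\ Leaf (g i) \in vertices u0.
Proof. by case: sib => ->; rewrite !vertices_Node !vertices_refl ?orbT. Qed.

Lemma vertices_below_parent v : v \in vertices u0 ->
  [\/ v = u0, v = Leaf (g i) | v \in vertices w].
Proof.
case: sib => ->; rewrite vertices_Node => /or3P[/eqP->|H|H].
- by constructor 1.
- by constructor 2; move: H; rewrite inE => /eqP.
- by constructor 3.
- by constructor 1.
- by constructor 3.
by constructor 2; move: H; rewrite inE => /eqP.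
Qed.

Lemma leaf_notin_sibling : g i \notin leaves w.
Proof. exact: siblings_notin Ut u0t sib. Qed.

Lemma sibling_vertex : w \in vertices t.
Proof. exact: vertices_trans u0t (sibling_in_parent.1). Qed.

Lemma trace_leaf : trace i g (Leaf (g i)) = set0.
Proof. by apply/setP => j; rewrite in_trace !inE (inj_eq gI) andbN. Qed.

Lemma trace_parent : trace i g u0 = trace i g w.
Proof.
have E : trace i g u0 = trace i g (Leaf (g i)) :|: trace i g w.
  by rewrite /trace; case: sib => ->; rewrite cluster_Node setIUl // setUC.
by rewrite E trace_leaf set0U.
Qed.

Lemma trace_sibling : trace i g w = cluster g w.
Proof.
apply/setP => j; rewrite in_trace inE andb_idr // => jw.
by apply: contraNneq leaf_notin_sibling => <-.
Qed.

Lemma sibling_ex : exists z, z \in trace i g w.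
Proof.
have [x xw] := leaves_ex w; have [g' _ gK] := injF_bij gI.
by exists (g' x); rewrite trace_sibling inE gK.
Qed.

Lemma sibling_cluster : [/\ trace i g w \in clusters g t,
  i |: trace i g w \in clusters g t & i \notin trace i g w].
Proof.
split; last by rewrite in_trace eqxx andbF.
  by rewrite trace_sibling cluster_in // sibling_vertex.
suff -> : i |: trace i g w = cluster g u0 by apply: cluster_in.
apply/setP => j; rewrite !inE; case: sib => ->; rewrite /= ?mem_cat !inE (inj_eq gI);
  by case: eqP => //= _; rewrite ?andbT ?orbF ?orbT.
Qed.

(** The parent u0 is not branching, so a branching vertex above the leaf of i is
    strictly above u0, and its other child brings in edges outside w. *)
Lemma aboveE u : u \in vertices t -> branching u ->
  (g i \in leaves u) = (trace i g w \proper trace i g u).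
Proof.
move=> ut bu; have [u1 [u2 [uE [x xu1] [y yu2]]]] := bu.
have Uu := leaves_uniq ut Ut; rewrite uE in Uu.
have notLeaf : u <> Leaf (g i) by rewrite uE.
have [wu0 iu0] := sibling_in_parent.
apply/idP/idP => [iu|/properP[sub [z zu zw]]].
  have u0u : u0 \in vertices u.
    have iu0' : g i \in leaves u0 by rewrite -mem_vertices_Leaf.
    have [//|/vertices_below_parent[->|//|uw]] := vertices_laminar Ut u0t ut iu0' iu.
      exact: vertices_refl.
    by have := leaf_notin_sibling; rewrite (leaves_sub uw iu).
  have disj z : z \in trace i g u1 -> z \in trace i g u2 -> False.
    rewrite !in_trace => /andP[z1 _] /andP[z2 _].
    by have := leaves_disjoint Uu z1; rewrite z2.
  apply/properP; split; first by rewrite -trace_parent; apply: trace_mono.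
  have [xu yu] : x \in trace i g u /\ y \in trace i g u.
    by rewrite uE; split; [apply: (subsetP (trace_mono _)) xu1 |
      apply: (subsetP (trace_mono _)) yu2]; rewrite vertices_Node vertices_refl ?orbT.
  move: u0u; rewrite uE vertices_Node => /or3P[/eqP u0E|u01|u02].
  - exfalso; case: sib => wE; rewrite wE in u0E; case: u0E => E1 E2;
      [move: xu1; rewrite -E1 | move: yu2; rewrite -E2]; by rewrite trace_leaf inE.
  - exists y; first by rewrite -uE.
    apply/negP => yw; apply: (disj y) => //; apply: (subsetP (trace_mono u01)).
    by rewrite trace_parent.
  exists x; first by rewrite -uE.
  apply/negP => xw; apply: (disj x) => //; apply: (subsetP (trace_mono u02)).
  by rewrite trace_parent.
have [a aw] := sibling_ex; have au := subsetP sub _ aw.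
have au0 : a \in trace i g u0 by rewrite trace_parent.
rewrite !in_trace in au au0; have [au' _] := andP au; have [au0' _] := andP au0.
have [H|/vertices_below_parent[->|//|uw]] := vertices_laminar Ut u0t ut au0' au'.
- by apply: (leaves_sub H); rewrite -mem_vertices_Leaf.
- by rewrite -mem_vertices_Leaf.
by rewrite (subsetP (trace_mono uw) _ zu) in zw.
Qed.

(** Turns the tests that select Cases A and B into inclusions of traces. *)
Lemma below_parentE u : u \in vertices t -> branching u -> g i \notin leaves u ->
  (u \in vertices u0) && (u != u0) = (trace i g u \subset trace i g w).
Proof.
move=> ut bu iu; have [u1 [u2 [uE [x xu1] _]]] := bu.
have [wu0 iu0] := sibling_in_parent.
have nu0 : u != u0 by apply: contraNneq iu => ->; rewrite -mem_vertices_Leaf.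
rewrite nu0 andbT; apply/idP/idP => [/vertices_below_parent[/eqP|uE'|uw]|sub].
- by rewrite (negPf nu0).
- by rewrite uE in uE'.
- exact: trace_mono.
have xu : x \in trace i g u.
  by rewrite uE; apply: (subsetP (trace_mono _)) xu1; rewrite vertices_Node vertices_refl orbT.
have xu0 : x \in trace i g u0 by rewrite trace_parent (subsetP sub).
rewrite !in_trace in xu xu0; have [xu' _] := andP xu; have [xu0' _] := andP xu0.
have [H|//] := vertices_laminar Ut u0t ut xu0' xu'.
by move: iu; rewrite (leaves_sub H) // -mem_vertices_Leaf.
Qed.

End Above.

Notation vpair n := (tree 'I_n * tree 'I_n)%type.

(** * The chains of common clusters above one leaf only *)

Section OneSidedChain.
Variables (n : nat) (i : 'I_n) (gA gB : 'I_n -> 'I_n) (tA tB : tree 'I_n).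
Hypotheses (gAI : injective gA) (gBI : injective gB).
Hypotheses (tAE : perm_eq (leaves tA) (enum 'I_n)).
Hypotheses (tBE : perm_eq (leaves tB) (enum 'I_n)).
Variables (uA wA uB wB : tree 'I_n).
Hypotheses (uAt : uA \in vertices tA) (sibA : siblings (gA i) uA wA).
Hypotheses (uBt : uB \in vertices tB) (sibB : siblings (gB i) uB wB).
Variables (R : seq (vpair n)) (sA sB : vpair n -> tree 'I_n).
Hypothesis RP : {in R, forall p,
  [/\ sA p \in vertices tA, sB p \in vertices tB, branching i gA (sA p),
      branching i gB (sB p) & trace i gA (sA p) = trace i gB (sB p)]}.
Hypothesis RC : forall C, common (clusters gA tA) (clusters gB tB) [set~ i] C ->
  1 < #|C| -> exists2 p, p \in R & trace i gB (sB p) = C.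

(** The order in which the program sorts a chain. *)
Definition lower (p q : vpair n) : bool := (sB q \in vertices (sB p)) && (sB p != sB q).

(** A common cluster above a sibling set has more than one element, so it has been
    listed; the tests of the program become inclusions by [aboveE]. *)
Lemma chain_one_sided ps :
  ps =i [seq p <- R | (gA i \notin leaves (sA p)) && (gB i \in leaves (sB p))] ->
  sorted lower ps ->
  one_sided (clusters gA tA) (clusters gB tB) i (trace i gA wA) (trace i gB wB)
    [seq trace i gB (sB p) | p <- ps].
Proof.
move=> psE srt; have inR p : p \in ps -> p \in R by rewrite psE mem_filter => /andP[].
split.
  rewrite sorted_map; apply: (sub_in_sorted (P := mem ps) _ _ srt); last exact/allP.
  move=> p q /= pps qps /andP[qp pq].
  have [_ pt _ bp _] := RP (inR _ pps); have [_ qt _ bq _] := RP (inR _ qps).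
  rewrite properEneq trace_mono // andbT; apply: contra pq => /eqP tqp; apply/eqP.
  by apply: (branching_inj tBE pt qt bp bq); rewrite tqp.
move=> C; split=> [/mapP[p pps ->]|[CC wBC wAC]].
  have [at_ bt ba bb tr] := RP (inR _ pps).
  move: pps; rewrite psE mem_filter => /andP[/andP[ia ib] _]; split.
  - by exists (cluster gA (sA p)), (cluster gB (sB p)); rewrite !cluster_in.
  - by rewrite -(aboveE gBI tBE uBt sibB bt bb).
  by rewrite -tr -(aboveE gAI tAE uAt sibA at_ ba).
have C1 : 1 < #|C|.
  have [z zw] := sibling_ex gBI tBE uBt sibB.
  by apply: leq_ltn_trans (proper_card wBC); rewrite card_gt0; apply/set0Pn; exists z.
have [p pR pC] := RC CC C1; have [at_ bt ba bb tr] := RP pR.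
apply/mapP; exists p => //; rewrite psE mem_filter pR andbT.
rewrite (aboveE gBI tBE uBt sibB bt bb) (aboveE gAI tAE uAt sibA at_ ba) tr pC.
by rewrite wBC wAC.
Qed.

End OneSidedChain.

Section Comparison.
Variables (n : nat) (G : tanglegram n) (i : 'I_n).
Let T := treeT G.
Let S := treeS G.
Let f := phi G.
Let fI : injective f := @perm_inj _ f.
Let D := [set~ i].

Variables XY XY' : layout n.
Hypotheses (eXY : extending G i XY) (eXY' : extending G i XY').

(** The pairs of edges whose order on the side of T, resp. S, differs between the
    two layouts. *)
Definition turnT j k := before XY.1 j k (+) before XY'.1 j k.
Definition turnS j k := before XY.2 (f j) (f k) (+) before XY'.2 (f j) (f k).

Lemma congruent_turnT : congruent (clusters id T) setT turnT.
Proof.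
case: eXY eXY' => [LX _ _] [LX' _ _] A AF x y z xD yD zD xA yA zA.
rewrite /turnT; congr addb.
  exact: (congruent_leaf_order (g := id) (leavesT G) LX AF).
exact: (congruent_leaf_order (g := id) (leavesT G) LX' AF).
Qed.

Lemma congruent_turnS : congruent (clusters f S) setT turnS.
Proof.
case: eXY eXY' => [_ LY _] [_ LY' _] A AF x y z xD yD zD xA yA zA.
rewrite /turnS; congr addb.
  exact: (congruent_leaf_order (g := f) (leavesS G) LY AF).
exact: (congruent_leaf_order (g := f) (leavesS G) LY' AF).
Qed.

Lemma symmetric_turnT : symmetric_on setT turnT.
Proof.
case: eXY eXY' => [LX _ _] [LX' _ _] x y _ _ xy; rewrite /turnT.
rewrite (before_in_order (leavesT G) LX xy) (before_in_order (leavesT G) LX' xy).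
by rewrite addNb addbN negbK.
Qed.

Lemma symmetric_turnS : symmetric_on setT turnS.
Proof.
case: eXY eXY' => [_ LY _] [_ LY' _] x y _ _ xy; rewrite /turnS.
have fxy : f x != f y by rewrite (inj_eq fI).
rewrite (before_in_order (leavesS G) LY fxy) (before_in_order (leavesS G) LY' fxy).
by rewrite addNb addbN negbK.
Qed.

Lemma turnTS x y : x \in D -> y \in D -> turnT x y = turnS x y.
Proof.
case: eXY eXY' => [_ _ P] [_ _ P']; rewrite !inE => xi yi.
have [->|xy] := eqVneq x y; first by rewrite /turnT /turnS /before !ltnn.
by rewrite /turnT /turnS P // P'.
Qed.

Lemma crossed_by_swing j : j \in D ->
  (j \in crossed_by G i XY') = (j \in crossed_by G i XY) (+) swing i turnT turnS j.
Proof.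
rewrite !inE => ji; rewrite ji /= !crossesE /swing /turnT /turnS -/f.
by case: (before XY.1 i j); case: (before XY'.1 i j); case: before; case: before.
Qed.

Lemma crossed_by_sub (Z : layout n) : crossed_by G i Z \subset D.
Proof. by apply/subsetP => j; rewrite !inE => /andP[]. Qed.

End Comparison.

Section Optimal.
Variables (n : nat) (G : tanglegram n) (i : 'I_n).
Let T := treeT G.
Let S := treeS G.
Let f := phi G.
Let fI : injective f := @perm_inj _ f.
Let idI : injective (@id 'I_n) := @inj_id _.
Variables (u0 wu v0 wv : tree 'I_n).
Hypotheses (u0t : u0 \in vertices T) (sibT : siblings i u0 wu).
Hypotheses (v0s : v0 \in vertices S) (sibS : siblings (f i) v0 wv).
Let w1 := trace i id wu.
Let w2 := trace i f wv.
Let F1 := clusters id T.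
Let F2 := clusters f S.

Let H1 : hierarchy F1 := hierarchy_clusters idI (leavesT G).
Let H2 : hierarchy F2 := hierarchy_clusters fI (leavesS G).
Let c1 := sibling_cluster (g := id) idI (leavesT G) u0t sibT.
Let c2 := sibling_cluster fI (leavesS G) v0s sibS.
Let e1 := sibling_ex (g := id) idI (leavesT G) u0t sibT.
Let e2 := sibling_ex fI (leavesS G) v0s sibS.

Variables XY XY' : layout n.
Hypotheses (eXY : extending G i XY) (eXY' : extending G i XY').

Let TT := congruent_turnT eXY eXY'.
Let SS := congruent_turnS eXY eXY'.
Let TC := symmetric_turnT eXY eXY'.
Let SC := symmetric_turnS eXY eXY'.
Let TS := turnTS eXY eXY'.
Let ST x y : x \in [set~ i] -> y \in [set~ i] -> turnS G XY XY' x y = turnT XY XY' x y.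
Proof. by move=> xD yD; rewrite TS. Qed.
Let cS j : j \in [set~ i] -> (j \in crossed_by G i XY') =
  (j \in crossed_by G i XY) (+) swing i (turnS G XY XY') (turnT XY XY') j.
Proof. by move=> jD; rewrite (crossed_by_swing G XY XY' jD) /swing; congr addb; rewrite addbC. Qed.

Lemma nestedS_optimal As : one_sided F1 F2 i w1 w2 As -> As != [::] ->
  head w2 As \subset w1 -> settled_in G i XY (w1 :\: head w2 As) ->
  settled_in G i XY w2 -> {in groups w2 As, forall E, settled_in G i XY E} ->
  crossings f XY <= crossings f XY'.
Proof.
case: c1 c2 => [a1 b1 n1] [a2 b2 n2] OA A0 top s1 s2 sA.
rewrite !(crossings_extending (i := i)) //.
apply: (nested_optimal H1 H2 TT SS TC SC TS a1 b1 n1 a2 b2 n2 e1 e2 _ OA) => //.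
- exact: crossed_by_swing.
- exact: crossed_by_sub.
exact: crossed_by_sub.
Qed.

Lemma nestedT_optimal As : one_sided F2 F1 i w2 w1 As -> As != [::] ->
  head w1 As \subset w2 -> settled_in G i XY (w2 :\: head w1 As) ->
  settled_in G i XY w1 -> {in groups w1 As, forall E, settled_in G i XY E} ->
  crossings f XY <= crossings f XY'.
Proof.
case: c1 c2 => [a1 b1 n1] [a2 b2 n2] OA A0 top s1 s2 sA.
rewrite !(crossings_extending (i := i)) //.
apply: (nested_optimal H2 H1 SS TT SC TC ST a2 b2 n2 a1 b1 n1 e2 e1 _ OA) => //.
- exact: crossed_by_sub.
exact: crossed_by_sub.
Qed.

Lemma disjointTS_optimal As Bs : [disjoint w1 & w2] ->
  one_sided F1 F2 i w1 w2 As -> one_sided F2 F1 i w2 w1 Bs ->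
  (As = [::] \/ ~~ (head w2 As \subset w1)) ->
  (Bs = [::] \/ ~~ (head w1 Bs \subset w2)) ->
  [disjoint crossed_by G i XY & w1] -> [disjoint crossed_by G i XY & w2] ->
  {in groups w2 As, forall E, settled_in G i XY E} ->
  {in groups w1 Bs, forall E, settled_in G i XY E} ->
  crossings f XY <= crossings f XY'.
Proof.
case: c1 c2 => [a1 b1 n1] [a2 b2 n2] w12 OA OB tA tB k1 k2 sA sB.
rewrite !(crossings_extending (i := i)) //.
apply: (disjoint_optimal H1 H2 TT SS TC SC TS a1 b1 n1 a2 b2 n2 e1 e2 _ w12 OA OB) => //.
- exact: crossed_by_swing.
- exact: crossed_by_sub.
exact: crossed_by_sub.
Qed.

(** The chains are empty: the largest member of one contains the common element of
    the sibling sets, so it is inside the other sibling set, which the hypotheses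
    exclude, or above it, which the definition of the chain excludes. *)
Lemma overlap_pattern As Bs : ~~ [disjoint w1 & w2] ->
  one_sided F1 F2 i w1 w2 As -> one_sided F2 F1 i w2 w1 Bs ->
  (As = [::] \/ ~~ (head w2 As \subset w1)) ->
  (Bs = [::] \/ ~~ (head w1 Bs \subset w2)) ->
  exists a b, forall j, j != i ->
    crosses f XY' i j = crosses f XY i j (+) (a && (j \in w1)) (+) (b && (j \in w2)).
Proof.
case: c1 c2 => [a1 b1 n1] [a2 b2 n2] w12 OA OB tA tB.
have [z /andP[z1 z2]] := pred0Pn w12.
have up C : common F1 F2 [set~ i] C -> (w1 \proper C) = (w2 \proper C).
  have [_ HA] := OA; have [_ HB] := OB.
  move=> CC; apply/idP/idP => wC; apply: contraT => wC'.
    have /HB := And3 (commonC CC) wC wC'.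
    case: Bs OB tB HB => [|B Bs] OB tB HB //= _.
    case: tB => [//|/= tB]; have [CB w1B w2B] := proj1 (HB B) (mem_head _ _).
    have zB : z \in B by apply: (subsetP (proper_sub w1B)).
    have [S'|S'] := common_sibling H2 a2 n2 CB zB z2; first by rewrite S' in tB.
    by rewrite S' in w2B.
  have /HA := And3 CC wC wC'.
  case: As OA tA HA => [|B Bs'] OA tA HA //= _.
  case: tA => [//|/= tA]; have [CB w2B w1B] := proj1 (HA B) (mem_head _ _).
  have zB : z \in B by apply: (subsetP (proper_sub w2B)).
  have [S'|S'] := common_sibling H1 a1 n1 CB zB z1; first by rewrite S' in tA.
  by rewrite S' in w1B.
have [a [b ab]] := swing_overlap H1 H2 TT SS TC SC TS a1 b1 n1 a2 b2 n2 z1 z2 up.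
exists a, b => j ji; have jD : j \in [set~ i] by rewrite !inE.
have := crossed_by_swing G XY XY' jD; rewrite ab // !inE ji /= => ->.
by rewrite addbA.
Qed.

End Optimal.

(** * The three cases *)

Section Nested.
Variables (n : nat) (G : tanglegram n) (i : 'I_n).
Let f := phi G.
Variables (edges1 edges2 : tree 'I_n -> tree 'I_n -> comp (seq 'I_n)).
Variables (sw1 sw2 : tree 'I_n -> layout n -> comp (layout n)).
Variables (turn : layout n -> vpair n -> comp (layout n)).
Variables (side : vpair n -> tree 'I_n) (g1 g2 : 'I_n -> 'I_n) (t1 t2 : tree 'I_n).
Variables (a0 am b0 lf : tree 'I_n).

(** Cases A and B exchange the roles of the two trees. *)
Definition nested_case (ps : seq (vpair n)) (XY : layout n) : comp (layout n) :=
  let* Ea := edges1 a0 am in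
  let* b := bad f i XY Ea in
  let* XY := if b then sw1 a0 XY else ret XY in
  let* XY := flip_chain G i edges2 turn side b0 ps XY in
  let* Eb := edges2 b0 lf in
  let* b := bad f i XY Eb in
  if b then sw2 b0 XY else ret XY.

Variables (w1 w2 : {set 'I_n}) (good : vpair n -> Prop).
Hypothesis edges1P : forall u w : tree 'I_n, u \in vertices t1 -> w \in vertices t1 ->
  within (edges1 u w) (6 * n) (fun es => lists es (trace i g1 u :\: trace i g1 w)).
Hypothesis edges2P : forall u w : tree 'I_n, u \in vertices t2 -> w \in vertices t2 ->
  within (edges2 u w) (6 * n) (fun es => lists es (trace i g2 u :\: trace i g2 w)).
Hypothesis turnP : forall XY p, extending G i XY -> good p ->
  within (turn XY p) (24 * n) (moved G i XY (trace i g2 (side p))).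
Hypotheses (a0t : a0 \in vertices t1) (amt : am \in vertices t1).
Hypotheses (b0t : b0 \in vertices t2) (lft : lf \in vertices t2).
Hypotheses (w1E : trace i g1 a0 = w1) (w2E : trace i g2 b0 = w2).
Hypothesis lfE : trace i g2 lf = set0.
Hypothesis sw1P : forall XY, extending G i XY ->
  within (sw1 a0 XY) (16 * n) (moved G i XY w1).
Hypothesis sw2P : forall XY, extending G i XY ->
  within (sw2 b0 XY) (16 * n) (moved G i XY w2).

Lemma within_nested_case (ps : seq (vpair n)) (XY : layout n) : extending G i XY ->
  {in ps, forall p, side p \in vertices t2 /\ good p} ->
  let As : seq {set 'I_n} := [seq trace i g2 (side p) | p <- ps] in
  sorted (fun A B : {set 'I_n} => B \proper A) As -> As != [::] ->
  trace i g1 am = head w2 As -> {in As, forall A : {set 'I_n}, w2 \proper A} ->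
  within (nested_case ps XY) (size ps * (48 * n) + 100 * n) (fun XY' =>
    [/\ extending G i XY', settled_in G i XY' (w1 :\: head w2 As),
        settled_in G i XY' w2 & {in groups w2 As, forall E, settled_in G i XY' E}]).
Proof.
move=> eXY good_ps As srt As0 amE w2A; rewrite /nested_case.
have n0 : 0 < n := leq_ltn_trans (leq0n i) (ltn_ord i).
apply: (within_bind (edges1P a0t amt)); first by lia.
move=> Ea LEa; rewrite w1E amE in LEa.
have iEa : i \notin w1 :\: head w2 As by rewrite inE -w1E in_trace eqxx !andbF.
apply: (within_bind_eq (within_bad eXY LEa iEa)); first by lia.
have sw1' XY1 : extending G i XY1 -> within (sw1 a0 XY1) (24 * n) (moved G i XY1 w1).
  by move=> e1; apply: within_weaken (sw1P e1) _ _ => //; lia.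
have sw2' XY1 : extending G i XY1 -> within (sw2 b0 XY1) (24 * n) (moved G i XY1 w2).
  by move=> e1; apply: within_weaken (sw2P e1) _ _ => //; lia.
apply: (within_bind (within_settle eXY (subsetDl _ _) iEa erefl (sw1' _ eXY))).
  by lia.
move=> XY1 [eXY1 st1 _].
apply: (within_bind (within_flip_chain edges2P turnP eXY1 b0t good_ps srt)); first by lia.
move=> XY2 [eXY2 same2 st2]; rewrite w2E -/As in same2 st2.
have top : head set0 As = head w2 As by case: (As) As0.
rewrite top in same2.
apply: (within_bind (edges2P b0t lft)); first by lia.
move=> Eb LEb; rewrite lfE setD0 w2E in LEb.
have iEb : i \notin w2 by rewrite -w2E in_trace eqxx andbF.
apply: (within_bind_eq (within_bad eXY2 LEb iEb)); first by lia.
apply: within_weaken (within_settle eXY2 (subxx _) iEb erefl (sw2' _ eXY2)) _ _; first by lia.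
have w2top : w2 \subset head w2 As.
  by case: (As) As0 w2A => //= A l _ /(_ A (mem_head _ _))/proper_sub.
move=> XY3 [eXY3 st3 same3]; split=> //.
  apply: settled_same (settled_same st1 _) _ => j ji.
    by rewrite inE => /andP[jt _]; apply: same2.
  rewrite inE => /andP[jt _]; apply: same3 => //; apply: contra jt.
  exact: subsetP.
move=> E EAs; apply: settled_same (st2 _ EAs) _ => j ji.
have [A [B [_ -> /subsetP sub _]]] := groupsP srt w2A EAs.
by rewrite inE => /andP[jB _]; apply: same3 => //; apply: contra jB; apply: sub.
Qed.

End Nested.

Lemma within_fewest_crossings n (G : tanglegram n) (i : 'I_n) js (l : seq (layout n)) :
  perm_eq js (enum 'I_n) -> {in l, forall XY, extending G i XY} -> l != [::] ->
  within (fewest_crossings (phi G) js l) (size l * (18 * n ^ 2 + 4) + 4)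
    (fun XY => XY \in l /\ {in l, forall XY', crossings (phi G) XY <= crossings (phi G) XY'}).
Proof.
move=> jsE el l0; rewrite /fewest_crossings.
set c := crossings (phi G).
apply: within_bind_eq; [apply: (within_lmap (g := fun XY => (c XY, XY)) (k := 18 * n ^ 2)) | |].
- move=> XY XYl; apply: (within_bind_eq (within_crossing_number (el _ XYl) jsE)); first by [].
  exact: within_ret.
- by set m := size l; nia.
pose Inv (p : seq (nat * layout n)) (o : option (nat * seq (layout n))) :=
  if o is Some (m, bs) then
    [/\ bs != [::], size bs <= size p, forall XY : layout n, XY \in bs -> (m, XY) \in p &
        forall q, q \in p -> m <= q.1] else p = [::].
apply: within_bind; [apply: (within_lfold (k := 0) (Inv := Inv)) | | ] => //.
- move=> p [m XY] s o lE; case: o => [[m' bs]|] /=; last first.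
    by move=> ->; apply: within_ret; split=> // [XY'|q]; rewrite mem_seq1 => /eqP->;
      rewrite ?mem_head.
  move=> [bs0 sz H K]; apply: within_ret; rewrite /Inv; case: ltnP => [lt|ge].
    split=> //; first by rewrite size_rcons.
      by move=> XY'; rewrite mem_seq1 => /eqP->; rewrite mem_rcons mem_head.
    move=> q; rewrite mem_rcons inE => /predU1P[->//|/K].
    exact: leq_trans (ltnW lt).
  case: eqP ge => [-> _|_ ge].
    split; rewrite ?size_rcons //; last first.
      by move=> q; rewrite mem_rcons inE => /predU1P[->|/K]//.
    move=> XY'; rewrite inE mem_rcons inE => /predU1P[->|/H->]; rewrite ?eqxx ?orbT //.
  split; rewrite ?size_rcons //; first exact: leqW.
    by move=> XY' /H; rewrite mem_rcons inE => ->; rewrite orbT.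
  by move=> q; rewrite mem_rcons inE => /predU1P[->|/K].
- by rewrite size_map; set m := size l; nia.
case=> [[m bs]|/= /(congr1 size)]; last by rewrite size_map => /size0nil lE; rewrite lE in l0.
move=> [bs0 sz H K]; apply: within_choose => //.
  by move: sz; rewrite size_map; set k1 := size l; set m2 := size bs => sz; nia.
move=> XY /H/mapP[XY' XYl [mE ->]]; split=> // XY2 XY2l.
by rewrite -/c -mE; apply: (K (c XY2, XY2)); apply: (map_f (fun XY => (c XY, XY))) XY2l.
Qed.

(** The order of one side does not let i tell apart the elements of w1.  On the
    other side i compares with them as any z in w2 does, and z cannot tell them
    apart either, because it compares with them as on the first side. *)
Lemma sibling_together (V : finType) (F1 F2 : seq {set V}) (i : V)
    (w1 w2 : {set V}) (o1 o2 : rel V) :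
  congruent F1 setT o1 -> congruent F2 setT o2 ->
  (forall x y, x != y -> o1 y x = ~~ o1 x y) ->
  (forall x y, x != i -> y != i -> x != y -> o1 x y = o2 x y) ->
  w1 \in F1 -> i \notin w1 -> i |: w2 \in F2 -> i \notin w2 ->
  (exists z, z \in w2) -> [disjoint w1 & w2] ->
  {in w1 &, forall j k, o1 i j (+) o2 i j = o1 i k (+) o2 i k}.
Proof.
move=> C1 C2 t1 P w1F iw1 w2F iw2 [z zw2] dis j k jw kw.
have n1 l : l \in w1 -> l != i by move=> lw; apply: contraNneq iw1 => <-.
have zi : z != i by apply: contraNneq iw2 => <-.
have zw1 : z \notin w1.
  by apply/negP => zw1; have := pred0P dis z; rewrite /= zw1 zw2.
have n2 l : l \in w1 -> l \notin w2.
  by move=> lw; apply/negP => lw2; have := pred0P dis l; rewrite /= lw lw2.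
have zl l : l \in w1 -> l != z by move=> lw; apply: contraNneq zw1 => <-.
have -> : o1 i j = o1 i k by rewrite t1 ?n1 // [RHS]t1 ?n1 // (C1 _ w1F j k i).
have E l : l \in w1 -> o2 i l = ~~ o1 l z.
  move=> lw; rewrite (C2 _ w2F i z l) ?inE ?eqxx ?zw2 ?orbT //; last first.
    by rewrite negb_or n1 // n2.
  have zl' : z != l by rewrite eq_sym zl.
  by rewrite -(P z l zi (n1 _ lw) zl') (t1 l z) ?zl.
by rewrite !E // (C1 _ w1F j k z).
Qed.

Section Step2.
Variables (n : nat) (G : tanglegram n) (i : 'I_n).
Let T := treeT G.
Let S := treeS G.
Let f := phi G.
Let fI : injective f := @perm_inj _ f.
Let idI : injective (@id 'I_n) := @inj_id _.
Variables (leT leS : tree 'I_n * tree 'I_n -> bool) (js : seq 'I_n).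
Hypotheses (leTP : is_below T leT) (leSP : is_below S leS).
Hypothesis jsE : perm_eq js (enum 'I_n).
Variables (u0 wu v0 wv : tree 'I_n).
Hypotheses (u0t : u0 \in vertices T) (sibT : siblings i u0 wu).
Hypotheses (v0s : v0 \in vertices S) (sibS : siblings (f i) v0 wv).
Let w1 := trace i id wu.
Let w2 := trace i f wv.
Let F1 := clusters id T.
Let F2 := clusters f S.
Implicit Types (p : vpair n) (ps : seq (vpair n)) (XY : layout n).

Let n0 : 0 < n := leq_ltn_trans (leq0n i) (ltn_ord i).
Let H1 : hierarchy F1 := hierarchy_clusters idI (leavesT G).
Let H2 : hierarchy F2 := hierarchy_clusters fI (leavesS G).
Let c1 := sibling_cluster (g := id) idI (leavesT G) u0t sibT.
Let c2 := sibling_cluster fI (leavesS G) v0s sibS.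
Let e1 := sibling_ex (g := id) idI (leavesT G) u0t sibT.
Let e2 := sibling_ex fI (leavesS G) v0s sibS.

Let leafT : Leaf i \in vertices T.
Proof. by rewrite mem_vertices_Leaf (leaves_all (leavesT G)). Qed.

Let leafS : Leaf (f i) \in vertices S.
Proof. by rewrite mem_vertices_Leaf (leaves_all (leavesS G)). Qed.

Definition pairing p : Prop :=
  [/\ p.1 \in vertices T, p.2 \in vertices S & trace i id p.1 = trace i f p.2].

Definition goodS p : Prop := pairing p /\ (i \notin leaves p.1) && (f i \in leaves p.2).
Definition goodT p : Prop := pairing p /\ (i \in leaves p.1) && (f i \notin leaves p.2).

Let turnS XY p : extending G i XY -> goodS p ->
  within (paired_flip leT leS XY p) (24 * n) (moved G i XY (trace i f p.2)).
Proof.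
case: p => u v eXY [[ut vs uv] /andP[/= iu fv]]; rewrite -uv.
by apply: within_paired_flip => //; rewrite (negPf iu).
Qed.

Let turnT XY p : extending G i XY -> goodT p ->
  within (paired_flip leT leS XY p) (24 * n) (moved G i XY (trace i id p.1)).
Proof.
case: p => u v eXY [[ut vs uv] /andP[/= iu fv]].
by apply: within_paired_flip => //; rewrite iu (negPf fv).
Qed.

Definition optimal XY : Prop := extending G i XY /\
  forall XY', extending G i XY' -> crossings f XY <= crossings f XY'.

Section Chains.
Variables (psS psT : seq (vpair n)).
Let As : seq {set 'I_n} := [seq trace i f p.2 | p <- psS].
Let Bs : seq {set 'I_n} := [seq trace i id p.1 | p <- psT].
Hypotheses (OA : one_sided F1 F2 i w1 w2 As) (OB : one_sided F2 F1 i w2 w1 Bs).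
Hypothesis goodSs : {in psS, forall p, p.2 \in vertices S /\ goodS p}.
Hypothesis goodTs : {in psT, forall p, p.1 \in vertices T /\ goodT p}.
Hypotheses (sizeS : size psS <= 2 * n) (sizeT : size psT <= 2 * n).

Let nn : n <= n ^ 2. Proof. by rewrite -[n in n <= _]expn1 leq_pexp2l. Qed.
Let costS : size psS * (48 * n) <= 96 * n ^ 2.
Proof. by apply: leq_trans (leq_mul sizeS (leqnn _)) _; lia. Qed.
Let costT : size psT * (48 * n) <= 96 * n ^ 2.
Proof. by apply: leq_trans (leq_mul sizeT (leqnn _)) _; lia. Qed.

Lemma within_caseA XY um : extending G i XY -> As != [::] -> head w2 As \subset w1 ->
  um \in vertices T -> trace i id um = head w2 As ->
  within (caseA f i js leT leS u0 v0 um psS XY) (300 * n ^ 2) optimal.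
Proof.
move=> eXY A0 top umt umE; rewrite /caseA.
apply: (within_bind_eq (within_read f i)); first by clear -nn n0 costS; lia.
have pT : trace i id u0 = w1 by apply: trace_parent.
have pS : trace i f v0 = w2 by apply: trace_parent.
have [srt HA] := OA.
apply: within_weaken.
- apply: (within_nested_case (sw1 := switchT leT) (sw2 := switchS leS)
    (within_edges_atT i leTP jsE) (within_edges_atS (G := G) i leSP jsE) turnS
    u0t umt v0s leafS pT pS _ _ _ eXY goodSs srt A0 umE).
  + exact: trace_leaf.
  + by move=> XY1 eXY1; apply: within_switchT.
  + by move=> XY1 eXY1; apply: within_switchS.
  by move=> A /HA[].
- by clear -nn n0 costS; lia.
move=> XY' [eXY' st1 st2 stA]; split=> // XY'' eXY''.
exact: (nestedS_optimal u0t sibT v0s sibS eXY' eXY'' OA A0 top st1 st2 stA).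
Qed.

Lemma within_caseB XY vm : extending G i XY -> Bs != [::] -> head w1 Bs \subset w2 ->
  vm \in vertices S -> trace i f vm = head w1 Bs ->
  within (caseB f i js leT leS u0 v0 vm psT XY) (300 * n ^ 2) optimal.
Proof.
move=> eXY B0 top vms vmE; rewrite /caseB.
have pT : trace i id u0 = w1 by apply: trace_parent.
have pS : trace i f v0 = w2 by apply: trace_parent.
have [srt HB] := OB.
apply: within_weaken.
- apply: (within_nested_case (sw1 := switchS leS) (sw2 := switchT leT)
    (within_edges_atS (G := G) i leSP jsE) (within_edges_atT i leTP jsE) turnT
    v0s vms u0t leafT pS pT _ _ _ eXY goodTs srt B0 vmE).
  + exact: trace_leaf.
  + by move=> XY1 eXY1; apply: within_switchS.
  + by move=> XY1 eXY1; apply: within_switchT.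
  by move=> B /HB[].
- by clear -nn n0 costT; lia.
move=> XY' [eXY' st1 st2 stB]; split=> // XY'' eXY''.
exact: (nestedT_optimal u0t sibT v0s sibS eXY' eXY'' OB B0 top st1 st2 stB).
Qed.

Hypothesis topS : As = [::] \/ ~~ (head w2 As \subset w1).
Hypothesis topT : Bs = [::] \/ ~~ (head w1 Bs \subset w2).

Let togetherT XY : extending G i XY -> [disjoint w1 & w2] ->
  {in w1 &, forall j k, crosses f XY i j = crosses f XY i k}.
Proof.
case: c1 c2 => [a1 b1 m1] [a2 b2 m2] [LX LY P] dis j k jw kw; rewrite !crossesE.
apply: (sibling_together (F1 := F1) (F2 := F2) (w1 := w1) (w2 := w2)
   (o1 := before XY.1) (o2 := fun x y => before XY.2 (f x) (f y))) => //.
- exact: (congruent_leaf_order (g := id) (leavesT G) LX).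
- exact: (congruent_leaf_order (g := f) (leavesS G) LY).
by move=> x y xy; rewrite (before_in_order (leavesT G) LX xy).
Qed.

Let togetherS XY : extending G i XY -> [disjoint w1 & w2] ->
  {in w2 &, forall j k, crosses f XY i j = crosses f XY i k}.
Proof.
case: c1 c2 => [a1 b1 m1] [a2 b2 m2] [LX LY P] dis j k jw kw; rewrite !crossesE.
rewrite addbC [RHS]addbC.
apply: (sibling_together (F1 := F2) (F2 := F1) (w1 := w2) (w2 := w1)
   (o2 := before XY.1) (o1 := fun x y => before XY.2 (f x) (f y))) => //.
- exact: (congruent_leaf_order (g := f) (leavesS G) LY).
- exact: (congruent_leaf_order (g := id) (leavesT G) LX).
- move=> x y xy; have fxy : f x != f y by rewrite (inj_eq fI).
  by rewrite (before_in_order (leavesS G) LY fxy).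
- by move=> x y xi yi xy; rewrite P.
by rewrite disjoint_sym.
Qed.

(** Switching the inserted edge over to the other side of w frees w. *)
Lemma within_clear XY (w : {set 'I_n}) b (sw : comp (layout n)) : extending G i XY ->
  i \notin w -> {in w &, forall j k, crosses f XY i j = crosses f XY i k} ->
  b = (#|crossed_by G i XY :&: w| == #|w|) ->
  within sw (16 * n) (moved G i XY w) ->
  within (if b then sw else ret XY) (16 * n) (fun XY' =>
    [/\ extending G i XY', [disjoint crossed_by G i XY' & w] &
     forall j, j != i -> j \notin w -> crosses f XY' i j = crosses f XY i j]).
Proof.
move=> eXY iw tog ->; have wi j : j \in w -> j != i.
  by move=> jw; apply: contraNneq iw => <-.
have le : #|crossed_by G i XY :&: w| <= #|w| by apply/subset_leq_card/subsetIr.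
case: ifP => [/eqP all_|some] swP.
  apply: within_weaken swP _ _ => // XY' [eXY' mv]; split=> //; last first.
    by move=> j ji jw; rewrite mv // (negPf jw) addbF.
  have /eqP sub : crossed_by G i XY :&: w == w by rewrite eqEcard subsetIr all_ leqnn.
  apply/pred0P => j /=; apply/negbTE/negP => /andP[]; rewrite inE => /andP[ji cr] jw.
  move: cr; rewrite mv // jw addbT; apply/negP; rewrite negbK.
  by have := jw; rewrite -sub !inE => /andP[/andP[]].
apply: within_ret; split=> //.
apply/pred0P => j /=; apply/negbTE/negP => /andP[]; rewrite inE => /andP[ji cr] jw.
move/negP: some; apply; rewrite eqn_leq le /=; apply/subset_leq_card/subsetP => k kw.
by rewrite !inE kw wi // (tog k j) // cr.
Qed.

(** If the sibling sets are disjoint, i crosses all or none of each of them, so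
    the two final switches leave no crossing there.  If they meet, the competitor
    crosses the same edges as one of the four layouts. *)
Lemma within_caseC XY : extending G i XY ->
  within (caseC f i js leT leS u0 v0 psS psT XY) (500 * n ^ 2) optimal.
Proof.
move=> eXY; rewrite /caseC.
have pT : trace i id u0 = w1 by apply: trace_parent.
have pS : trace i f v0 = w2 by apply: trace_parent.
have [srtA HA] := OA; have [srtB HB] := OB.
have w2A A : A \in As -> w2 \proper A by case/HA.
have w1B B : B \in Bs -> w1 \proper B by case/HB.
have [[a1 b1 iw1] [a2 b2 iw2]] := (c1, c2).
apply: (within_bind_eq (within_read f i)); first by clear -nn n0 costS costT; lia.
apply: (within_bind (within_flip_chain (within_edges_atT i leTP jsE) turnT eXY u0t goodTs srtB)).
  by clear -nn n0 costS costT; lia.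
move=> XY1 [eXY1 _ stB].
apply: (within_bind (within_flip_chain (within_edges_atS (G := G) i leSP jsE) turnS eXY1 v0s goodSs srtA)).
  by clear -nn n0 costS costT; lia.
move=> XY2 [eXY2 same2 stA]; rewrite pT -/Bs in stB; rewrite pS -/As in stA same2.
apply: (within_bind (within_edges_atT i leTP jsE u0t leafT)); first by clear -nn n0 costS costT; lia.
move=> Ea; rewrite pT (trace_leaf i idI) setD0 => LEa.
apply: (within_bind (within_edges_atS (G := G) i leSP jsE v0s leafS)); first by clear -nn n0 costS costT; lia.
move=> Eb; rewrite pS (trace_leaf i fI) setD0 => LEb.
have meetE : has (mem Eb) Ea = ~~ [disjoint w1 & w2].
  apply/hasP/pred0Pn => [[x xa xb]|[x /andP[xa xb]]]; exists x.
  - have xb' : x \in Eb := xb.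
    by rewrite LEa.2 in xa; rewrite LEb.2 in xb'; apply/andP.
  - by rewrite LEa.2.
  by rewrite /= LEb.2.
apply: (@within_bind_eq _ _ _ _ (has (mem Eb) Ea) (6 * n ^ 2)).
- apply: within_weaken; [apply: (within_lhas (q := mem Eb) (k := n * 1 + 1)) | |] => //.
    move=> x _; apply: within_weaken; [apply: (within_lhas (q := pred1 x) (k := 0)) | |].
    + by move=> y _; rewrite /= [y == x]eq_sym; apply: within_ret.
    + by move: (lists_le LEb); set m := size Eb; clear; lia.
    by move=> _ <-; rewrite has_pred1.
  apply: leq_trans (_ : (n * (n * 1 + 1).+1).+1 <= _); last by clear -nn n0; lia.
  by rewrite ltnS leq_mul2r (lists_le LEa) orbT.
- by clear -nn n0 costS costT; lia.
rewrite meetE negbK; case: ifPn => [dis|meet].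
  have disA := top_disjoint H1 a1 iw1 OA dis topS.
  have disB : [disjoint head w1 Bs & w2].
    by apply: (top_disjoint H2 a2 iw2 OB _ topT); rewrite disjoint_sym.
  have disAB := tops_disjoint H1 OA OB disA disB.
  apply: (within_bind_eq (within_crosses_all eXY2 LEa iw1)); first by clear -nn n0 costS costT; lia.
  apply: (within_bind (within_clear eXY2 iw1 (togetherT eXY2 dis) erefl
     (within_switchT leTP eXY2 u0t sibT))); first by clear -nn n0 costS costT; lia.
  move=> XY3 [eXY3 K1 same3].
  apply: (within_bind_eq (within_crosses_all eXY3 LEb iw2)); first by clear -nn n0 costS costT; lia.
  apply: within_weaken (within_clear eXY3 iw2 (togetherS eXY3 dis) erefl
     (within_switchS leSP eXY3 v0s sibS)) _ _; first by clear -nn n0 costS costT; lia.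
  move=> XY4 [eXY4 K2 same4]; split=> // XY' eXY'.
  have out (X Y : {set 'I_n}) j : [disjoint X & Y] -> j \in X -> j \notin Y.
    by move=> /pred0P dXY jX; apply/negP => jY; have := dXY j; rewrite /= jX jY.
  have in_group (ws : {set 'I_n}) (Cs : seq {set 'I_n}) (E : {set 'I_n}) j :
      sorted (fun A B : {set 'I_n} => B \proper A) Cs ->
      {in Cs, forall A : {set 'I_n}, ws \proper A} -> E \in groups ws Cs -> j \in E ->
      j \in head ws Cs /\ j \notin ws.
    move=> srt sub ECs jE; have [A [B [ACs EE wB _]]] := groupsP srt sub ECs.
    move: jE; rewrite EE inE => /andP[jB jA]; split; last by apply: contra jB; apply: subsetP.
    exact: subsetP (sorted_top _ srt ACs) _ jA.
  apply: (disjointTS_optimal u0t sibT v0s sibS eXY4 eXY' dis OA OB topS topT _ K2).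
  - apply/pred0P => j /=; apply/negbTE/negP => /andP[]; rewrite inE => /andP[ji cr] jw.
    have jK : j \in crossed_by G i XY3 by rewrite inE ji -same4 // (out _ _ _ dis jw).
    by have := out _ _ _ K1 jK; rewrite jw.
  - move=> E EAs; apply: settled_same (settled_same (stA _ EAs) _) _ => j ji jE;
    have [jA jw] := in_group _ _ _ _ srtA w2A EAs jE; [apply: same3 | apply: same4] => //.
    exact: out disA jA.
  move=> E EBs; apply: settled_same (settled_same (settled_same (stB _ EBs) _) _) _ => j ji jE;
  have [jB jw] := in_group _ _ _ _ srtB w1B EBs jE; [apply: same2 | apply: same3 | apply: same4] => //.
  - have := out _ _ _ disAB jB; apply: contra.
    by case: (As) => //=; rewrite inE.
  exact: out disB jB.
apply: (within_bind (within_switchT leTP eXY2 u0t sibT)); first by clear -nn n0 costS costT; lia.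
move=> Z1 [eZ1 m1]; apply: (within_bind (within_switchS leSP eXY2 v0s sibS)); first by clear -nn n0 costS costT; lia.
move=> Z2 [eZ2 m2]; apply: (within_bind (within_switchS leSP eZ1 v0s sibS)); first by clear -nn n0 costS costT; lia.
move=> Z3 [eZ3 m3]; pose l := [:: XY2; Z1; Z2; Z3].
have el : {in l, forall XY, extending G i XY}.
  by move=> Z; rewrite !inE => /or4P[]/eqP->.
apply: within_weaken (within_fewest_crossings jsE el _) _ _ => //=; first by clear -nn n0 costS costT; lia.
move=> Z [Zl best]; split; first exact: el.
move=> XY' eXY'.
have [a [b ab]] := overlap_pattern u0t sibT v0s sibS eXY2 eXY' meet OA OB topS topT.
(* The bits tell which of the two switches the competitor amounts to. *)
pose Zab := if a then if b then Z3 else Z1 else if b then Z2 else XY2.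
have Zabl : Zab \in l by rewrite /Zab !inE; case: (a); case: (b); rewrite eqxx ?orbT.
suff <- : crossings f Zab = crossings f XY' by apply: best.
rewrite !(crossings_extending (i := i)) //; last exact: el.
apply: eq_card => j; rewrite !inE; have [//|ji] := eqVneq j i.
rewrite /= ab // /Zab; case: (a); case: (b); rewrite /= ?m3 ?m2 ?m1 ?addbF //.
Qed.

End Chains.

Variable R : seq (vpair n).
Hypothesis RP : {in R, forall p, [/\ p.1 \in vertices T, p.2 \in vertices S,
  branching i id p.1, branching i f p.2 & trace i id p.1 = trace i f p.2]}.
Hypothesis RC : forall C, common F1 F2 [set~ i] C -> 1 < #|C| ->
  exists2 p, p \in R & trace i id p.1 = C.
Hypotheses (RU : uniq R) (RS : size R <= 2 * n).

Let LS := [seq p <- R | (i \notin leaves p.1) && (f i \in leaves p.2)].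
Let LT := [seq p <- R | (i \in leaves p.1) && (f i \notin leaves p.2)].

Let aboveT p : p \in R ->
  within (above leT p.1 (Leaf i)) 2 (eq (i \in leaves p.1)).
Proof.
move=> /RP[ut _ [u1 [u2 [uE _ _]]] _ _].
apply: within_weaken; [exact: within_above | by [] |] => _ <-.
by rewrite (belowE leTP) // uE andbT.
Qed.

Let aboveS p : p \in R ->
  within (above leS p.2 (Leaf (f i))) 2 (eq (f i \in leaves p.2)).
Proof.
move=> /RP[_ vs _ [v1 [v2 [vE _ _]]] _].
apply: within_weaken; [exact: within_above | by [] |] => _ <-.
by rewrite (belowE leSP) // vE andbT.
Qed.

Let inj1 p q : p \in R -> q \in R -> p.1 = q.1 -> p = q.
Proof.
case: p q => u v [u' v'] /RP[/= _ vs _ bv uv] /RP[/= _ vs' _ bv' uv'] uu.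
rewrite -uu in uv' *; congr pair; apply: (branching_inj (leavesS G) vs vs' bv bv').
by rewrite -uv uv'.
Qed.

Let inj2 p q : p \in R -> q \in R -> p.2 = q.2 -> p = q.
Proof.
case: p q => u v [u' v'] /RP[/= us _ bu _ uv] /RP[/= us' _ bu' _ uv'] vv.
rewrite -vv in uv' *; congr pair; apply: (branching_inj (leavesT G) us us' bu bu').
by rewrite uv uv'.
Qed.

Let sortS : within (lsort (fun p q => above leS p.2 q.2) LS) (16 * n ^ 2 + 1)
  (fun s => perm_eq s LS /\ sorted (lower snd) s).
Proof.
have sz : size LS <= 2 * n by apply: leq_trans RS; rewrite size_filter count_size.
have inLS p : p \in LS -> p \in R /\ f i \in leaves p.2.
  by rewrite mem_filter => /andP[/andP[_ ->] ->].
apply: within_weaken; [apply: (within_lsort (k := 2) (r := lower snd)) | |] => //.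
- exact: filter_uniq.
- move=> p q /inLS[/RP[_ vs _ _ _] _] _; apply: within_weaken; [exact: within_above | by [] |].
  by move=> _ <-; rewrite leSP vs.
- move=> p q /inLS[pR fp] /inLS[qR fq] pq.
  have [_ vp _ _ _] := RP pR; have [_ vq _ _ _] := RP qR.
  have npq : p.2 != q.2 by apply: contra pq => /eqP/(inj2 pR qR)->.
  rewrite /lower npq [q.2 == _]eq_sym npq !andbT.
  have [->|->] := vertices_laminar (leaves_tree_uniq (leavesS G)) vp vq fp fq => //.
  by rewrite orbT.
move: sz; set m := size LS; move: n0; clear; nia.
Qed.

Let sortT : within (lsort (fun p q => above leT p.1 q.1) LT) (16 * n ^ 2 + 1)
  (fun s => perm_eq s LT /\ sorted (lower fst) s).
Proof.
have sz : size LT <= 2 * n by apply: leq_trans RS; rewrite size_filter count_size.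
have inLT p : p \in LT -> p \in R /\ i \in leaves p.1.
  by rewrite mem_filter => /andP[/andP[-> _] ->].
apply: within_weaken; [apply: (within_lsort (k := 2) (r := lower fst)) | |] => //.
- exact: filter_uniq.
- move=> p q /inLT[/RP[ut _ _ _ _] _] _; apply: within_weaken; [exact: within_above | by [] |].
  by move=> _ <-; rewrite leTP ut.
- move=> p q /inLT[pR fp] /inLT[qR fq] pq.
  have [up _ _ _ _] := RP pR; have [uq _ _ _ _] := RP qR.
  have npq : p.1 != q.1 by apply: contra pq => /eqP/(inj1 pR qR)->.
  rewrite /lower npq [q.1 == _]eq_sym npq !andbT.
  have [->|->] := vertices_laminar (leaves_tree_uniq (leavesT G)) up uq fp fq => //.
  by rewrite orbT.
move: sz; set m := size LT; move: n0; clear; nia.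
Qed.

Lemma within_step2 XY : extending G i XY ->
  within (step2 f i js leT leS u0 v0 R XY) (600 * n ^ 2) optimal.
Proof.
move=> eXY; rewrite /step2.
have nn : n <= n ^ 2 by rewrite -[n in n <= _]expn1 leq_pexp2l.
apply: (within_bind_eq (within_read f i)); first by clear -nn n0; lia.
have costR : (size R * 5).+1 <= 11 * n by move: RS n0; clear; lia.
apply: (@within_bind_eq _ _ _ _ LS (11 * n)); [| by clear -nn n0; lia |].
  apply: within_weaken; [apply: (within_lfilter (k := 4) (q := fun p => (i \notin leaves p.1) && (f i \in leaves p.2))) | exact: costR | by []].
  move=> p pR; apply: within_bind_eq; [exact: aboveT | by [] |].
  apply: within_bind_eq; [exact: aboveS | by [] |]; exact: within_ret.
apply: (@within_bind_eq _ _ _ _ LT (11 * n)); [| by clear -nn n0; lia |].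
  apply: within_weaken; [apply: (within_lfilter (k := 4) (q := fun p => (i \in leaves p.1) && (f i \notin leaves p.2))) | exact: costR | by []].
  move=> p pR; apply: within_bind_eq; [exact: aboveT | by [] |].
  apply: within_bind_eq; [exact: aboveS | by [] |]; exact: within_ret.
apply: (within_bind sortS); first by clear -nn n0; lia.
move=> psS [pS srtS]; apply: (within_bind sortT); first by clear -nn n0; lia.
move=> psT [pT srtT].
have OA := chain_one_sided (sA := fst) (sB := snd) idI fI (leavesT G) (leavesS G)
  u0t sibT v0s sibS RP.
have {}OA : one_sided F1 F2 i w1 w2 [seq trace i f p.2 | p <- psS].
  apply: OA => //; last exact: perm_mem.
  move=> C CC C1; have [p pR pC] := RC CC C1; exists p => //.
  by have [_ _ _ _ <-] := RP pR.
have RP' : {in R, forall p, [/\ p.2 \in vertices S, p.1 \in vertices T,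
    branching i f p.2, branching i id p.1 & trace i f p.2 = trace i id p.1]}.
  by move=> p /RP[].
have OB := chain_one_sided (sA := snd) (sB := fst) fI idI (leavesS G) (leavesT G)
  v0s sibS u0t sibT RP'.
have {}OB : one_sided F2 F1 i w2 w1 [seq trace i id p.1 | p <- psT].
  apply: OB => //; first by move=> C /commonC CC C1; apply: RC.
  by move=> p; rewrite (perm_mem pT) !mem_filter; congr (_ && _); rewrite andbC.
have goodSs : {in psS, forall p, p.2 \in vertices S /\ goodS p}.
  move=> p; rewrite (perm_mem pS) mem_filter => /andP[ip /RP[? ? _ _ ?]].
  by split=> //; split.
have goodTs : {in psT, forall p, p.1 \in vertices T /\ goodT p}.
  move=> p; rewrite (perm_mem pT) mem_filter => /andP[ip /RP[? ? _ _ ?]].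
  by split=> //; split.
have szS : size psS <= 2 * n.
  by rewrite (perm_size pS); apply: leq_trans RS; rewrite size_filter count_size.
have szT : size psT <= 2 * n.
  by rewrite (perm_size pT); apply: leq_trans RS; rewrite size_filter count_size.
have inS p : p \in psS -> p \in R by rewrite (perm_mem pS) mem_filter => /andP[].
have inT p : p \in psT -> p \in R by rewrite (perm_mem pT) mem_filter => /andP[].
pose As : seq {set 'I_n} := [seq trace i f p.2 | p <- psS].
pose Bs : seq {set 'I_n} := [seq trace i id p.1 | p <- psT].
apply: (@within_bind_eq _ _ _ _ ((As != [::]) && (head w2 As \subset w1)) 2);
  [| by clear -nn n0; lia |].
  rewrite /As; case: (psS) goodSs inS => [_ _|p ps goodSs inS]; first exact: within_ret.
  have [_ [[ut _ uv] /andP[ip _]]] := goodSs p (mem_head _ _).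
  have [_ _ bu _ _] := RP (inS p (mem_head _ _)).
  apply: within_weaken; [exact: within_above | by [] |] => _ <-.
  rewrite leTP u0t /= eq_sym -uv.
  exact: (esym (below_parentE (g := id) idI (leavesT G) u0t sibT ut bu ip)).
apply: (@within_bind_eq _ _ _ _ ((Bs != [::]) && (head w1 Bs \subset w2)) 2);
  [| by clear -nn n0; lia |].
  rewrite /Bs; case: (psT) goodTs inT => [_ _|p ps goodTs inT]; first exact: within_ret.
  have [_ [[_ vs uv] /andP[_ ip]]] := goodTs p (mem_head _ _).
  have [_ _ _ bv _] := RP (inT p (mem_head _ _)).
  apply: within_weaken; [exact: within_above | by [] |] => _ <-.
  rewrite leSP v0s /= eq_sym uv.
  exact: (esym (below_parentE fI (leavesS G) v0s sibS vs bv ip)).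
have tA : ~~ ((As != [::]) && (head w2 As \subset w1)) ->
    As = [::] \/ ~~ (head w2 As \subset w1).
  by rewrite negb_and negbK => /orP[/eqP|]; [left | right].
have tB : ~~ ((Bs != [::]) && (head w1 Bs \subset w2)) ->
    Bs = [::] \/ ~~ (head w1 Bs \subset w2).
  by rewrite negb_and negbK => /orP[/eqP|]; [left | right].
have caseC : As = [::] \/ ~~ (head w2 As \subset w1) ->
    Bs = [::] \/ ~~ (head w1 Bs \subset w2) ->
    within (caseC f i js leT leS u0 v0 psS psT XY) (500 * n ^ 2) optimal.
  by move=> topS topT; apply: within_caseC.
have caseB vm : Bs != [::] -> head w1 Bs \subset w2 -> vm \in vertices S ->
    trace i f vm = head w1 Bs ->
    within (caseB f i js leT leS u0 v0 vm psT XY) (500 * n ^ 2) optimal.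
  move=> B0 top vms vmE; have HB := within_caseB OB goodTs szS szT eXY B0 top vms vmE.
  apply: (within_weaken HB) => //.
  by clear; lia.
have caseA um : As != [::] -> head w2 As \subset w1 -> um \in vertices T ->
    trace i id um = head w2 As ->
    within (caseA f i js leT leS u0 v0 um psS XY) (500 * n ^ 2) optimal.
  move=> A0 top umt umE; have HA := within_caseA OA goodSs szS szT eXY A0 top umt umE.
  apply: (within_weaken HA) => //.
  by clear; lia.
apply: (within_weaken (k := 500 * n ^ 2) (P := optimal)) => //; last by clear -nn n0; lia.
rewrite /As /Bs in caseA caseB caseC tA tB *.
case: ifPn => [/andP[A0 topA]|/tA topA].
  case: psS A0 topA {pS srtS OA szS As tA caseC} caseA goodSs inS => // p ps A0 topA caseA goodSs inS.
  have [_ [[ut _ uv] _]] := goodSs p (mem_head _ _).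
  exact: caseA.
case: ifPn => [/andP[B0 topB]|/tB topB].
  case: psT B0 topB {pT srtT OB szT Bs tB caseC} caseB goodTs inT => // p ps B0 topB caseB goodTs inT.
  have [_ [[_ vs uv] _]] := goodTs p (mem_head _ _).
  by case: (psS) => *; apply: caseB.
by move: (caseC topA topB); case: (psS); case: (psT).
Qed.

End Step2.

(** * The list of common clusters *)

Section Reduce.
Variables (n : nat) (i : 'I_n) (g : 'I_n -> 'I_n) (t : tree 'I_n).
Hypotheses (gI : injective g) (tE : perm_eq (leaves t) (enum 'I_n)).
Implicit Types (u v : tree 'I_n).

Lemma card_trace u : u \in vertices t ->
  #|trace i g u| = count (fun b => b != g i) (leaves u).
Proof.
move=> ut; rewrite -(card_imset _ gI) -size_filter.
have U : uniq (filter (fun b => b != g i) (leaves u)).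
  by rewrite filter_uniq // (leaves_uniq ut (leaves_tree_uniq tE)).
rewrite -(card_uniqP U); apply: eq_card => b; rewrite mem_filter.
have [g' gK Kg] := injF_bij gI.
apply/imsetP/andP => [[j]|[bi bu]].
  by rewrite in_trace => /andP[ju ji] ->; rewrite (inj_eq gI).
by exists (g' b); rewrite ?in_trace Kg // bu; apply: contraNneq bi => <-; rewrite Kg.
Qed.

Variable c : tree 'I_n -> nat.
Hypothesis cE : {in vertices t, forall u, c u = #|trace i g u|}.

(** The count of a vertex is the size of its trace, so the descent keeps the trace
    and stops where both children have a smaller one. *)
Lemma within_reduce u : u \in vertices t -> 1 < c u ->
  within (reduce c u) (4 * size (leaves u)) (fun v =>
    [/\ v \in vertices t, branching i g v & trace i g v = trace i g u]).
Proof.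
elim: u => [a|u1 IH1 u2 IH2] ut c1 /=.
  by move: c1; rewrite cE // card_trace //=; case: (a != g i).
have u1t := vertices_childl ut; have u2t := vertices_childr ut.
have := size_leaves_gt0 u1; have := size_leaves_gt0 u2; rewrite size_cat.
set s1 := size (leaves u1); set s2 := size (leaves u2) => s20 s10.
have n1 := trace_mono i g (_ : u1 \in vertices (Node u1 u2)).
have n2 := trace_mono i g (_ : u2 \in vertices (Node u1 u2)).
have {}n1 : trace i g u1 \subset trace i g (Node u1 u2).
  by apply: n1; rewrite vertices_Node vertices_refl orbT.
have {}n2 : trace i g u2 \subset trace i g (Node u1 u2).
  by apply: n2; rewrite vertices_Node vertices_refl !orbT.
have cU : #|trace i g (Node u1 u2)| = #|trace i g u1| + #|trace i g u2|.
  by rewrite !card_trace //= count_cat.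
apply: within_call; first by clear -s10; lia.
do 3!(apply: (within_bind_eq (within_read c _)); first by clear -s10 s20; lia).
case: eqP => [E|N1].
  have tr : trace i g u1 = trace i g (Node u1 u2).
    by apply/eqP; rewrite eqEcard n1 -!cE // E leqnn.
  rewrite -tr; apply: within_weaken (IH1 u1t _) _ _ => //; first by rewrite E.
  by clear -s20; rewrite -/s1; lia.
case: eqP => [E|N2].
  have tr : trace i g u2 = trace i g (Node u1 u2).
    by apply/eqP; rewrite eqEcard n2 -!cE // E leqnn.
  rewrite -tr; apply: within_weaken (IH2 u2t _) _ _ => //; first by rewrite E.
  by clear -s10; rewrite -/s2; lia.
apply: within_ret; split=> //; exists u1, u2; split=> //; apply/set0Pn.
  by apply/negP => /eqP z; apply: N2; rewrite !cE // cU z cards0.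
by apply/negP => /eqP z; apply: N1; rewrite !cE // cU z cards0 addn0.
Qed.

End Reduce.

Section ReducedPairs.
Variables (n : nat) (G : tanglegram n) (i : 'I_n).
Let T := treeT G.
Let S := treeS G.
Let f := phi G.
Let fI : injective f := @perm_inj _ f.
Let idI : injective (@id 'I_n) := @inj_id _.
Let n0 : 0 < n := leq_ltn_trans (leq0n i) (ltn_ord i).

Definition branching_pair (p : vpair n) : Prop :=
  [/\ p.1 \in vertices T, p.2 \in vertices S, branching i id p.1,
      branching i f p.2 & trace i id p.1 = trace i f p.2].

(** Reducing does not change the traces; the recorded pairs are compared after the
    reduction, when they are determined by their traces. *)
Lemma within_reduced_pairs (L : seq (vpair n)) : size L <= 2 * n ->
  {in L, forall p, pairing G i p} ->
  (forall C, common (clusters id T) (clusters f S) [set~ i] C -> 1 < #|C| ->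
     exists2 p, p \in L & trace i id p.1 = C) ->
  within (reduced_pairs T S f i L) (80 * n ^ 2) (fun R =>
    [/\ {in R, forall p, branching_pair p},
        forall C, common (clusters id T) (clusters f S) [set~ i] C -> 1 < #|C| ->
          exists2 p, p \in R & trace i id p.1 = C,
        uniq R & size R <= 2 * n]).
Proof.
move=> sL LP LC; rewrite /reduced_pairs.
have nn : n <= n ^ 2 by rewrite -[n in n <= _]expn1 leq_pexp2l.
have sT := size_leaves (leavesT G); have sS := size_leaves (leavesS G).
apply: (within_bind (within_count_table i sT)); first by clear -nn; lia.
move=> cT cTP; apply: (within_bind_eq (within_read f i)); first by clear -nn n0; lia.
apply: (within_bind (within_count_table (f i) sS)); first by clear -nn n0; lia.
move=> cS cSP.
have cTE : {in vertices T, forall u, cT u = #|trace i id u|}.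
  by move=> u ut; rewrite cTP // (card_trace i idI (leavesT G)).
have cSE : {in vertices S, forall u, cS u = #|trace i f u|}.
  by move=> u us; rewrite cSP // (card_trace i fI (leavesS G)).
have sub (t u : tree 'I_n) : size (leaves t) = n -> u \in vertices t -> size (leaves u) <= size (leaves t).
  by move=> _ /vertices_size[->|/ltnW].
pose Inv (p : seq (vpair n)) (R : seq (vpair n)) :=
  [/\ {in R, forall q, branching_pair q}, uniq R, size R <= size p &
      {in p, forall q, 1 < #|trace i id q.1| ->
         exists2 r, r \in R & trace i id r.1 = trace i id q.1}].
apply: within_weaken; [apply: (within_lfold (A := vpair n) (k := 24 * n) (Inv := Inv)) | | ].
- by split.
- move=> p [u v] s R LE [RP RU RS RC].
  have uvL : (u, v) \in L by rewrite LE mem_cat mem_head orbT.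
  have [/= ut vs uv] := LP _ uvL.
  have su := sub T u sT ut; have sv := sub S v sS vs.
  have sR : size R <= 2 * n.
    apply: leq_trans RS (leq_trans _ sL); rewrite LE size_cat leq_addr //.
  apply: (within_bind_eq (within_read cT u)); first by clear -n0; lia.
  apply: (within_bind_eq (within_read cS v)); first by clear -n0; lia.
  rewrite cTE // cSE // -uv eqxx /=; case: ifP => [big|small]; last first.
    apply: within_ret; split=> //.
      by apply: leq_trans RS _; rewrite size_rcons.
    by move=> q; rewrite mem_rcons inE => /predU1P[->|/RC]; rewrite //= small.
  apply: (within_bind (within_reduce idI (leavesT G) cTE ut (_ : 1 < cT u))).
  + by rewrite cTE.
  + by move: su; rewrite sT; clear -n0; lia.
  move=> u' [ut' bu' uu'].
  apply: (within_bind (within_reduce fI (leavesS G) cSE vs (_ : 1 < cS v))).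
  + by rewrite cSE // -uv.
  + by move: su sv; rewrite sT sS; clear -n0; lia.
  move=> v' [vs' bv' vv'].
  apply: (within_bind_eq (v := has (fun q => (q.1 == u') && (q.2 == v')) R)).
  + apply: (within_lhas (k := 2)) => q _.
    do 2!(apply: within_bind_eq; [exact: within_same | by [] |]).
    exact: within_ret.
  + by move: su sv sR; rewrite sT sS; set m := size R; clear -n0; lia.
  apply: within_ret; case: ifPn => [/hasP[r rR /andP[/eqP r1 /eqP r2]]|nR].
    split=> //; first by apply: leq_trans RS _; rewrite size_rcons.
    move=> q; rewrite mem_rcons inE => /predU1P[->|/RC//] _.
    by exists r; rewrite // r1 uu'.
  split=> //.
  + move=> q; rewrite inE => /predU1P[->|/RP//]; split=> //=.
    by rewrite uu' uv vv'.
  + rewrite /= RU andbT; apply: contra nR => uvR.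
    by apply/hasP; exists (u', v'); rewrite //= !eqxx.
  + by rewrite /= size_rcons ltnS.
  move=> q; rewrite mem_rcons inE => /predU1P[-> _|/RC H /H[r rR rE]].
    by exists (u', v'); rewrite ?mem_head.
  by exists r; rewrite // inE rR orbT.
- apply: leq_trans (_ : (2 * n * (24 * n).+1).+1 <= _); first by rewrite ltnS leq_mul2r sL orbT.
  by clear -nn n0; lia.
move=> R [RP RU RS RC]; split=> //; last exact: leq_trans RS sL.
move=> C CC C1; have [p pL pC] := LC C CC C1.
by have [|r rR rE] := RC p pL; [rewrite pC | exists r; rewrite // rE].
Qed.

End ReducedPairs.

(** * The steps of the untangling loop *)

Section Untangle.
Variables (n : nat) (G : tanglegram n) (i : 'I_n).
Let T := treeT G.
Let S := treeS G.
Let f := phi G.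
Let fI : injective f := @perm_inj _ f.
Let n0 : 0 < n := leq_ltn_trans (leq0n i) (ltn_ord i).
Notation vertex := (tree 'I_n).
Implicit Types (u v w x y b : tree 'I_n) (e : vpair n) (E L : seq (vpair n)).

(** The two trees are treated alike, so they are indexed by the side. *)
Definition side_label (side : bool) : 'I_n -> 'I_n := if side then id else f.
Definition side_tree (side : bool) : vertex := if side then T else S.
Definition side_trace (side : bool) u : {set 'I_n} := trace i (side_label side) u.

Lemma side_label_inj side : injective (side_label side).
Proof. by case: side => // x y /fI. Qed.

Lemma side_leaves side : perm_eq (leaves (side_tree side)) (enum 'I_n).
Proof. by case: side; [exact: leavesT | exact: leavesS]. Qed.

Lemma side_uniq side : uniq (leaves (side_tree side)).
Proof. exact: leaves_tree_uniq (side_leaves side). Qed.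

Lemma side_size side : size (leaves (side_tree side)) = n.
Proof. exact: size_leaves (side_leaves side). Qed.

(** Some edge other than i joins the two vertices. *)
Definition linked e : bool := ~~ [disjoint side_trace true e.1 & side_trace false e.2].

Lemma orientK side : involutive (@orient n side).
Proof. by case: side => -[]. Qed.

Lemma linked_orient side u b :
  linked (orient side (u, b)) = ~~ [disjoint side_trace side u & side_trace (~~ side) b].
Proof. by case: side; rewrite /linked //= disjoint_sym. Qed.

Lemma linkedP side u b :
  reflect (exists2 j, j \in side_trace side u & j \in side_trace (~~ side) b)
    (linked (orient side (u, b))).
Proof.
rewrite linked_orient; apply: (iffP pred0Pn) => [[j /andP[ju jb]]|[j ju jb]].
  by exists j.
by exists j; apply/andP.
Qed.

Lemma side_trace_Node side u1 u2 :
  side_trace side (Node u1 u2) = side_trace side u1 :|: side_trace side u2.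
Proof. by rewrite /side_trace /trace cluster_Node setIUl. Qed.

Lemma linked_Node side u1 u2 b : linked (orient side (Node u1 u2, b)) =
  linked (orient side (u1, b)) || linked (orient side (u2, b)).
Proof.
rewrite !linked_orient side_trace_Node; apply/pred0Pn/orP.
  move=> [j /andP[/= ju jb]]; move: ju; rewrite inE => /orP[] ju; [left|right];
  by apply/pred0Pn; exists j; apply/andP.
by case=> /pred0Pn[j /andP[ju jb]]; exists j; apply/andP; split; rewrite //= inE;
  apply/orP; [left | right].
Qed.

Definition table_ok (B : vpair n -> bool) : Prop :=
  forall u v, u \in vertices T -> v \in vertices S -> B (u, v) = linked (u, v).

Lemma within_untangle_table :
  within (untangle_table T S f i) (40 * n ^ 2) table_ok.
Proof.
have nn : n <= n ^ 2 by rewrite -[n in n <= _]expn1 leq_pexp2l.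
have pT := size_postorder T; have pS := size_postorder S.
have sT := side_size true; have sS := side_size false.
rewrite /= in sT sS; rewrite sT in pT; rewrite sS in pS.
have nv2 : nv n * nv n <= 4 * n ^ 2 by rewrite /nv; clear -n0; nia.
rewrite /untangle_table.
apply: within_bind_eq; [exact: within_new_table | by clear -nv2; lia |].
apply: (within_bind_eq (within_postorder T)); first by rewrite sT; clear -nv2 nn; lia.
apply: (within_bind_eq (within_postorder S)); first by rewrite sT sS; clear -nv2 nn; lia.
pose Inv (p : seq vertex) (B : vpair n -> bool) :=
  forall u v, u \in vertices T -> v \in p -> B (u, v) = linked (u, v).
apply: within_weaken; [apply: (within_lfold (A := vertex) (k := 8 * n + 1) (Inv := Inv)) | | ].
- by [].
- move=> p v s B pE IB.
  pose Jnv (q : seq vertex) (B : vpair n -> bool) :=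
    Inv p B /\ forall u, u \in q -> B (u, v) = linked (u, v).
  apply: within_weaken; [apply: (within_lfold (A := vertex) (k := 3) (Inv := Jnv)) | | ].
  + by split.
  + move=> q u r B' qE [IB' JB'].
    have ut : u \in vertices T by rewrite -mem_postorder qE mem_cat mem_head orbT.
    apply: (@within_bind_eq _ _ _ _ (linked (u, v)) 2); last 2 first.
    * by [].
    * apply: within_weaken (within_write _ _ _) _ _ => // _ <-; split.
        move=> u' v' ut' vp; case: eqP => [[-> ->]//|_]; exact: IB'.
      move=> u'; rewrite mem_rcons inE xpair_eqE eqxx andbT.
      by case: eqP => [->|_ /JB'].
    * case: u ut qE => [j|u1 u2] ut qE.
        case: v pE @Jnv JB' => [k|v1 v2] pE Jnv JB'.
          apply: (within_bind_eq (within_read _ _)); first by [].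
          apply: within_ret.
          have LP : reflect (exists2 x, x \in side_trace true (Leaf j) & x \in side_trace false (Leaf k))
            (linked (Leaf j, Leaf k)) := linkedP true (Leaf j) (Leaf k).
          symmetry; apply/idP/LP => [/andP[ji /eqP fk]|[j']].
            by exists j; rewrite /side_trace !in_trace /= !inE ?ji ?andbT //; apply/eqP.
          rewrite /side_trace !in_trace /= !inE => /andP[/eqP-> ji] /andP[/eqP<- _].
          by rewrite ji eqxx.
        have [v1p v2p] := postorder_children pE.
        do 2!(apply: (within_bind_eq (within_read _ _)); first by []).
        by apply: within_ret; rewrite !IB' // -(linked_Node false).
      have [u1q u2q] := postorder_children qE.
      suff H : within (let* b1 := read B' (u1, v) in
          let* b2 := read B' (u2, v) in ret (b1 || b2)) 2 (eq (linked (Node u1 u2, v))).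
        by case: (v) H.
      do 2!(apply: (within_bind_eq (within_read _ _)); first by []).
      by apply: within_ret; rewrite !JB' // -(linked_Node true).
  + by move: pT; clear -n0; lia.
  move=> B' [IB' JB'] u w ut; rewrite mem_rcons inE => /predU1P[->|]; last exact: IB'.
  by apply: JB'; rewrite mem_postorder.
- apply: leq_trans (_ : (2 * n * (8 * n + 2)).+1 <= _).
    by rewrite ltnS leq_mul //; [move: pS; clear; lia | clear; lia].
  by rewrite sT sS; move: nv2; set a := nv n * nv n; clear -nn n0; lia.
by move=> B IB u v ut vs; apply: IB; rewrite ?mem_postorder.
Qed.

(** * The vertices of highest degree *)

Definition internal u : bool := if u is Node _ _ then true else false.

Definition degree E (su : bool * vertex) : nat :=
  count (fun e => (orient su.1 e).1 == su.2) E.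

(** The last clause makes the first internal vertex enter the list even if its
    degree is 0: it then ties with the initial maximum. *)
Definition best_of E (P : seq (bool * vertex)) (r : nat * seq (bool * vertex)) : Prop :=
  [/\ forall su, su \in r.2 -> [/\ su \in P, internal su.2 & degree E su = r.1],
      forall su, su \in P -> internal su.2 -> degree E su <= r.1 /\ r.2 != [::],
      size r.2 <= size P & r.2 = [::] -> r.1 = 0].

Lemma best_of_scan E P r su : best_of E P r -> best_of E (rcons P su)
  (if ~~ internal su.2 then r else
   if r.1 < degree E su then (degree E su, [:: su])
   else if degree E su == r.1 then (r.1, su :: r.2) else r).
Proof.
case: r => m l [/= H1 H2 H3 H4].
have inP su' : su' \in P -> su' \in rcons P su.
  by rewrite mem_rcons inE => ->; rewrite orbT.
case: ifPn => [/negbTE ni|/negbNE int].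
  split=> /=; rewrite ?size_rcons //; last exact: leqW.
    by move=> su' /H1[/inP].
  by move=> su'; rewrite mem_rcons inE => /predU1P[->|/H2//]; rewrite ni.
case: ltnP => [lt|le].
  split=> /=; rewrite ?size_rcons //.
    by move=> su'; rewrite mem_seq1 => /eqP->; rewrite mem_rcons mem_head.
  move=> su'; rewrite mem_rcons inE => /predU1P[->//|/H2 K /K[le _]]; split=> //.
  exact: leq_trans le (ltnW lt).
case: eqP => [E1|ne].
  split=> /=; rewrite ?size_rcons //.
    by move=> su'; rewrite inE => /predU1P[->|/H1[/inP//]]; rewrite mem_rcons mem_head.
  by move=> su'; rewrite mem_rcons inE => /predU1P[->|/H2 K /K[]].
split=> /=; rewrite ?size_rcons //; last exact: leqW.
  by move=> su' /H1[/inP].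
move=> su'; rewrite mem_rcons inE => /predU1P[->|/H2//]; split=> //.
by apply/eqP => l0; apply: ne; move: le; rewrite H4 // leqn0 => /eqP.
Qed.

Definition sided (X Y : seq vertex) : seq (bool * vertex) :=
  [seq (true, u) | u <- X] ++ [seq (false, u) | u <- Y].

Lemma within_highest_internal X Y E : size E <= 2 * n -> size X <= n -> size Y <= n ->
  within (highest_internal X Y E) (24 * n) (best_of E (sided X Y)).
Proof.
move=> sE sX sY; rewrite /highest_internal.
apply: within_bind_eq; [exact: within_new_table | by rewrite /nv; clear; lia |].
apply: within_bind_eq; [exact: within_new_table | by rewrite /nv; clear; lia |].
pose Inv (p : seq (vpair n)) (d : (vertex -> nat) * (vertex -> nat)) :=
  (forall u, d.1 u = degree p (true, u)) /\ (forall u, d.2 u = degree p (false, u)).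
apply: (within_bind (within_lfold (A := vpair n) (k := 4) (Inv := Inv) _ _)).
- by split.
- move=> p [u v] s [dT dS] _ [/= H1 H2].
  do 4!(apply: within_bind_eq; [exact: within_read || exact: within_write | by [] |]).
  apply: within_ret; split=> w /=; rewrite /degree -cats1 count_cat /= ?H1 ?H2 eq_sym.
    by case: eqP => [->|_]; rewrite ?addn0 ?addn1.
  by case: eqP => [->|_]; rewrite ?addn0 ?addn1.
- by rewrite /nv; move: sE; set m := size E; clear -n0; lia.
move=> [dT dS] [H1 H2].
have scanP side (d : vertex -> nat) (Z : seq vertex) (P : seq (bool * vertex)) r :
    (forall u, d u = degree E (side, u)) -> best_of E P r -> size Z <= n ->
    within (lfold (fun best u => if u is Leaf _ then ret best else
      let: (m, l) := best in
      let* d := read d u in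
      ret (if m < d then (d, [:: (side, u)])
           else if d == m then (m, (side, u) :: l) else best)) r Z) (2 * n + 1)
      (best_of E (P ++ [seq (side, u) | u <- Z])).
  move=> dE bP sZ.
  pose Jnv (q : seq vertex) r := best_of E (P ++ [seq (side, u) | u <- q]) r.
  apply: within_weaken; [apply: (within_lfold (A := vertex) (k := 1) (Inv := Jnv)) | | by []].
  - by rewrite /Jnv cats0.
  - move=> q u s r' _ Jq.
    have := best_of_scan (side, u) Jq; rewrite rcons_cat -map_rcons => J'.
    case: u J' => [a|u1 u2] J'; first exact: within_ret.
    case: r' Jq J' => m l Jq J'.
    apply: (within_bind_eq (within_read _ _)); first by [].
    by apply: within_ret; rewrite dE.
  - by move: sZ; set m := size Z; clear; lia.
have b0 : best_of E [::] (0, [::]) by split.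
apply: (within_bind (scanP true dT X _ _ H1 b0 sX)).
  by rewrite /nv; move: sE; set m := size E; clear -n0; lia.
move=> best bX; apply: within_weaken (scanP false dS Y _ _ H2 bX sY) _ _ => //.
by rewrite /nv; move: sE; set m := size E; clear -n0; lia.
Qed.

End Untangle.

(** * Refining a vertex *)

Section Refine.
Variables (n : nat) (G : tanglegram n) (i : 'I_n).
Notation vertex := (tree 'I_n).
Notation linked := (linked G i).
Variables (side : bool) (A Bl p s : seq (tree 'I_n)) (u1 u2 : tree 'I_n).
Variables (E : seq (vpair n)) (B : vpair n -> bool).
Let u := Node u1 u2.
Hypotheses (BP : table_ok G i B) (AE : A = p ++ u :: s).
Hypotheses (UA : uniq A) (UB : uniq Bl) (u1A : u1 \notin A) (u2A : u2 \notin A).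
Hypothesis u12 : u1 != u2.
Hypothesis At : {subset A <= vertices (side_tree G side)}.
Hypothesis Bt : {subset Bl <= vertices (side_tree G (~~ side))}.
Hypothesis UE : uniq E.
Hypothesis EE : forall c b, (orient side (c, b) \in E) =
  [&& c \in A, b \in Bl & linked (orient side (c, b))].
Hypotheses (sE : size E <= 2 * n) (sA : size A <= n) (sB : size Bl <= n).
Let n0 : 0 < n := leq_ltn_trans (leq0n i) (ltn_ord i).

Let oE (c b c' b' : vertex) :
  (orient side (c, b) == orient side (c', b')) = (c == c') && (b == b').
Proof. by rewrite (inj_eq (inv_inj (@orientK n side))). Qed.

Let uA : u \in A. Proof. by rewrite AE mem_cat mem_head orbT. Qed.

Let Blinked c b : c \in vertices (side_tree G side) -> b \in Bl ->
  B (orient side (c, b)) = linked (orient side (c, b)).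
Proof. by move=> ct bB; have := Bt bB; move: ct; case: side => /= ct bt; apply: BP. Qed.

Let u1t : u1 \in vertices (side_tree G side).
Proof. exact: vertices_childl (At uA). Qed.
Let u2t : u2 \in vertices (side_tree G side).
Proof. exact: vertices_childr (At uA). Qed.

(** The three outcomes of the comparison in Refine: the edges respect the order
    of the children, two edges contradict it, or u1 has no neighbour. *)
Definition ordered_children w1 w2 : Prop :=
  [\/ [/\ w1 = u1, w2 = u2 & {in Bl &, forall b1 b2,
         linked (orient side (u1, b1)) -> linked (orient side (u2, b2)) ->
         index b1 Bl <= index b2 Bl}],
      [/\ w1 = u2, w2 = u1 & exists b1 b2,
         [/\ b1 \in Bl, b2 \in Bl, linked (orient side (u1, b1)),
             linked (orient side (u2, b2)) & index b2 Bl < index b1 Bl]] |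
      {in Bl, forall b, ~~ linked (orient side (u1, b))} /\
      ((w1, w2) = (u1, u2) \/ (w1, w2) = (u2, u1))].

Lemma within_refine :
  within (refine B (side, u) (if side then A else Bl) (if side then Bl else A) E) (70 * n)
    (fun r => exists w1 w2 E', let A' := p ++ w1 :: w2 :: s in
      [/\ r = (if side then (A', Bl, E') else (Bl, A', E')), ordered_children w1 w2,
          uniq E' & forall c b, (orient side (c, b) \in E') =
            [&& c \in A', b \in Bl & linked (orient side (c, b))]]).
Proof.
rewrite /refine /u.
(* The edges of q away from u, and the links that the children of u take over. *)
pose Inv (q E' : seq (vpair n)) :=
  [/\ uniq E', size E' <= 2 * size q & forall c b, (orient side (c, b) \in E') =
    (orient side (c, b) \in q) && (c != u) ||
    [&& orient side (u, b) \in q, (c == u1) || (c == u2) & linked (orient side (c, b))]].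
apply: (within_bind (within_lfold (A := vpair n) (k := 3) (Inv := Inv) _ _)).
- by split.
- move=> q e r E' qE [U' s' H'].
  have qsub e' : e' \in q -> e' \in E by rewrite qE mem_cat => ->.
  have eE : e \in E by rewrite qE mem_cat mem_head orbT.
  have eq_ : e \notin q.
    by move: UE; rewrite qE cat_uniq => /and3P[_ /norP[]].
  case oe: (orient side e) => [x b0].
  have eO : e = orient side (x, b0) by rewrite -oe orientK.
  have b0B : b0 \in Bl by move: eE; rewrite eO EE => /and3P[].
  apply: within_bind_eq; [exact: within_same | by [] |].
  have [xu|xu] := eqVneq x u; last first.
    apply: within_ret; split.
    + rewrite /= U' andbT eO H' -eO (negPf eq_) /=.
      apply/negP => /and3P[_ xc _]; have xA : x \in A by move: eE; rewrite eO EE => /and3P[].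
      by case/orP: xc => /eqP xc; [move: u1A | move: u2A]; rewrite -xc xA.
    + by rewrite /= size_rcons; move: s'; clear; lia.
    move=> c b; rewrite inE H' !mem_rcons !inE eO !oE [u == x]eq_sym (negPf xu) /=.
    by case: eqP => [->|_] //=; rewrite xu; case: (b == b0).
  do 2!(apply: within_bind_eq; [exact: within_read | by [] |]).
  apply: within_ret; rewrite !Blinked //.
  have notE' c : c = u1 \/ c = u2 -> orient side (c, b0) \notin E'.
    move=> cu; rewrite H' -xu -eO (negPf eq_) orbF negb_and; apply/orP; left.
    apply/negP => /qsub; rewrite EE => /and3P[cA _ _].
    by case: cu cA => ->; [rewrite (negPf u1A) | rewrite (negPf u2A)].
  set E1 := if linked (orient side (u1, b0)) then _ else _.
  have UE1 : uniq E1.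
    by rewrite /E1; case: ifP => _ //=; rewrite U' andbT; apply: notE'; left.
  have sE1 : size E1 <= (size E').+1 by rewrite /E1; case: ifP.
  have mE1 c b : (orient side (c, b) \in E1) = (orient side (c, b) \in E') ||
      [&& c == u1, b == b0 & linked (orient side (c, b))].
    rewrite /E1; case: ifP => l1; last first.
      by case: eqP => [->|_]; rewrite ?orbF //=; case: eqP => [->|_]; rewrite ?l1 ?orbF.
    rewrite inE oE orbC; congr (_ || _).
    by case: eqP => //= ->; case: eqP => //= ->; rewrite l1.
  have nE1 : orient side (u2, b0) \notin E1.
    by rewrite mE1 negb_or notE'; [rewrite eq_sym (negPf u12) | right].
  set E2 := if linked (orient side (u2, b0)) then _ else _.
  have mE2 c b : (orient side (c, b) \in E2) = (orient side (c, b) \in E1) ||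
      [&& c == u2, b == b0 & linked (orient side (c, b))].
    rewrite /E2; case: ifP => l1; last first.
      by case: eqP => [->|_]; rewrite ?orbF //=; case: eqP => [->|_]; rewrite ?l1 ?orbF.
    rewrite inE oE orbC; congr (_ || _).
    by case: eqP => //= ->; case: eqP => //= ->; rewrite l1.
  split.
  + by rewrite /E2; case: ifP => _ //=; rewrite nE1.
  + have : size E2 <= (size E1).+1 by rewrite /E2; case: ifP.
    by rewrite size_rcons; clear -s' sE1; lia.
  move=> c b; rewrite mE2 mE1 H' !mem_rcons !inE eO xu !oE eqxx /=.
  case: (c == u); rewrite /= ?andbF ?orbF /=;
  case: (b == b0); case: (c == u1); case: (c == u2); case: (linked _);
    case: (orient side (c, b) \in q); case: (orient side (u, b) \in q) => //=.
- by move: sE; set m := size E; clear -n0; lia.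
move=> E' [U' s' H'].
have {}s' : size E' <= 4 * n by move: s' sE; set m := size E'; set m' := size E; clear; lia.
have mE' w1 w2 : (w1, w2) = (u1, u2) \/ (w1, w2) = (u2, u1) ->
    forall c b, (orient side (c, b) \in E') =
      [&& c \in p ++ w1 :: w2 :: s, b \in Bl & linked (orient side (c, b))].
  move=> w12 c b; have up : (u \notin p) && (u \notin s).
    by move: UA; rewrite AE cat_uniq /= => /and4P[_ /norP[-> _] -> _].
  have -> : (c \in p ++ w1 :: w2 :: s) = ((c == u1) || (c == u2)) || (c != u) && (c \in A).
    rewrite AE !mem_cat !inE; case/andP: up => up us.
    have [->|cu] := eqVneq c u; last first.
      by case: w12 => -[-> ->]; case: (c \in p); case: (c == u1); case: (c == u2);
         rewrite ?orbT.
    rewrite (negPf up) (negPf us) !orbF.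
    by case: w12 => -[-> ->]; case: (u == u1); case: (u == u2).
  have L1 : ((c == u1) || (c == u2)) && linked (orient side (c, b)) ==>
      linked (orient side (u, b)).
    by apply/implyP => /andP[/orP[]/eqP-> l]; rewrite (linked_Node G i side) l ?orbT.
  rewrite H' !EE uA; move: L1; case: (linked (orient side (u, b)));
    case: (linked (orient side (c, b))); case: (c \in A); case: (b \in Bl);
    case: ((c == u1) || (c == u2)); by case: (c == u).
have inE' c b : orient side (c, b) \in E' -> b \in Bl.
  by rewrite (mE' _ _ (or_introl erefl)) => /and3P[].
have in1 b : (orient side (u1, b) \in E') = (b \in Bl) && linked (orient side (u1, b)).
  by rewrite (mE' _ _ (or_introl erefl)) mem_cat mem_head orbT.
have in2 b : (orient side (u2, b) \in E') = (b \in Bl) && linked (orient side (u2, b)).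
  by rewrite (mE' _ _ (or_introl erefl)) mem_cat !inE eqxx !orbT.
have -> : (if side then if side then Bl else A else if side then A else Bl) = Bl by case: side.
have -> : (if side then if side then A else Bl else if side then Bl else A) = A by case: side.
have sposn : nv n + 2 * size Bl + 1 <= 4 * n + 1.
  by rewrite /nv; move: sB; set m := size Bl; clear; lia.
apply: (within_bind (within_weaken (within_positions (nv n) UB) sposn (fun _ H => H))).
  by move: sE; set m := size E; clear -n0; lia.
move=> pos posP.
pose Kinv (q : seq (vpair n)) (k : option nat) :=
  if k is Some k' then
    (exists2 b, orient side (u1, b) \in q & index b Bl = k') /\
    forall b, orient side (u1, b) \in q -> index b Bl <= k'
  else forall b, orient side (u1, b) \notin q.
have sfold : (size E' * 3).+1 <= 12 * n + 1 by move: s'; set m := size E'; clear; lia.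
apply: (within_bind (within_weaken (within_lfold (A := vpair n) (k := 2) (Inv := Kinv) (b := None) (l := E') _ _) sfold (fun _ H => H))).
- by [].
- move=> q e r k qE Kq; case oe: (orient side e) => [x b0].
  have eO : e = orient side (x, b0) by rewrite -oe orientK.
  have b0B : b0 \in Bl by apply: (inE' x); rewrite -eO qE mem_cat mem_head orbT.
  apply: within_bind_eq; [exact: within_same | by [] |].
  have [xu|xu] := eqVneq x u1; last first.
    apply: within_ret; case: k Kq => [k'|] /= => [[[b bq bk] H]|H].
      split; first by exists b; rewrite // mem_rcons inE bq orbT.
      by move=> b'; rewrite mem_rcons inE eO oE eq_sym (negPf xu) => /H.
    by move=> b; rewrite mem_rcons inE eO oE eq_sym (negPf xu) /= H.
  apply: within_bind_eq; [exact: within_read | by [] |].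
  rewrite (posP _ b0B); apply: within_ret.
  case: k Kq => [k'|] /= => [[[b bq bk] H]|H].
    split; last first.
      move=> b'; rewrite mem_rcons inE eO oE xu eqxx /= => /predU1P[->|/H].
        by rewrite leq_maxr.
      by move=> h; rewrite leq_max h.
    case: (leqP k' (index b0 Bl)) => _; last first.
      by exists b; rewrite // mem_rcons inE bq orbT.
    by exists b0; rewrite // eO xu mem_rcons mem_head.
  split; first by exists b0; rewrite // eO xu mem_rcons mem_head.
  move=> b'; rewrite mem_rcons inE eO oE xu eqxx /= => /predU1P[->//|].
  by rewrite (negPf (H _)).
- by move: sE; set m := size E; clear -n0; lia.
move=> k Kk.
apply: (@within_bind _ _ _ _ (12 * n + 1) _ (fun w => ordered_children w.1 w.2)).
- case: k Kk => [k'|] Kk; last first.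
    apply: (within_choose (A := (vertex * vertex)%type)) => //; first by rewrite /=; clear -n0; lia.
    have none : {in Bl, forall b, ~~ linked (orient side (u1, b))}.
      by move=> b bB; have := Kk b; rewrite in1 bB.
    move=> w; rewrite !inE => /orP[]/eqP->; constructor 3; split=> //; [left | right] => //.
  case: Kk => -[b1 b1E b1k] maxk.
  pose q e := let: (x, b) := orient side e in (x == u2) ==> (k' <= index b Bl).
  have allE : within (lall (fun e => let: (x, b) := orient side e in
      let* e2 := same x u2 in
      if e2 then let* j := read pos b in ret (k' <= j) else ret true) E') (12 * n + 1) (eq (all q E')).
    apply: within_weaken; [apply: (within_lall (k := 2) (q := q)) | exact: sfold | by []].
    move=> e eE'; rewrite /q; case oe: (orient side e) => [x b0].
    have b0B : b0 \in Bl by apply: (inE' x); rewrite -oe orientK.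
    apply: within_bind_eq; [exact: within_same | by [] |].
    case: eqP => _; last exact: within_ret.
    apply: within_bind_eq; [exact: within_read | by [] |].
    by rewrite (posP _ b0B); apply: within_ret.
  apply: (within_bind_eq allE); first by [].
  apply: within_ret; case: allP => [ord|/allP nord] /=.
    constructor 1; split=> // b b' bB b'B l l'.
    have bk : index b Bl <= k' by apply: maxk; rewrite in1 bB.
    apply: leq_trans bk _.
    have := ord (orient side (u2, b')); rewrite in2 b'B l' /q orientK eqxx; exact.
  constructor 2; split=> //.
  have [e eE'] := allPn nord; rewrite /q; case oe: (orient side e) => [x b2].
  rewrite negb_imply -ltnNge => /andP[/eqP xu lt].
  have := eE'; rewrite -[e](orientK side) oe xu in2 => /andP[b2B l2].
  by have := b1E; rewrite in1 => /andP[b1B l1]; exists b1, b2; rewrite b1k.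
- by move: sE; set m := size E; clear -n0; lia.
move=> [w1 w2] /= ord.
have w12 : (w1, w2) = (u1, u2) \/ (w1, w2) = (u2, u1).
  by case: ord => [[-> -> _]|[-> -> _]|[_ //]]; [left | right].
(* The list is rebuilt backwards, by pushing w1 and then w2, and reversed. *)
pose h x := if x == u then [:: w1; w2] else [:: x].
pose g (acc : seq vertex) x := if x == u then w2 :: w1 :: acc else x :: acc.
apply: (within_bind_eq (v := foldl g [::] A)).
- apply: (within_lfold_eq (A := Defs_tree__canonical__eqtype_Equality _) (k := 1)) => acc x _.
  by apply: within_bind_eq; [exact: within_same | by [] |]; exact: within_ret.
- by move: sE sA; set m := size E; set m' := size A; clear -n0; lia.
have gE acc : foldl g acc A = catrev (flatten (map h A)) acc.
  elim: (A) acc => //= x l IH acc; rewrite IH catrev_catl /g /h.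
  by case: eqP.
have gs : size (foldl g [::] A) <= 2 * n.
  rewrite gE -/(rev _) size_rev; apply: leq_trans (_ : 2 * size A <= _); last by rewrite leq_mul2l.
  elim: (A) => //= x l IH; rewrite size_cat mulnS; apply: leq_add IH.
  by rewrite /h; case: eqP.
apply: (within_bind_eq (within_lrev _)).
  by move: sE sA gs; set m := size E; set m' := size A; set m2 := size (foldl _ _ _); clear -n0; lia.
have -> : rev (foldl g [::] A) = p ++ w1 :: w2 :: s.
  rewrite gE -/(rev _) revK AE map_cat flatten_cat /= /h eqxx.
  have idl (l : seq vertex) : u \notin l -> flatten (map h l) = l.
    elim: l => //= x l IH; rewrite inE negb_or /h => /andP[ux ul].
    by rewrite eq_sym (negPf ux) /= IH.
  move: UA; rewrite AE cat_uniq /= => /and4P[_ /norP[up _] us _].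
  by rewrite -/h !idl.
apply: within_ret; exists w1, w2, E'; split=> //; [by case: (side) | exact: (mE' _ _ w12)].
Qed.

End Refine.

(** * Lists of vertices that stand for a partial layout *)

Lemma before_blocks (A : eqType) (p q1 q2 r : seq A) x y :
  uniq (p ++ (q1 ++ q2) ++ r) -> x \in q1 -> y \in q2 ->
  before (p ++ (q1 ++ q2) ++ r) x y.
Proof.
move=> U xq yq; have Uq : uniq (q1 ++ q2) by move: U; rewrite !cat_uniq => /and3P[_ _ /and3P[]].
rewrite (before_mid x y U (perm_refl _)) !mem_cat xq yq orbT /=.
have yq1 : y \notin q1.
  by move: Uq; rewrite cat_uniq => /and3P[_ /hasPn H _]; apply: H.
rewrite /before !index_cat xq (negPf yq1).
by apply: leq_trans (leq_addr _ _); rewrite index_mem.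
Qed.

Section Frontier.
Variables (n : nat) (t : tree 'I_n).
Hypothesis tE : perm_eq (leaves t) (enum 'I_n).
Notation vertex := (tree 'I_n).
Implicit Types (A : seq vertex) (u v x y : vertex).

Definition spread A : seq 'I_n := flatten [seq leaves x | x <- A].

Definition frontier A : Prop :=
  {subset A <= vertices t} /\ leaf_order (Some t) (spread A).

Lemma spread_cat A A' : spread (A ++ A') = spread A ++ spread A'.
Proof. by rewrite /spread map_cat flatten_cat. Qed.

Lemma spread_cons x A : spread (x :: A) = leaves x ++ spread A.
Proof. by []. Qed.

Lemma spreadP A j : reflect (exists2 x, x \in A & j \in leaves x) (j \in spread A).
Proof. exact: flatten_mapP. Qed.

Lemma frontier_cover A j : frontier A -> exists2 x, x \in A & j \in leaves x.
Proof. by move=> [_ L]; apply/spreadP; exact: (leaf_order_all tE j L). Qed.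

Lemma spread_disjoint A x y j : uniq (spread A) -> x \in A -> y \in A ->
  j \in leaves x -> j \in leaves y -> x = y.
Proof.
elim: A => //= z A IH; rewrite spread_cons cat_uniq => /and3P[_ /hasPn H U].
have out w : w \in A -> j \in leaves w -> j \notin leaves z.
  by move=> wA jw; apply: H; apply/spreadP; exists w.
rewrite !inE => /predU1P[->|xA] /predU1P[->|yA] // jx jy.
- by have := out _ yA jy; rewrite jx.
- by have := out _ xA jx; rewrite jy.
exact: IH.
Qed.

Lemma frontier_disjoint A x y j : frontier A -> x \in A -> y \in A ->
  j \in leaves x -> j \in leaves y -> x = y.
Proof. by move=> [_ L]; apply: spread_disjoint; exact: (leaf_order_uniq tE L). Qed.

Lemma spread_uniq A : uniq (spread A) -> uniq A.
Proof.
elim: A => //= z A IH; rewrite spread_cons cat_uniq => /and3P[_ /hasPn H U].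
rewrite IH // andbT; apply/negP => zA; have [j jz] := leaves_ex z.
have jA : j \in spread A by apply/spreadP; exists z.
by have := H j jA; rewrite /= jz.
Qed.

Lemma frontier_uniq A : frontier A -> uniq A.
Proof. by move=> [_ L]; apply: spread_uniq; exact: (leaf_order_uniq tE L). Qed.

Lemma size_spread A : size A <= size (spread A).
Proof.
elim: A => //= x A IH; rewrite spread_cons size_cat -add1n.
exact: leq_add (size_leaves_gt0 x) IH.
Qed.

Lemma frontier_size A : frontier A -> size A <= n.
Proof. by move=> [_ L]; apply: leq_trans (size_spread A) _; rewrite (leaf_order_size tE L). Qed.

Lemma frontier_size_lt A u1 u2 : frontier A -> Node u1 u2 \in A -> size A < n.
Proof.
move=> [_ L] uA; apply: leq_trans (_ : size (spread A) <= n); last first.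
  by rewrite (leaf_order_size tE L).
elim: A {L} uA => //= x A IH.
rewrite inE spread_cons size_cat => /predU1P[<-|/IH lt]; last first.
  by rewrite -[(size A).+2]/(1 + (size A).+1); apply: leq_add (size_leaves_gt0 x) lt.
rewrite -[(size A).+2]/(2 + size A); apply: leq_add (size_spread A).
by have := size_leaves_gt0 u1; have := size_leaves_gt0 u2; rewrite /= size_cat; lia.
Qed.

Lemma frontier_root : frontier [:: t].
Proof.
split=> [x|]; first by rewrite mem_seq1 => /eqP->; apply: vertices_refl.
rewrite /spread /= cats0; split=> // w wt.
suff [p [r E]] : exists p r, leaves t = p ++ leaves w ++ r by exists p, (leaves w), r.
elim: (t) wt => [a|t1 IH1 t2 IH2] /=; first by rewrite inE => /eqP->; exists [::], [::].
rewrite inE mem_cat => /or3P[/eqP->|/IH1[p [r ->]]|/IH2[p [r ->]]].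
- by exists [::], [::]; rewrite cats0.
- by exists p, (r ++ leaves t2); rewrite -!catA.
by exists (leaves t1 ++ p), r; rewrite -!catA.
Qed.

Variables (p s : seq vertex) (u1 u2 : vertex).
Let A := p ++ Node u1 u2 :: s.
Hypothesis fA : frontier A.
Let U : uniq (spread A) := leaf_order_uniq tE fA.2.

Lemma spread_node : spread A = spread p ++ (leaves u1 ++ leaves u2) ++ spread s.
Proof. by rewrite spread_cat spread_cons. Qed.

Lemma spread_children w1 w2 : spread (p ++ w1 :: w2 :: s) =
  spread p ++ (leaves w1 ++ leaves w2) ++ spread s.
Proof. by rewrite spread_cat !spread_cons -(catA (leaves w1)). Qed.

Let ut : Node u1 u2 \in vertices t.
Proof. by apply: fA.1; rewrite mem_cat mem_head orbT. Qed.

Lemma children_disjoint j : j \in leaves u1 -> j \notin leaves u2.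
Proof. by apply: leaves_disjoint; apply: leaves_uniq ut (leaves_tree_uniq tE). Qed.

Lemma child_notin c : c = u1 \/ c = u2 -> c \notin A.
Proof.
move=> cu; apply/negP => cA; have [j jc] := leaves_ex c.
have cE : c = Node u1 u2.
  apply: (frontier_disjoint (j := j) fA cA) => //; first by rewrite mem_cat mem_head orbT.
  by rewrite /= mem_cat; case: cu => <-; rewrite jc ?orbT.
have := congr1 (fun x => size (leaves x)) cE; rewrite /= size_cat.
by have := size_leaves_gt0 u1; have := size_leaves_gt0 u2; case: cu => ->; lia.
Qed.

Lemma before_children w1 w2 (x y : 'I_n) : (w1, w2) = (u1, u2) \/ (w1, w2) = (u2, u1) ->
  ~~ ((x \in leaves u1) && (y \in leaves u2) || (x \in leaves u2) && (y \in leaves u1)) ->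
  before (spread (p ++ w1 :: w2 :: s)) x y = before (spread A) x y.
Proof.
move=> w12 N; rewrite spread_children spread_node.
case: w12 => -[-> ->] //; rewrite before_switch -?spread_node //.
by rewrite (negPf N) addbF.
Qed.

Lemma before_child_order w1 w2 (x y : 'I_n) : (w1, w2) = (u1, u2) \/ (w1, w2) = (u2, u1) ->
  x \in leaves u1 -> y \in leaves u2 ->
  before (spread (p ++ w1 :: w2 :: s)) x y = (w1 == u1).
Proof.
have u12 : u2 != u1.
  have [j j1] := leaves_ex u1; apply: contraTneq (children_disjoint j1) => ->.
  by rewrite j1.
have U' := U; rewrite spread_node in U'.
move=> w12 x1 y2; rewrite spread_children.
case: w12 => -[-> ->]; first by rewrite eqxx; apply: before_blocks.
rewrite before_switch // before_blocks // x1 y2 /=; exact/esym/negbTE.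
Qed.

Lemma frontier_children w1 w2 : (w1, w2) = (u1, u2) \/ (w1, w2) = (u2, u1) ->
  frontier (p ++ w1 :: w2 :: s).
Proof.
move=> w12; have [sub L] := fA; split.
  move=> x; rewrite mem_cat !inE => xA.
  have : [|| x == u1, x == u2 | x \in A].
    move: xA; rewrite mem_cat inE.
    by case: w12 => -[-> ->] /or4P[] ->; rewrite ?orbT.
  case/or3P => [/eqP->|/eqP->|/sub //].
    exact: vertices_childl ut.
  exact: vertices_childr ut.
case: w12 => -[-> ->]; first by rewrite spread_children -spread_node.
have B (x y : 'I_n) : x != y -> before (spread (p ++ u2 :: u1 :: s)) x y = before (spread A) x y (+)
    ((x \in leaves u1) && (y \in leaves u2) || (x \in leaves u2) && (y \in leaves u1)).
  by move=> _; rewrite spread_children spread_node before_switch -?spread_node.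
apply: (leaf_order_invert tE L _ B); last exact: (children_congruent tE ut).
by rewrite spread_children spread_node perm_cat2l perm_cat2r perm_catC.
Qed.

End Frontier.

(** * A planar order that survives the refinements *)

Section Consistent.
Variables (n : nat) (G : tanglegram n) (i : 'I_n).
Notation vertex := (tree 'I_n).
Notation lbl := (side_label G).
Notation tre := (side_tree G).
Notation tr := (side_trace G i).
Notation linked := (linked G i).
Let D : {set 'I_n} := [set~ i].
Implicit Types (side : bool) (A Bl : seq vertex) (o : rel 'I_n) (a b j : 'I_n).

(** A planar layout of the other edges, seen as an order on them. *)
Definition planar_order o : Prop :=
  (forall a b, a \in D -> b \in D -> a != b -> o b a = ~~ o a b) /\
  (forall side, congruent (clusters (lbl side) (tre side)) D o).

(** Inside the block of one entry nothing has been decided yet. *)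
Definition agrees side A o : Prop := forall a b, a \in D -> b \in D -> a != b ->
  {in A, forall x, ~~ ((a \in tr side x) && (b \in tr side x))} ->
  o a b = before (spread A) (lbl side a) (lbl side b).

Lemma in_tr side x j : (j \in tr side x) = (lbl side j \in leaves x) && (j != i).
Proof. exact: in_trace. Qed.

Lemma trD side x j : j \in tr side x -> j \in D.
Proof. by rewrite in_tr !inE => /andP[]. Qed.

Lemma tr_cover side A j : frontier (tre side) A -> j \in D ->
  exists2 x, x \in A & j \in tr side x.
Proof.
move=> fA; rewrite !inE => ji.
have [x xA jx] := frontier_cover (side_leaves G side) (lbl side j) fA.
by exists x; rewrite // in_tr jx.
Qed.

Lemma tr_disjoint side A x y j : frontier (tre side) A -> x \in A -> y \in A ->
  j \in tr side x -> j \in tr side y -> x = y.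
Proof.
rewrite !in_tr => fA xA yA /andP[jx _] /andP[jy _].
exact: (frontier_disjoint (side_leaves G side) fA xA yA jx jy).
Qed.

Lemma tr_ex side u1 u2 : Node u1 u2 \in vertices (tre side) ->
  exists j, j \in tr side (Node u1 u2).
Proof.
move=> ut; have [j1 h1] := leaves_ex u1; have [j2 h2] := leaves_ex u2.
have [g gK Kg] := injF_bij (@side_label_inj n G side).
have [j1i|j1i] := eqVneq (g j1) i; last first.
  by exists (g j1); rewrite in_tr Kg /= mem_cat h1.
exists (g j2); rewrite in_tr Kg /= mem_cat h2 orbT /=.
apply/eqP => j2i; have U := leaves_uniq ut (side_uniq G side).
have := leaves_disjoint U h1; rewrite -[j1]Kg j1i -j2i Kg.
by rewrite h2.
Qed.

(** The blocks of a frontier are consecutive, so they are compared as a whole. *)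
Lemma agrees_index side A o x y a b : frontier (tre side) A -> agrees side A o ->
  x \in A -> y \in A -> index x A < index y A -> a \in tr side x -> b \in tr side y ->
  o a b.
Proof.
move=> fA ag xA yA xy ax by_.
have sep z : z \in A -> ~~ ((a \in tr side z) && (b \in tr side z)).
  move=> zA; apply/negP => /andP[az bz].
  have E1 := tr_disjoint fA xA zA ax az; have E2 := tr_disjoint fA yA zA by_ bz.
  by rewrite E1 E2 ltnn in xy.
have ab : a != b.
  by apply: contraTneq xy => ab; rewrite (tr_disjoint fA xA yA ax) ?ltnn // ab.
rewrite (ag a b) ?(trD ax) ?(trD by_) //.
have UA := leaf_order_uniq (side_leaves G side) fA.2.
move: ax by_; rewrite !in_tr => /andP[ax _] /andP[by_ _].
elim: (A) UA xA yA xy => //= z A' IH; rewrite spread_cons => UA.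
have U' : uniq (spread A') by move: UA; rewrite cat_uniq => /and3P[].
have out l : l \in spread A' -> l \notin leaves z.
  by move: UA; rewrite cat_uniq => /and3P[_ /hasPn H _]; apply: H.
rewrite !inE => xzA yzA; have [//|zy] := eqVneq z y.
have yA' : y \in A' by move: yzA; rewrite eq_sym (negPf zy).
have bs : lbl side b \in spread A' by apply/spreadP; exists y.
have [zx _|zx lt] := eqVneq z x.
  rewrite -zx in ax; rewrite /before !index_cat ax (negPf (out _ bs)).
  by apply: leq_trans (leq_addr _ _); rewrite index_mem.
have xA' : x \in A' by move: xzA; rewrite eq_sym (negPf zx).
have as_ : lbl side a \in spread A' by apply/spreadP; exists x.
by rewrite /before !index_cat (negPf (out _ as_)) (negPf (out _ bs)) ltn_add2l; apply: IH.
Qed.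

Definition reverse_in (C : {set 'I_n}) o : rel 'I_n :=
  fun a b => if (a \in C) && (b \in C) then o b a else o a b.

(** A cluster that meets C is inside C or contains it, so reversing C is invisible
    from an element outside the cluster. *)
Lemma planar_reverse C o : planar_order o ->
  (forall side, exists2 P, P \in clusters (lbl side) (tre side) & P :&: D = C) ->
  planar_order (reverse_in C o).
Proof.
move=> [tot cg] CP; split.
  move=> a b aD bD ab; rewrite /reverse_in andbC.
  by case: ifP => _; apply: tot; rewrite // eq_sym.
move=> side P PF x y z xD yD zD xP yP zP; rewrite /reverse_in.
have [Q QF QC] := CP side.
have [L _] := hierarchy_clusters (@side_label_inj n G side) (side_leaves G side).
have [zC|_] := boolP (z \in C); last by rewrite !andbF; apply: (cg side P).
have zQ : z \in Q by move: zC; rewrite -QC inE => /andP[].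
have side_xy x' y' : x' \in P -> y' \in P -> y' \in D -> x' \in C -> y' \in C.
  move=> x'P y'P y'D x'C; have x'Q : x' \in Q by move: x'C; rewrite -QC inE => /andP[].
  case: (L P Q PF QF x' x'P x'Q) => /subsetP sub; first by rewrite -QC inE y'D sub.
  by rewrite sub in zP.
have -> : (x \in C) = (y \in C) by apply/idP/idP; apply: side_xy.
rewrite !andbT; case: ifP => _; last exact: (cg side P).
have nz w : w \in P -> w != z by move=> wP; apply: contraNneq zP => <-.
by rewrite !(tot _ z) ?nz // (cg side P PF x y z).
Qed.

Section Step.
Variables (side : bool) (p s Bl : seq vertex) (u1 u2 w1 w2 : vertex) (o : rel 'I_n).
Let u := Node u1 u2.
Let A := p ++ u :: s.
Let A' := p ++ w1 :: w2 :: s.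
Hypotheses (fA : frontier (tre side) A) (fB : frontier (tre (~~ side)) Bl).
Hypotheses (po : planar_order o) (agA : agrees side A o) (agB : agrees (~~ side) Bl o).
Hypothesis ord : ordered_children G i side Bl u1 u2 w1 w2.
Hypothesis full : {in Bl, forall x, tr side u \subset tr (~~ side) x ->
  tr side u = tr (~~ side) x}.

Let sl := side_leaves G side.
Let uA : u \in A. Proof. by rewrite mem_cat mem_head orbT. Qed.
Let ut : u \in vertices (tre side). Proof. exact: (fA.1 _ uA). Qed.

Let w12 : (w1, w2) = (u1, u2) \/ (w1, w2) = (u2, u1).
Proof. by case: ord => [[-> -> _]|[-> -> _]|[_ //]]; [left | right]. Qed.

Let trU : tr side u = tr side u1 :|: tr side u2.
Proof. exact: side_trace_Node. Qed.

(** It is enough that the two children are placed as the order wants. *)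
Let agrees_children o' : planar_order o' -> agrees side A o' ->
  {in tr side u1 & tr side u2, forall a b, o' a b = (w1 == u1)} -> agrees side A' o'.
Proof.
move=> [tot' _] ag' h a b aD bD ab sep.
have childA' c : c = u1 \/ c = u2 -> c \in A'.
  by rewrite mem_cat !inE; case: w12 => -[-> ->] [->|->]; rewrite !eqxx ?orbT.
have lblE c x : c \in D -> (c \in tr side x) = (lbl side c \in leaves x).
  by rewrite in_tr !inE => ->; rewrite andbT.
have [same|sepA] := boolP ((a \in tr side u) && (b \in tr side u)); last first.
  have N x y : x \in D -> y \in D -> ~~ ((x \in tr side u) && (y \in tr side u)) ->
      ~~ ((lbl side x \in leaves u1) && (lbl side y \in leaves u2) ||
          (lbl side x \in leaves u2) && (lbl side y \in leaves u1)).
    move=> xD yD; rewrite trU !in_setU !lblE //; apply: contra.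
    by case/orP=> /andP[-> ->]; rewrite ?orbT.
  rewrite (before_children sl fA w12) ?N //; apply: ag' => // x xA.
  have [->//|xu] := eqVneq x u; apply: sep.
  move: xA; rewrite !mem_cat !inE (negPf xu) /= => /orP[->//|->]; by rewrite !orbT.
move: same; rewrite trU !in_setU => /andP[ha hb].
have not_both c : c = u1 \/ c = u2 -> ~~ ((a \in tr side c) && (b \in tr side c)).
  by move=> cu; apply: sep; apply: childA'.
have flab : lbl side a != lbl side b by rewrite (inj_eq (@side_label_inj n G side)).
have allA' x : x \in spread A'.
  exact: (leaf_order_all sl x (frontier_children sl fA w12).2).
case/orP: ha => ha; case/orP: hb => hb.
- by have := not_both u1 (or_introl erefl); rewrite ha hb.
- by rewrite h // (before_child_order sl fA w12) // -lblE.
- have -> : o' a b = ~~ o' b a by apply: tot' => //; rewrite eq_sym.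
  have flba : lbl side b != lbl side a by rewrite eq_sym.
  rewrite h // (before_total (allA' (lbl side b)) flba).
  by rewrite (before_child_order sl fA w12) // -lblE.
by have := not_both u2 (or_intror erefl); rewrite ha hb.
Qed.

(** If two edges tell in which order the children have to be placed, the program
    has found it.  The only order that it can get wrong with respect to o is that
    of two children with one and the same neighbour; then reversing the common
    cluster below them gives a planar order that agrees with its choice. *)
Lemma refine_planar : exists o', [/\ planar_order o', agrees side A' o' &
  agrees (~~ side) Bl o'].
Proof.
have [tot cg] := po.
have [e1|[a1 a1u]] := set_0Vmem (tr side u1).
  by exists o; split=> //; apply: agrees_children => // a b; rewrite e1 inE.
have [e2|[a2 a2u]] := set_0Vmem (tr side u2).
  by exists o; split=> //; apply: agrees_children => // a b _; rewrite e2 inE.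
have cl c : c \in vertices (tre side) -> cluster (lbl side) c \in clusters (lbl side) (tre side).
  exact: cluster_in.
have dis a b : a \in tr side u1 -> b \in tr side u2 -> lbl side a \notin leaves u2 /\
    lbl side b \notin leaves u1.
  rewrite !in_tr => /andP[a1' _] /andP[b2' _].
  split; first exact: (children_disjoint sl fA a1').
  by apply: contraL b2' => /(children_disjoint sl fA).
have neq a b : a \in tr side u1 -> b \in tr side u2 -> a != b.
  move=> a1' b2'; have [_] := dis _ _ a1' b2'; apply: contraNneq => <-.
  by move: a1'; rewrite in_tr => /andP[].
have const a b : a \in tr side u1 -> b \in tr side u2 -> o a b = o a1 a2.
  move=> au bu.
  have E1 : o a b = o a1 b.
    apply: (cg side _ (cl _ (vertices_childl ut))); rewrite ?(trD au) ?(trD a1u) ?(trD bu) //.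
    - by move: au; rewrite in_tr inE => /andP[].
    - by move: a1u; rewrite in_tr inE => /andP[].
    by rewrite inE; case: (dis _ _ au bu).
  rewrite E1 tot ?(trD a1u) ?(trD bu) 1?eq_sym ?neq // [RHS]tot ?(trD a1u) ?(trD a2u) 1?eq_sym ?neq //.
  congr (~~ _); apply: (cg side _ (cl _ (vertices_childr ut))); rewrite ?(trD a2u) ?(trD a1u) ?(trD bu) //.
  - by move: bu; rewrite in_tr inE => /andP[].
  - by move: a2u; rewrite in_tr inE => /andP[].
  by rewrite inE; case: (dis _ _ a1u bu).
have link c x a : a \in tr side c -> a \in tr (~~ side) x -> linked (orient side (c, x)).
  by move=> ac ax; apply/linkedP; exists a.
have [b1 b1B a1b] := tr_cover fB (trD a1u); have [b2 b2B a2b] := tr_cover fB (trD a2u).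
case: ord => [[E1 E2 le]|[E1 E2 [c1 [c2 [c1B c2B l1 l2 lt]]]]|[none _]]; last first.
- by have := none _ b1B; rewrite (link _ _ _ a1u a1b).
- exists o; split=> //; apply: agrees_children => // a b au bu.
  have [x xu xc] := linkedP _ _ _ _ _ l1; have [y yu yc] := linkedP _ _ _ _ _ l2.
  have oyx : o y x by apply: agrees_index fB agB c2B c1B lt yc xc.
  rewrite const // -(const x y) // tot ?(trD xu) ?(trD yu) 1?eq_sym ?neq // oyx E1 /=.
  apply/esym/negbTE; have [j j1] := leaves_ex u1.
  apply/eqP => uu; have := children_disjoint sl fA j1.
  by rewrite -uu j1.
have [o12|o21] := boolP (o a1 a2).
  by exists o; split=> //; apply: agrees_children => // a b au bu; rewrite const // o12 E1 eqxx.
(* All the neighbours coincide, so the edges below u form a common cluster. *)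
have one a b x y : a \in tr side u1 -> b \in tr side u2 -> x \in Bl -> y \in Bl ->
    a \in tr (~~ side) x -> b \in tr (~~ side) y -> x = y.
  move=> au bu xB yB ax by_; have := le x y xB yB (link _ _ _ au ax) (link _ _ _ bu by_).
  rewrite leq_eqVlt => /orP[/eqP E|lt].
    by rewrite -(nth_index x xB) E nth_index.
  by have := agrees_index fB agB xB yB lt ax by_; rewrite const // (negPf o21).
have b12 : b1 = b2 by apply: one a1u a2u b1B b2B a1b a2b.
have sub : tr side u \subset tr (~~ side) b1.
  apply/subsetP => a; rewrite trU inE => /orP[au|au].
    have [x xB ax] := tr_cover fB (trD au).
    by rewrite b12 -(one _ _ _ _ au a2u xB b2B ax a2b).
  have [x xB ax] := tr_cover fB (trD au).
  by rewrite (one _ _ _ _ a1u au b1B xB a1b ax).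
have CE := full b1B sub.
have pr : planar_order (reverse_in (tr side u) o).
  apply: planar_reverse => // side'.
  have [<-|ns] := eqVneq side side'.
    by exists (cluster (lbl side) u) => //; apply: cl.
  have -> : side' = ~~ side by move: ns; case: (side); case: side'.
  exists (cluster (lbl (~~ side)) b1); last exact/esym/CE.
  by apply: cluster_in; apply: fB.1.
exists (reverse_in (tr side u) o); split=> //.
  apply: agrees_children => //.
    move=> a b aD bD ab sep; rewrite /reverse_in.
    by rewrite (negPf (sep _ uA)); apply: agA.
  move=> a b au bu; rewrite /reverse_in trU !in_setU au bu orbT /=.
  by rewrite tot ?(trD au) ?(trD bu) ?neq // const // o21 E1 eqxx.
move=> a b aD bD ab sep; rewrite /reverse_in CE (negPf (sep _ b1B)).
exact: agB.
Qed.

End Step.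

End Consistent.

(** * The untangling loop *)

Section Loop.
Variables (n : nat) (G : tanglegram n) (i : 'I_n).
Notation vertex := (tree 'I_n).
Notation lbl := (side_label G).
Notation tre := (side_tree G).
Notation tr := (side_trace G i).
Notation linked := (linked G i).
Let T := treeT G.
Let S := treeS G.
Let f := phi G.
Let fI : injective f := @perm_inj _ f.
Let idI : injective (@id 'I_n) := @inj_id _.
Let D : {set 'I_n} := [set~ i].
Let n0 : 0 < n := leq_ltn_trans (leq0n i) (ltn_ord i).
Let Common := common (clusters id T) (clusters f S) D.
Implicit Types (side : bool) (A Bl X Y : seq vertex) (E L : seq (vpair n)).

Definition exact_edges side A Bl E : Prop := uniq E /\
  forall c b, (orient side (c, b) \in E) = [&& c \in A, b \in Bl & linked (orient side (c, b))].

(** A common cluster is not broken up before it is recorded. *)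
Definition recorded side A Bl L : Prop := forall C, Common C -> 1 < #|C| ->
  (exists2 p, p \in L & trace i id p.1 = C) \/
  (exists x y, [/\ x \in A, y \in Bl, C \subset tr side x & C \subset tr (~~ side) y]).

Definition planar_state side A Bl : Prop :=
  [/\ frontier (tre side) A, frontier (tre (~~ side)) Bl &
      exists o, [/\ planar_order G i o, agrees G i side A o & agrees G i (~~ side) Bl o]].

Definition state side A Bl E L : Prop :=
  [/\ planar_state side A Bl, 1 < n -> exact_edges side A Bl E, size E <= 2 * n,
      {in L, forall p, pairing G i p} & size L + 2 <= size A + size Bl /\ recorded side A Bl L].

Lemma state_swap side A Bl E L : state side A Bl E L -> state (~~ side) Bl A E L.
Proof.
move=> [[fA fB [o [po a1 a2]]] ex sE pL [sL rec]]; split=> //.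
- by split; rewrite ?negbK //; exists o; split.
- move=> n1; have [UE EE] := ex n1; split=> // c b.
  have -> : orient (~~ side) (c, b) = orient side (b, c) by case: (side).
  by rewrite EE andbCA.
split; first by rewrite [size Bl + _]addnC.
move=> C CC C1; have [|[x [y [xA yB Cx Cy]]]] := rec C CC C1; first by left.
by right; exists y, x; rewrite negbK.
Qed.

Lemma state_side side A Bl E L :
  state true (if side then A else Bl) (if side then Bl else A) E L <-> state side A Bl E L.
Proof. by case: side; split=> // /state_swap. Qed.

Section Edges.
Variables (side : bool) (A Bl : seq vertex) (E : seq (vpair n)).
Hypotheses (ps : planar_state side A Bl) (ex : exact_edges side A Bl E).

Let fA : frontier (tre side) A. Proof. by case: ps. Qed.
Let fB : frontier (tre (~~ side)) Bl. Proof. by case: ps. Qed.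
Let UA : uniq A := frontier_uniq (side_leaves G side) fA.
Let UB : uniq Bl := frontier_uniq (side_leaves G (~~ side)) fB.

(** No two edges cross, so the sum of the positions of the ends determines an
    edge: there are linearly many. *)
Lemma size_edges : size E <= size A + size Bl.
Proof.
have [_ _ [o [[tot _] aA aB]]] := ps; have [UE EE] := ex.
pose h (e : vpair n) := index (orient side e).1 A + index (orient side e).2 Bl.
have mono c b c' b' : orient side (c, b) \in E -> orient side (c', b') \in E ->
    index c A < index c' A -> index b Bl <= index b' Bl.
  rewrite !EE => /and3P[cA bB /linkedP[j jc jb]] /and3P[c'A b'B /linkedP[k kc kb]] lt.
  rewrite leqNgt; apply/negP => lt'.
  have ojk := agrees_index fA aA cA c'A lt jc kc.
  have okj := agrees_index fB aB b'B bB lt' kb jb.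
  have jk : j != k.
    apply: contraTneq lt => jk; rewrite -jk in kc.
    by rewrite (tr_disjoint fA cA c'A jc kc) ltnn.
  by move: okj; rewrite tot ?(trD jc) ?(trD kc) // ojk.
have hinj : {in E &, injective h}.
  move=> e e'; rewrite -[e](orientK side) -[e'](orientK side).
  case: (orient side e) => c b; case: (orient side e') => c' b'.
  rewrite /h !orientK /= => eE e'E hE; congr (orient side _).
  have ic : index c A = index c' A.
    have [lt|lt|//] := ltngtP (index c A) (index c' A).
      by have := mono _ _ _ _ eE e'E lt; lia.
    by have := mono _ _ _ _ e'E eE lt; lia.
  have ib : index b Bl = index b' Bl by move: hE; rewrite ic => /addnI.
  move: eE e'E; rewrite !EE => /and3P[cA bB _] /and3P[c'A b'B _].
  by rewrite -(nth_index c cA) ic nth_index // -(nth_index b bB) ib nth_index.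
rewrite -(size_map h); apply: leq_trans (_ : size (iota 0 (size A + size Bl)) <= _); last first.
  by rewrite size_iota.
apply: uniq_leq_size; first by rewrite map_inj_in_uniq.
move=> m /mapP[e eE ->]; rewrite mem_iota /= add0n /h.
move: eE; rewrite -[e](orientK side); case: (orient side e) => c b.
rewrite EE orientK /= => /and3P[cA bB _].
by rewrite -addSn; apply: leq_add; [rewrite index_mem | rewrite ltnW // index_mem].
Qed.

Lemma degreeE u : u \in A ->
  degree E (side, u) = count (fun x => linked (orient side (u, x))) Bl.
Proof.
move=> uA; have [UE EE] := ex; rewrite /degree -!size_filter /=.
pose K := [seq orient side (u, x) | x <- Bl & linked (orient side (u, x))].
have UK : uniq K.
  rewrite map_inj_in_uniq ?filter_uniq // => x y _ _.
  by move/(inv_inj (@orientK n side)) => -[].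
have <- : size K = size [seq x <- Bl | linked (orient side (u, x))] by rewrite size_map.
apply: perm_size; apply: uniq_perm => //; first exact: filter_uniq.
move=> e; rewrite mem_filter; apply/andP/mapP => [[/eqP eu eE]|[x]].
  have eO : e = orient side (u, (orient side e).2).
    by rewrite -eu -surjective_pairing orientK.
  exists (orient side e).2 => //; rewrite mem_filter -eO.
  by move: eE; rewrite eO EE -eO => /and3P[_ -> ->].
by rewrite mem_filter => /andP[l xB] ->; rewrite orientK EE uA xB l eqxx.
Qed.

Lemma degree1 u x y : u \in A -> degree E (side, u) <= 1 -> x \in Bl -> y \in Bl ->
  linked (orient side (u, x)) -> linked (orient side (u, y)) -> x = y.
Proof.
move=> uA; rewrite degreeE // -size_filter => le xB yB lx ly; apply/eqP.
apply: contraTT le => xy; rewrite -ltnNge.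
have := @uniq_leq_size _ [:: x; y] [seq z <- Bl | linked (orient side (u, z))].
apply; first by rewrite /= inE xy.
by move=> z; rewrite !inE mem_filter => /orP[]/eqP->; rewrite ?lx ?ly.
Qed.

Lemma degree1_sub u x : u \in A -> degree E (side, u) <= 1 -> x \in Bl ->
  linked (orient side (u, x)) -> tr side u \subset tr (~~ side) x.
Proof.
move=> uA d1 xB lx; apply/subsetP => j ju.
have [y yB jy] := tr_cover fB (trD ju).
by rewrite (degree1 uA d1 xB yB lx) //; apply/linkedP; exists j.
Qed.

Lemma sub_degree1 u x : u \in A -> x \in Bl -> tr side u \subset tr (~~ side) x ->
  degree E (side, u) <= 1.
Proof.
move=> uA xB /subsetP sub; rewrite degreeE // -size_filter.
apply: (@uniq_leq_size _ _ [:: x]); first exact: filter_uniq.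
move=> y; rewrite mem_filter mem_seq1 => /andP[/linkedP[j ju jy] yB].
by rewrite (tr_disjoint fB yB xB jy (sub _ ju)).
Qed.

End Edges.

Section Step.
Variables (side : bool) (p s Bl : seq vertex) (u1 u2 : vertex) (E L : seq (vpair n)).
Let u := Node u1 u2.
Let A := p ++ u :: s.
Hypotheses (st : state side A Bl E L) (ex : exact_edges side A Bl E).
Hypothesis maxB : forall x, x \in Bl -> internal x ->
  degree E (~~ side, x) <= degree E (side, u).

Let psA : planar_state side A Bl. Proof. by case: st. Qed.
Let fA : frontier (tre side) A. Proof. by case: psA. Qed.
Let fB : frontier (tre (~~ side)) Bl. Proof. by case: psA. Qed.
Let sl := side_leaves G side.
Let uA : u \in A. Proof. by rewrite mem_cat mem_head orbT. Qed.
Let ut : u \in vertices (tre side). Proof. exact: (fA.1 _ uA). Qed.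

Let exB : exact_edges (~~ side) Bl A E.
Proof.
have [UE EE] := ex; split=> // c b.
have -> : orient (~~ side) (c, b) = orient side (b, c) by case: (side).
by rewrite EE andbCA.
Qed.

Let psB : planar_state (~~ side) Bl A.
Proof. by have [psB' _ _ _ _] := state_swap st. Qed.

(** If all the edges below u lead to x, then u has degree one, and x, whose degree
    is not higher, has no edge that leads elsewhere.  A leaf x has one edge at
    most. *)
Lemma full_neighbour : {in Bl, forall x, tr side u \subset tr (~~ side) x ->
  tr side u = tr (~~ side) x}.
Proof.
move=> x xB sub; apply/eqP; rewrite eqEsubset sub /=.
have [j ju] := tr_ex i ut; have jx := subsetP sub _ ju.
have d1 := sub_degree1 psA ex uA xB sub.
have [[l xE]|Ix] : (exists l, x = Leaf l) \/ internal x.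
  by case: (x) => [l|? ?]; [left; exists l | right].
  have leafE k : k \in tr (~~ side) x -> lbl (~~ side) k = l.
    by rewrite xE in_tr inE => /andP[/eqP].
  apply/subsetP => k /leafE kl.
  by rewrite (side_label_inj (etrans kl (esym (leafE _ jx)))).
have := degree1_sub psB exB xB (leq_trans (maxB xB Ix) d1) uA; rewrite negbK; apply.
by apply/linkedP; exists j; rewrite // negbK.
Qed.

Lemma record_pairing e : e \in E -> (orient side e).1 = u -> degree E (side, u) = 1 ->
  pairing G i e /\ trace i id e.1 = tr side u.
Proof.
move=> eE eu d1; have [UE EE] := ex.
have eO : e = orient side (u, (orient side e).2).
  by rewrite -eu -surjective_pairing orientK.
move: (orient side e).2 eO => x eO; subst e.
move: (eE); rewrite EE => /and3P[_ xB lx].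
have d1' : degree E (side, u) <= 1 by rewrite d1.
have sE : tr side u = tr (~~ side) x := full_neighbour xB (degree1_sub psA ex uA d1' xB lx).
have xt := fB.1 _ xB; rewrite /pairing; clear -ut xt sE; move: ut xt sE.
by rewrite /side_trace; case: (side) => /= ut_ xt_ sE_; split=> //; split.
Qed.

Variables (w1 w2 : vertex) (E' L' : seq (vpair n)).
Let A' := p ++ w1 :: w2 :: s.
Hypothesis ord : ordered_children G i side Bl u1 u2 w1 w2.
Hypothesis ex' : exact_edges side A' Bl E'.
Hypothesis LP : if degree E (side, u) == 1 then
  exists e, [/\ L' = e :: L, e \in E & (orient side e).1 = u] else L' = L.

(** A common cluster C that lies below u but below neither child is all of the
    trace of u, as no vertex with edges below both children is strictly below u.
    Moreover C lies below one vertex of the other list, so u has degree one and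
    its only edge is being recorded. *)
Lemma state_refined : state side A' Bl E' L'.
Proof.
have w12 : (w1, w2) = (u1, u2) \/ (w1, w2) = (u2, u1).
  by case: ord => [[-> -> _]|[-> -> _]|[_ //]]; [left | right].
have [_ _ _ pL [sL rec]] := st.
have [_ _ [o [po aA aB]]] := psA.
have fA' := frontier_children sl fA w12.
have ps' : planar_state side A' Bl.
  split=> //; have [o' [po' a1 a2]] := refine_planar fA fB po aA aB ord full_neighbour.
  by exists o'.
have LL' q : q \in L -> q \in L'.
  by move: LP; case: ifP => [_ [e [-> _ _]]|_ ->//]; rewrite inE => ->; rewrite orbT.
split=> //.
- apply: leq_trans (size_edges ps' ex') _; rewrite mul2n -addnn.
  exact: leq_add (frontier_size sl fA') (frontier_size (side_leaves G (~~ side)) fB).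
- move: LP; case: eqP => [d1 [e [-> eE eu]] q|_ -> //].
  by rewrite inE => /predU1P[->|/pL//]; case: (record_pairing eE eu d1).
split.
  have sA' : size A' = (size A).+1 by rewrite !size_cat /= !addnS.
  rewrite sA' addSn; have : size L' <= (size L).+1 by move: LP; case: ifP => [_ [e [-> _ _]]|_ ->].
  by move: sL; clear; lia.
move=> C CC C1; have [[q qL qC]|[x [y [xA yB Cx Cy]]]] := rec C CC C1.
  by left; exists q; first exact: LL'.
have childA' c : c = u1 \/ c = u2 -> c \in A'.
  by rewrite mem_cat !inE; case: w12 => -[-> ->] [->|->]; rewrite !eqxx ?orbT.
have [xu|xu] := eqVneq x u; last first.
  right; exists x, y; split=> //; move: xA; rewrite !mem_cat !inE (negPf xu) /=.
  by case/orP=> ->; rewrite ?orbT.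
rewrite {x}xu in xA Cx.
have [C_1|/subsetPn[j2 j2C j2u]] := boolP (C \subset tr side u1).
  by right; exists u1, y; split=> //; apply: childA'; left.
have [C_2|/subsetPn[j1 j1C j1u]] := boolP (C \subset tr side u2).
  by right; exists u2, y; split=> //; apply: childA'; right.
left.
have trU : tr side u = tr side u1 :|: tr side u2 by apply: side_trace_Node.
have {}j1u : j1 \in tr side u1.
  by have := subsetP Cx _ j1C; rewrite trU inE (negPf j1u) orbF.
have {}j2u : j2 \in tr side u2.
  by have := subsetP Cx _ j2C; rewrite trU inE (negPf j2u).
have [P [w [wt PE PC]]] : exists P w, [/\ w \in vertices (tre side),
    P = cluster (lbl side) w & P :&: D = C].
  have [P [Q [/mapP[w wt ->] /mapP[v vt ->] PC QC]]] := CC.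
  case: (side); first by exists (cluster id w), w.
  by exists (cluster f v), v.
have CE : C = tr side u.
  apply/eqP; rewrite eqEsubset Cx /=; rewrite -PC PE.
  have jw j : j \in C -> lbl side j \in leaves w by rewrite -PC PE !inE => /andP[].
  have l1 : lbl side j1 \in leaves u1 by move: j1u; rewrite in_tr => /andP[].
  have l2 : lbl side j2 \in leaves u2 by move: j2u; rewrite in_tr => /andP[].
  have l1u : lbl side j1 \in leaves u by rewrite /= mem_cat l1.
  have uw : u \in vertices w.
    have [//|] := vertices_laminar (side_uniq G side) ut wt l1u (jw _ j1C).
    rewrite vertices_Node => /or3P[/eqP->|wu|wu]; first exact: vertices_refl.
      have := children_disjoint sl fA (leaves_sub wu (jw _ j2C)).
      by rewrite l2.
    have := children_disjoint sl fA l1.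
    by rewrite (leaves_sub wu (jw _ j1C)).
  exact: (trace_mono i (lbl side) uw).
have d1 : degree E (side, u) = 1.
  have sub : tr side u \subset tr (~~ side) y by rewrite -CE.
  apply/eqP; rewrite eqn_leq (sub_degree1 psA ex uA yB sub) /=.
  rewrite (degreeE psA ex uA) -has_count; apply/hasP; exists y => //.
  apply/linkedP; exists j1; first by rewrite -CE.
  exact: (subsetP Cy).
move: LP; rewrite d1 eqxx => -[e [-> eE eu]]; exists e; first exact: mem_head.
by rewrite CE; case: (record_pairing eE eu d1).
Qed.

End Step.
End Loop.

Section Iterate.
Variables (n : nat) (G : tanglegram n) (i : 'I_n).
Notation vertex := (tree 'I_n).
Notation tre := (side_tree G).
Let n0 : 0 < n := leq_ltn_trans (leq0n i) (ltn_ord i).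
Implicit Types (side : bool) (A Bl X Y : seq vertex) (E L : seq (vpair n)).

Lemma mem_sided side A Bl u :
  ((side, u) \in sided (if side then A else Bl) (if side then Bl else A)) = (u \in A).
Proof.
have pI (b : bool) : injective (fun u : vertex => (b, u)) by move=> x y [].
have out (b : bool) (Z : seq vertex) : (b, u) \in [seq (~~ b, x) | x <- Z] = false.
  by apply/mapP => -[x _ []]; case: b.
by rewrite mem_cat; case: side; rewrite (mem_map (pI _)) ?(out true) ?(out false) ?orbF.
Qed.

Lemma mem_sidedN side A Bl u :
  ((~~ side, u) \in sided (if side then A else Bl) (if side then Bl else A)) = (u \in Bl).
Proof. by rewrite -(mem_sided (~~ side) Bl A); case: side. Qed.

Lemma within_record side u d E L : size E <= 2 * n -> degree E (side, u) = d ->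
  within (if d == 1 then
            let* es := edges_of (side, u) E in
            if es is e :: _ then ret (e :: L) else abort
          else ret L) (4 * n + 1)
    (fun L' => if degree E (side, u) == 1 then
       exists e, [/\ L' = e :: L, e \in E & (orient side e).1 = u] else L' = L).
Proof.
move=> sE <-; case: eqP => [d1|_]; last exact: within_ret.
apply: within_bind_eq.
- by apply: (within_lfilter (k := 1)) => e _; apply: within_same.
- by move: sE; set m := size E; clear; lia.
have : size [seq e <- E | (orient side e).1 == u] = 1 by rewrite size_filter.
case E1: [seq e <- E | _] => [|e es] //= _; apply: within_ret; exists e.
have : e \in [seq e <- E | (orient side e).1 == u] by rewrite E1 mem_head.
by rewrite mem_filter => /andP[/eqP eu eE].
Qed.

(** A list with an internal vertex is shorter than the list of leaves.  As every
    refinement lengthens a list, the fuel lasts until no internal vertex is left.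
    The bound 1 < n makes the initial edge a linked pair. *)
Lemma internal_room side A Bl E L u1 u2 : state G i side A Bl E L ->
  Node u1 u2 \in A -> 1 < n /\ size A + size Bl < 2 * n.
Proof.
move=> [[fA fB _] _ _ _ _] uA.
have lt := frontier_size_lt (side_leaves G side) fA uA.
have le := frontier_size (side_leaves G (~~ side)) fB.
have A1 : 0 < size A by case: (A) uA.
by move: lt le A1; set a := size A; set b := size Bl; clear; lia.
Qed.

Lemma lists_of side X Y : exists A Bl,
  X = (if side then A else Bl) /\ Y = if side then Bl else A.
Proof. by case: side; [exists X, Y | exists Y, X]. Qed.

Lemma within_untangle_loop B fuel X Y E L : table_ok G i B ->
  state G i true X Y E L -> 2 * n <= fuel + (size X + size Y) ->
  within (untangle_loop fuel B X Y E L) (fuel.+1 * (110 * n)) (fun r =>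
    (exists E', state G i true r.1.1 r.1.2 E' r.2) /\
    forall x, x \in r.1.1 \/ x \in r.1.2 -> ~~ internal x).
Proof.
move=> BP; elim: fuel X Y E L => [|fuel IH] X Y E L st le /=.
all: have [[fX fY _] _ sE _ _] := st.
all: have sX := frontier_size (side_leaves G true) fX.
all: have sY := frontier_size (side_leaves G false) fY.
all: apply: within_call; first by clear -n0; lia.
all: apply: within_bind; [exact: (within_highest_internal i sE sX sY) | by clear -n0; lia |].
all: move=> [d best] [/= best1 best2 best3 _].
all: have [bE|[[side w] wb]] : best = [::] \/ exists su, su \in best;
  [by case: (best) => [|su l]; [left | right; exists su; apply: mem_head]
  |rewrite bE; apply: within_ret; split; first (by exists E)|].
1,3: move=> x /= xXY; apply/negP => Ix.
1,2: have [s xs] : exists side, (side, x) \in sided X Y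
     by (case: xXY => xin; [exists true | exists false];
         rewrite mem_cat map_f ?orbT //).
1,2: by have [_] := best2 _ xs Ix; rewrite bE.
- have [ws Iw _] := best1 _ wb; have [A [Bl [XE YE]]] := lists_of side X Y.
  rewrite XE YE mem_sided in ws; rewrite XE YE state_side in st.
  case: w Iw ws {wb} => // w1 w2 _ ws; have [_] := internal_room st ws.
  move: le; rewrite XE YE ltnNge add0n; case: (side) => le; first by rewrite le.
  by rewrite addnC le.
have bn0 : best != [::] by case: (best) wb.
have -> (C : Type) (c1 c2 : C) : (if best is [::] then c1 else c2) = c2 by case: (best) bn0.
clear side w wb.
have sb : size best <= 2 * n.
  apply: leq_trans best3 _; rewrite size_cat !size_map.
  by move: sX sY; set a := size X; set b := size Y; clear; lia.
apply: within_bind.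
- by apply: (within_choose (k := 2 * n + 1) bn0 _ (fun x xb => xb)); rewrite addn1 ltnS.
- by clear -n0; lia.
move=> [side u] ub; have [us Iu du] := best1 _ ub; have [A [Bl [XE YE]]] := lists_of side X Y.
rewrite XE YE mem_sided in us; rewrite XE YE state_side in st.
have sXY : size X + size Y = size A + size Bl.
  by rewrite XE YE; case: (side); rewrite // addnC.
have [sA sB] : size A <= n /\ size Bl <= n.
  by move: sX sY; rewrite XE YE; case: (side).
case: u Iu us du ub => // u1 u2 _ us du ub.
have [n1 room] := internal_room st us.
have [ps ex _ _ _] := st; have {}ex := ex n1; have [UE EE] := ex; have [fA fB _] := ps.
apply: within_bind; [exact: (within_record L sE du) | by clear -n0; lia |].
move=> L' LP.
have maxB x : x \in Bl -> internal x ->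
    degree E (~~ side, x) <= degree E (side, Node u1 u2).
  move=> xB Ix; rewrite du; suff /best2 [] : (~~ side, x) \in sided X Y by [].
  by rewrite XE YE mem_sidedN.
have [p [s AE]] : exists p s, A = p ++ Node u1 u2 :: s.
  by case/splitPr: (us) => p s; exists p, s.
have sl := side_leaves G side.
have [UA UB] : uniq A /\ uniq Bl.
  exact: conj (frontier_uniq sl fA) (frontier_uniq (side_leaves G (~~ side)) fB).
have fA' := fA; rewrite AE in fA'.
have u1A : u1 \notin A by rewrite AE; apply: (child_notin sl fA'); left.
have u2A : u2 \notin A by rewrite AE; apply: (child_notin sl fA'); right.
have u12 : u1 != u2.
  have [j j1] := leaves_ex u1; apply: contraTneq (children_disjoint sl fA' j1) => <-.
  by rewrite j1.
rewrite XE YE; apply: within_bind.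
- exact: (within_refine BP AE UA UB u1A u2A u12 fA.1 fB.1 UE EE sE sA sB).
- by clear -n0; lia.
move=> r [w1 [w2 [E' [rE ord UE' EE']]]].
have ex' : exact_edges G i side (p ++ w1 :: w2 :: s) Bl E' by [].
rewrite AE in st ex; have st' := state_refined st ex maxB ord ex' LP.
have sA' : size (p ++ w1 :: w2 :: s) = (size A).+1 by rewrite AE !size_cat /= !addnS.
have -> : r = (if side then p ++ w1 :: w2 :: s else Bl,
               if side then Bl else p ++ w1 :: w2 :: s, E') by rewrite rE; case: (side).
apply: (within_weaken (IH _ _ _ _ _ _)) => //; first exact/state_side.
  have -> : size (if side then p ++ w1 :: w2 :: s else Bl) +
     size (if side then Bl else p ++ w1 :: w2 :: s) = (size X + size Y).+1.
    by rewrite sXY -addSn -sA'; case: (side); rewrite // addnC.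
  by move: le; rewrite addnS addSn.
by clear -n0; lia.
Qed.

End Iterate.

Section Untangle.
Variables (n : nat) (G : tanglegram n) (i : 'I_n).
Notation vertex := (tree 'I_n).
Notation lbl := (side_label G).
Notation tre := (side_tree G).
Notation tr := (side_trace G i).
Let T := treeT G.
Let S := treeS G.
Let f := phi G.
Let D : {set 'I_n} := [set~ i].
Let n0 : 0 < n := leq_ltn_trans (leq0n i) (ltn_ord i).
Implicit Types (side : bool) (X Y : seq vertex) (E L : seq (vpair n)).

(** The order is that of the edges in a planar layout of the subtanglegram. *)
Lemma planar_induced_order : planar_induced G D -> exists o, planar_order G i o.
Proof.
move=> [[X Y] [[/= LX LY] /eqP]]; rewrite cards_eq0 => /eqP cr0.
have [XT HX] := proj1 (leaf_order_inducedP _ _ (leaves_tree_uniq (leavesT G))) LX.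
have [YS HY] := proj1 (leaf_order_inducedP _ _ (leaves_tree_uniq (leavesS G))) LY.
have fI : injective f := @perm_inj _ f.
have fD j : j \in D -> f j \in f @: D by apply: imset_f.
have XD j : (j \in X) = (j \in D).
  by rewrite (perm_mem XT) mem_filter (leaves_all (leavesT G)) andbT.
have YD j : j \in D -> f j \in Y.
  by move=> jD; rewrite (perm_mem YS) mem_filter (leaves_all (leavesS G)) andbT; apply: fD.
have tot a b : a \in D -> a != b -> before X b a = ~~ before X a b.
  by move=> aD; apply: before_total; rewrite XD.
have E a b : a \in D -> b \in D -> a != b -> before X a b = before Y (f a) (f b).
  move=> aD bD ab; wlog lt : a b aD bD ab / a < b.
    move=> H; have [lt|lt|/val_inj/eqP] := ltngtP a b; last by rewrite (negPf ab).
      exact: H.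
    have ba : b != a by rewrite eq_sym.
    by rewrite (tot b a) // (H b a) // [in RHS](before_total (YD _ bD)) // (inj_eq fI).
  have := in_set0 (a, b); rewrite -cr0 inE /= !XD aD bD lt /= /crosses.
  by move/negbFE/eqP.
exists (before X); split=> [a b aD bD|]; first exact: tot.
move=> side _ /mapP[u ut ->] x y z xD yD zD.
rewrite !inE; case: side ut => /= ut xu yu zu.
  by apply: (HX u); rewrite // (leaves_all (leavesT G)).
have nz w : f w \in leaves u -> w != z by apply: contraTneq => ->.
rewrite !E ?nz //; apply: (HY u) => //; rewrite ?(leaves_all (leavesS G)) //; exact: fD.
Qed.

Lemma agrees_root side o : agrees G i side [:: tre side] o.
Proof.
move=> a b aD bD ab /(_ _ (mem_head _ _)); move: aD bD.
by rewrite !in_tr !inE => -> ->; rewrite !(leaves_all (side_leaves G side)).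
Qed.

Lemma initial_state : planar_induced G D ->
  state G i true [:: T] [:: S] [:: (T, S)] [::].
Proof.
move=> /planar_induced_order[o po].
have trD side j : j \in D -> j \in tr side (tre side).
  by rewrite in_tr !inE (leaves_all (side_leaves G side)).
split=> //.
- split; [exact: (frontier_root T) | |].
    exact: (frontier_root S).
  by exists o; split; [| exact: (@agrees_root true o) | exact: (@agrees_root false o)].
- move=> n1; split=> // c b; rewrite !mem_seq1 xpair_eqE.
  have [->|//] := eqVneq c T; have [->|//] := eqVneq b S; symmetry.
  have /card_gt0P[j jD] : 0 < #|D| by rewrite cardsC1 card_ord; lia.
  by apply/(linkedP G i true); exists j; [exact: (trD true) | exact: (trD false)].
- by rewrite /=; lia.
split=> // C [P [Q [_ _ <- _]]] _; right; exists T, S; rewrite !mem_head.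
split=> //; apply/subsetP => j; rewrite inE => /andP[_ jD].
  exact: (trD true).
exact: (trD false).
Qed.

Let label (u : vertex) : 'I_n := if u is Leaf a then a else i.

Lemma within_leaf_labels X : size X <= n -> {in X, forall x, ~~ internal x} ->
  within (leaf_labels X) (3 * n) (eq (spread X)).
Proof.
move=> sX IX; have -> : spread X = map label X.
  elim: X IX {sX} => //= x X IH IX; rewrite spread_cons IH.
    by move: (IX x (mem_head _ _)); clear; case: x.
  by move=> y yX; apply: IX; rewrite inE yX orbT.
apply: within_weaken; [apply: (within_lmap (k := 0) (g := label)) | | by []].
  by move=> x xX; have := IX x xX; case: x {xX} => // a _; apply: within_ret.
by move: sX; set m := size X; clear -n0; lia.
Qed.

Lemma leaf_trace side x a b : ~~ internal x -> a \in tr side x -> b \in tr side x -> a = b.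
Proof.
case: x => // l _; rewrite !in_tr !inE => /andP[/eqP al _] /andP[/eqP bl _].
exact: (side_label_inj (etrans al (esym bl))).
Qed.

(** Lists of leaves decide the order of all the edges, so they agree with a planar
    order; and a common cluster with two elements does not fit below a leaf. *)
Lemma untangled X Y E L : state G i true X Y E L ->
  (forall x, x \in X \/ x \in Y -> ~~ internal x) ->
  [/\ extending G i (spread X, spread Y), size L <= 2 * n,
      {in L, forall p, pairing G i p} &
      forall C, common (clusters id T) (clusters f S) D C -> 1 < #|C| ->
        exists2 p, p \in L & trace i id p.1 = C].
Proof.
move=> [[fX fY [o [_ aX aY]]] _ _ pL [sL rec]] IX; split=> //.
- split=> [||j k ji ki jk]; [exact: fX.2 | exact: fY.2 |].
  have sep side Z : {in Z, forall x, ~~ internal x} ->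
      {in Z, forall x, ~~ ((j \in tr side x) && (k \in tr side x))}.
    move=> IZ x xZ; apply: contra jk => /andP[jx kx].
    by rewrite (leaf_trace (IZ x xZ) jx kx).
  have jD : j \in D by rewrite !inE.
  have kD : k \in D by rewrite !inE.
  rewrite -[LHS](aX j k jD kD jk); last by apply: sep => x xX; apply: IX; left.
  by apply: (aY j k jD kD jk); apply: sep => x xY; apply: IX; right.
- have := frontier_size (side_leaves G true) fX.
  have := frontier_size (side_leaves G false) fY.
  by move: sL; set a := size X; set b := size Y; set c := size L; clear; lia.
move=> C CC C1; have [//|[x [y [xX yY Cx _]]]] := rec C CC C1.
have /card_gt1P[a [b [aC bC ab]]] := C1.
have Ix : ~~ internal x by apply: IX; left.
by move: ab; rewrite (leaf_trace Ix (subsetP Cx _ aC) (subsetP Cx _ bC)) eqxx.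
Qed.

Lemma within_modified_untangle : planar_induced G D ->
  within (modified_untangle T S f i) (400 * n ^ 2) (fun r =>
    [/\ extending G i r.1, size r.2 <= 2 * n,
        {in r.2, forall p, pairing G i p} &
        forall C, common (clusters id T) (clusters f S) D C -> 1 < #|C| ->
          exists2 p, p \in r.2 & trace i id p.1 = C]).
Proof.
move=> /initial_state st; have nn : n <= n ^ 2 by rewrite -[n in n <= _]expn1 leq_pexp2l.
apply: within_bind; [exact: within_untangle_table | by clear -nn; lia |].
move=> B BP; apply: within_bind.
- have cost : (2 * n).+1 * (110 * n) <= 330 * n ^ 2.
    by rewrite mulSn mulnACA mulnn; clear -nn; lia.
  exact: (within_weaken (within_untangle_loop BP st (leq_addr _ _)) cost (fun _ H => H)).
- by clear; lia.
move=> [[X Y] L] /= [[E' st'] IX].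
have sX := frontier_size (side_leaves G true) (let: And5 p _ _ _ _ := st' in let: And3 a _ _ := p in a).
have sY := frontier_size (side_leaves G false) (let: And5 p _ _ _ _ := st' in let: And3 _ a _ := p in a).
apply: within_bind_eq; [apply: (within_leaf_labels sX) | by clear -nn; lia |].
  by move=> x xX; apply: IX; left.
apply: within_bind_eq; [apply: (within_leaf_labels sY) | by clear -nn; lia |].
  by move=> x xX; apply: IX; right.
by apply: within_ret; apply: (untangled st').
Qed.

End Untangle.

(** * The whole algorithm *)

Section Insertion.
Variables (n : nat) (G : tanglegram n) (i : 'I_n).
Notation vertex := (tree 'I_n).
Let T := treeT G.
Let S := treeS G.
Let f := phi G.
Let n0 : 0 < n := leq_ltn_trans (leq0n i) (ltn_ord i).

Lemma foldl_leaves (t : vertex) acc :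
  foldl (fun js u => if u is Leaf j then j :: js else js) acc (postorder_seq t) =
  rev (leaves t) ++ acc.
Proof.
elim: t acc => //= t1 IH1 t2 IH2 acc.
by rewrite !foldl_cat /= IH1 IH2 rev_cat catA.
Qed.

Lemma parent_siblings (x : 'I_n) (w1 w2 : vertex) : w1 = Leaf x \/ w2 = Leaf x ->
  exists w, siblings x (Node w1 w2) w.
Proof. by case=> ->; [exists w2; left | exists w1; right]. Qed.

(** Without another edge there is nothing to cross. *)
Lemma optimal_single XY : n = 1 -> extending G i XY -> optimal G i XY.
Proof.
move=> n1 eXY; split=> // XY' _; rewrite (crossings_extending eXY).
rewrite (_ : crossed_by _ _ _ = set0) ?cards0 //; apply/setP => j; rewrite !inE.
suff -> : j = i by rewrite eqxx.
by apply: val_inj => /=; have := ltn_ord i; have := ltn_ord j; lia.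
Qed.

Lemma within_insertion : planar_induced G [set~ i] ->
  within (insertion G i) (1200 * n ^ 2) (solves_insertion G i).
Proof.
move=> pl; apply: (within_weaken (k := 1200 * n ^ 2) (P := optimal G i)) => //; last first.
  move=> XY [eXY H]; split; first exact/extendingP.
  by move=> XY' /extendingP; apply: H.
have nn : n <= n ^ 2 by rewrite -[n in n <= _]expn1 leq_pexp2l.
have sT := size_leaves (leavesT G); have sS := size_leaves (leavesS G).
rewrite /insertion /insertion_program.
apply: within_bind; [exact: (within_modified_untangle pl) | by clear; lia |].
move=> [XY L] [/= eXY sL LP LC].
apply: within_bind; [exact: (within_reduced_pairs sL LP LC) | by clear; lia |].
move=> R [RP RC RU RS].
apply: (within_bind_eq (within_read f i)); first by clear -nn n0; lia.
have iT : Leaf i \in vertices T by rewrite mem_vertices_Leaf (leaves_all (leavesT G)).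
have iS : Leaf (f i) \in vertices S by rewrite mem_vertices_Leaf (leaves_all (leavesS G)).
apply: within_bind; [exact: (within_parent sT iT) | by clear -nn n0; lia |].
move=> ou Hu; apply: within_bind; [exact: (within_parent sS iS) | by clear -nn n0; lia |].
move=> ov Hv.
have single t x : size (leaves t) = n -> Leaf x = t -> within (ret XY) 
    (1200 * n ^ 2 - 400 * n ^ 2 - 80 * n ^ 2 - 1 - 8 * n - 8 * n) (optimal G i).
  move=> tn tE; apply: within_ret; apply: optimal_single => //.
  by rewrite -tn -tE.
case: ou Hu => [u|] Hu; last exact: single sT Hu.
case: ov Hv => [v|] Hv; last exact: single sS Hv.
have [u1 [u2 [uE ut /parent_siblings[wu]]]] := Hu; rewrite -uE => sibT.
have [v1 [v2 [vE vt /parent_siblings[wv]]]] := Hv; rewrite -vE => sibS.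
have := within_postorder T; have po := size_postorder T; rewrite sT in po *.
move=> postT; apply: (within_bind_eq postT); first by clear -nn n0; lia.
apply: (@within_bind_eq _ _ _ _ (rev (leaves T)) (4 * n)); [| by clear -nn n0; lia |].
  apply: within_weaken.
  - apply: (within_lfold_eq (k := 0) (g := fun js u => if u is Leaf j then j :: js else js)).
    by move=> js [j|t1 t2] _; apply: within_ret.
  - by move: po; set m := size _; clear -n0; lia.
  by move=> _ <-; rewrite foldl_leaves cats0.
apply: within_bind; [exact: (within_below_table sT) | by clear -nn n0; lia |].
move=> leT leTP; apply: within_bind; [exact: (within_below_table sS) | by clear -nn n0; lia |].
move=> leS leSP.
have jsE : perm_eq (rev (leaves T)) (enum 'I_n).
  by rewrite perm_rev; apply: leavesT.
apply: within_weaken.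
- exact: (within_step2 leTP leSP jsE ut sibT vt sibS RP RC RU RS eXY).
- by clear -nn n0; lia.
by [].
Qed.

End Insertion.

Theorem theorem1p3 :
  exists C : nat, forall (n : nat) (G : tanglegram n) (i : 'I_n),
    planar_induced G [set~ i] ->
    insertion G i <> [::] /\
    forall (o : option (layout n)) (time space : nat),
      (o, (time, space)) \in insertion G i ->
      exists XY : layout n,
        [/\ o = Some XY, solves_insertion G i XY,
            time <= C * n ^ 2 & space <= C * n ^ 2].
Proof.
exists 1200 => n G i /within_insertion[ne run]; split=> // o time space oin.
suff /run[XY /= oE [sXY tC sC]] : List.In (o, (time, space)) (insertion G i) by exists XY.
elim: (insertion G i) oin => //= r l IH; rewrite inE => /predU1P[<-|/IH]; [left | right] => //.
Qed.
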